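(* Let $\mathbf{S}=\mathbf{X}^{(1)}+\cdots+\mathbf{X}^{(n)}$ where $\mathbf{X}^{(1)},\ldots,\mathbf{X}^{(n)}$ are independent $\mathbb{R}^q$-valued random variables, and suppose that $|\mathbf{X}^{(j)}_i-\mathbb{E}[\mathbf{X}^{(j)}_i]|\le\tau$ with probability $1$ for all $i\in[q]$ and $j\in[n]$. Let $\mathcal{G}$ be the $q$-dimensional Gaussian with the same mean and covariance matrix as $\mathbf{S}$, and let $\mathcal{O}$ be a union of orthants in $\mathbb{R}^q$. Then for all $r>0$, \[\big|\Pr[\mathbf{S}\in\mathcal{O}]-\Pr[\mathcal{G}\in\mathcal{O}]\big| = O\Bigg(\frac{\tau q^{3/2}\log n}{r}+\sum_{i=1}^q\frac{r+\tau}{\big(\sum_{j=1}^n\mathrm{Var}[\mathbf{X}^{(j)}_i]\big)^{1/2}}\Bigg).\]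
   Context: An orthant of $\mathbb{R}^q$ is a set of the form $\{x\in\mathbb{R}^q:\mathrm{sign}(x_i)=b_i\text{ for all }i\in[q]\}$ for some $b\in\{-1,1\}^q$, where $\mathrm{sign}(t)=1$ if $t\ge0$ and $-1$ if $t<0$. The implied constant in $O(\cdot)$ is absolute. *)

(* Defs.v *)
From HB Require Import structures.
From mathcomp Require Export all_boot all_order all_algebra.
From mathcomp Require Export all_classical all_reals all_analysis.

Set Implicit Arguments.
Unset Strict Implicit.
Unset Printing Implicit Defensive.

Import Order.TTheory GRing.Theory Num.Theory.
Import numFieldNormedType.Exports.

Local Open Scope classical_set_scope.
Local Open Scope ring_scope.

(* R^q is [q.-tuple R], whose library sigma-algebra is the one generated by
   the coordinate projections [tnth ^~ i], i.e. the Borel sigma-algebra. *)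

(* This is not [Num.sg]: here sign 0 = 1. *)
Definition sign (R : realType) (t : R) : R := if 0 <= t then 1 else -1.

Definition is_orthant (R : realType) (q : nat) (A : set (q.-tuple R)) : Prop :=
  exists b : 'I_q -> R, (forall i, b i = 1 \/ b i = -1) /\
    A = [set x | forall i, sign (tnth x i) = b i].

Definition is_union_of_orthants (R : realType) (q : nat)
    (O : set (q.-tuple R)) : Prop :=
  exists F : set (set (q.-tuple R)),
    (forall A, F A -> is_orthant A) /\ O = \bigcup_(A in F) A.

(* The product rule for subfamilies is the case where some [B j] are [setT]. *)
Definition independent_RVs (d d' : measure_display) (T : measurableType d)
    (T' : measurableType d') (R : realType) (P : probability T R) (n : nat)
    (X : 'I_n -> {RV P >-> T'}) : Prop :=
  forall B : 'I_n -> set T', (forall j, measurable (B j)) ->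
    P (\bigcap_(j in [set: 'I_n]) (X j @^-1` B j)) =
    (\prod_(j < n) P (X j @^-1` B j))%E.

Definition component (T : Type) (R : realType) (q : nat) (V : T -> q.-tuple R)
    (i : 'I_q) : T -> R :=
  fun w => tnth (V w) i.

Definition sum_RV (d : measure_display) (T : measurableType d) (R : realType)
    (P : probability T R) (q n : nat) (X : 'I_n -> {RV P >-> q.-tuple R}) :
    T -> q.-tuple R :=
  fun w => [tuple \sum_(j < n) component (X j) i w | i < q].

(* Normal law with mean [m] and standard deviation [s], degenerate for s = 0
   (where the library's [normal_prob m 0] is a uniform law instead). *)
Definition gaussian_law (R : realType) (m s : R) (A : set R) : \bar R :=
  if s == 0 then \d_m A else normal_prob m s A.

(* Possibly degenerate (singular covariance): every linear combination of the
   coordinates is univariate Gaussian. *)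
Definition gaussian_vector (d : measure_display) (T : measurableType d)
    (R : realType) (Q : probability T R) (q : nat)
    (G : {RV Q >-> q.-tuple R}) : Prop :=
  forall a : 'I_q -> R, exists m s : R, 0 <= s /\
    forall A : set R, measurable A ->
      Q ((fun w => \sum_(i < q) a i * component G i w) @^-1` A) =
      gaussian_law m s A.

Definition same_mean_and_covariance (d d' : measure_display)
    (T : measurableType d) (T' : measurableType d') (R : realType)
    (P : probability T R) (Q : probability T' R) (q : nat)
    (S : T -> q.-tuple R) (G : T' -> q.-tuple R) : Prop :=
  (forall i, ('E_Q[component G i] = 'E_P[component S i])%E) /\
  (forall i k, covariance Q (component G i) (component G k) =
               covariance P (component S i) (component S k)).

(* Main.v *)
(** A Stein/Lindeberg interpolation. Replacing the indicator of the union of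
    orthants by the multilinear extension of its Boolean function, composed with
    a smooth step of width [r] in each coordinate, costs at most the probability
    that some coordinate falls in a window of width about [r] around 0. For
    [G_i] that probability is bounded by the Gaussian density, and for [S_i] by
    Stein's argument, which gives [O((r + tau) / sigma_i)].

    The gradient of the multilinear extension has l2 norm [O(1 / r)], by the
    variance decomposition over independent bits. Let [H_t] be the heat
    semigroup of the covariance [Sigma] of [G]. The smoothed probabilities are
    compared along [theta |-> E ((H_(cos theta ^ 2) f) (sin theta * S))] (for
    centered [S]), whose derivative is a sum over [j] of third-order Taylor
    remainders. Two of the three derivatives are absorbed by the Gaussian
    kernel, at the price of the weights [X_j Sigma^+ X_j^T], whose expectations
    sum to at most [rank Sigma <= q];
    [log n] is the integral of the resulting singularity [tan theta], cut off at
    [cos theta = 1 / sqrt n], beyond which absorbing one derivative is enough.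

    The test functions are trigonometric polynomials: on them [H_t] and all
    derivatives act coefficientwise, so that no differentiation under the
    integral sign is needed. The smooth step is a Bernstein polynomial of a
    quadratic spline evaluated at [sin (t / L)]. *)
From HB Require Import structures.
Require Import Defs.
From mathcomp Require Import measurable_realfun ring lra.
Set Implicit Arguments.
Unset Strict Implicit.
Unset Printing Implicit Defensive.
Import Order.TTheory GRing.Theory Num.Theory.
Import numFieldNormedType.Exports.
Local Open Scope classical_set_scope.
Local Open Scope ring_scope.

(** The power [q^(3/2)] has two sources. One derivative falls on the test function along a summand
    with coordinates at most [tau], and the l2 gradient bound makes this cost [tau * sqrt q / r];
    the other factor [q] is the rank bound for the weights. As [Sigma] may be singular, the kernel
    absorbs only directions in its row space. Each centered summand lies there almost surely; it is
    set to 0 on the exceptional null set, and where it exceeds [tau], so that both properties hold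
    at every outcome and the Taylor estimates can be pointwise. A periodic test function cannot
    follow an indicator far from the origin. The smooth step is allowed an extra error
    [eta * (1 + t^2)], paid for by second moments. Its derivative bounds are free of [eta], so
    letting [eta] tend to 0 removes this cost. If some [sigma_i <= tau], one term of the sum is at
    least 1 and the bound is trivial. Otherwise [n >= 2], because [sigma_i^2 <= n * tau^2]; then
    [log n] is bounded below and absorbs the additive constant of the interpolation. *)

(** * One-variable calculus: increments and Taylor remainders *)

Section Calculus.
Variable R : realType.
Implicit Types (f g df dg : R -> R) (a b x h M : R).

(** Both [g - f] and [g + f] are nondecreasing. This replaces the integration of a derivative bound:
    in the interpolation [g] is a negative multiple of [ln cos] or of [cos]. *)
Lemma norm_increment_le f df g dg a b : a <= b ->
  (forall x, a <= x <= b -> is_derive x 1 f (df x)) ->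
  (forall x, a <= x <= b -> is_derive x 1 g (dg x)) ->
  (forall x, a <= x <= b -> `|df x| <= dg x) ->
  `|f b - f a| <= g b - g a.
Proof.
move=> ab hf hg hle.
have inab x : x \in `]a, b[ -> a <= x <= b.
  by rewrite in_itv/= => /andP[/ltW -> /ltW ->].
have incc x : x \in `[a, b] -> a <= x <= b by rewrite in_itv.
have key (k dk : R -> R) : (forall x, a <= x <= b -> is_derive x 1 k (dk x)) ->
    (forall x, a <= x <= b -> 0 <= dk x) -> k a <= k b.
  move=> hk dk0.
  have [||c cab kE] := @MVT_segment _ k dk a b ab.
  - by move=> x /inab /hk.
  - apply: derivable_within_continuous => x /incc /hk H.
    exact: (@ex_derive _ _ _ _ _ _ _ H).
  - rewrite -subr_ge0 kE mulr_ge0 ?subr_ge0//.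
    exact/dk0/incc.
have h1 : (g - f) a <= (g - f) b.
  apply: (key _ (fun x => dg x - df x)) => x xab.
    exact: (is_deriveB (hg _ xab) (hf _ xab)).
  by have := hle _ xab; rewrite ler_norml => /andP[]; lra.
have h2 : (g + f) a <= (g + f) b.
  apply: (key _ (fun x => dg x + df x)) => x xab.
    exact: (is_deriveD (hg _ xab) (hf _ xab)).
  by have := hle _ xab; rewrite ler_norml => /andP[]; lra.
move: h1 h2; rewrite !fctE ler_norml => ? ?; apply/andP; split; lra.
Qed.

Lemma is_derive_affine (c k x : R) : is_derive x 1 (fun t : R => c + k * t) k.
Proof.
have H : is_derive x 1 (cst c + k \*: id) (0 + k *: 1).
  by apply: is_deriveD.
by apply: is_derive_eq H _; rewrite add0r /GRing.scale/= mulr1.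
Qed.

Lemma is_derive_comp_affine f l (c k x : R) :
  is_derive (c + k * x) 1 f l -> is_derive x 1 (fun t => f (c + k * t)) (l * k).
Proof.
move=> hf.
exact: (@is_derive1_comp _ f (fun t => c + k * t) x l k hf (is_derive_affine c k x)).
Qed.

Lemma is_derive_sqr_half M x : is_derive x 1 (fun t => M * t ^+ 2 / 2) (M * x).
Proof.
have H : is_derive x 1 ((M / 2) \*: (id ^+ 2)) ((M / 2) *: ((2%:R * x ^+ 1) *: 1)).
  exact: is_deriveZ.
have -> : (fun t : R => M * t ^+ 2 / 2) = (M / 2) \*: (id ^+ 2).
  by apply/funext => t; rewrite !fctE -[RHS]/(M / 2 * t ^+ 2); field.
by apply: is_derive_eq H _; rewrite -[LHS]/(M / 2 * (2 * x ^+ 1 * 1)); field.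
Qed.

Lemma lipschitz_derive f df M x h :
  (forall y : R, is_derive y 1 f (df y)) -> (forall y : R, `|df y| <= M) ->
  `|f (x + h) - f x| <= M * `|h|.
Proof.
move=> hf hM.
(* The increment lemma wants an interval going right from 0; a negative [h] is [-1] times its
   absolute value, so the sign travels in [k]. *)
have pos (k : R) : `|f (x + k * `|h|) - f x| <= M * `|k| * `|h|.
  have H := @norm_increment_le (fun t => f (x + k * t))
    (fun t => df (x + k * t) * k) (fun t => 0 + M * `|k| * t)
    (fun=> M * `|k|) 0 `|h| (normr_ge0 h).
  rewrite !mulr0 !addr0 add0r subr0 in H.
  apply: H => t _.
  - exact: is_derive_comp_affine.
  - exact: is_derive_affine.
  - by rewrite normrM ler_wpM2r.
have [h0|h0] := leP 0 h.
  by have := pos 1; rewrite normr1 mulr1 mul1r (ger0_norm h0).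
by have := pos (-1); rewrite normrN1 mulr1 mulN1r (ltr0_norm h0) opprK.
Qed.

Lemma taylor2_derive f df ddf M x h :
  (forall y : R, is_derive y 1 f (df y)) -> (forall y : R, is_derive y 1 df (ddf y)) ->
  (forall y : R, `|ddf y| <= M) ->
  `|f (x + h) - f x - h * df x| <= M * h ^+ 2 / 2.
Proof.
move=> hf hdf hM.
have pos (k : R) : `|k| = 1 ->
    `|f (x + k * `|h|) - f x - k * `|h| * df x| <= M * `|h| ^+ 2 / 2.
  move=> k1.
  have H := @norm_increment_le (fun t => f (x + k * t) - (0 + k * df x * t))
    (fun t => df (x + k * t) * k - k * df x) (fun t => M * t ^+ 2 / 2)
    (fun t => M * t) 0 `|h| (normr_ge0 h).
  have -> : f (x + k * `|h|) - f x - k * `|h| * df x =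
    (f (x + k * `|h|) - (0 + k * df x * `|h|)) - (f (x + k * 0) - (0 + k * df x * 0)).
    by rewrite mulr0 addr0; ring.
  have -> : M * `|h| ^+ 2 / 2 = M * `|h| ^+ 2 / 2 - M * 0 ^+ 2 / 2.
    by rewrite expr0n/= mulr0 mul0r subr0.
  apply: H => t /andP[t0 _].
  - apply: (@is_deriveB _ _ _ (fun t => f (x + k * t)) (fun t => 0 + k * df x * t)).
      exact: is_derive_comp_affine.
    exact: is_derive_affine.
  - exact: is_derive_sqr_half.
  - rewrite mulrC -mulrBr normrM k1 mul1r.
    have := lipschitz_derive x (k * t) hdf hM.
    by rewrite normrM k1 mul1r (ger0_norm t0).
have [h0|h0] := leP 0 h.
  by have := pos 1 (normr1 _); rewrite mul1r (ger0_norm h0).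
by have := pos (-1) (normrN1 _); rewrite mulN1r (ltr0_norm h0) opprK sqrrN.
Qed.

Lemma cos_taylor2 x h : `|cos (x + h) - cos x + h * sin x| <= h ^+ 2 / 2.
Proof.
have := @taylor2_derive cos (fun y => - sin y) (fun y => - cos y) 1 x h.
by rewrite mul1r mulrN opprK; apply => y; rewrite normrN cos_max.
Qed.

(** Prepares differentiation under an expectation without dominated convergence: a quadratic Taylor
    remainder stays quadratic after averaging. *)
Lemma is_derive_quadratic_error f a l M :
  (forall h, `|f (a + h) - f a - h * l| <= M * h ^+ 2) -> is_derive a 1 f l.
Proof.
move=> hM.
have M0 : 0 <= M by have := hM 1; rewrite expr1n mulr1; apply: le_trans.
have cv : h^-1 *: (f (h *: (1 : R) + a) - f a) @[h --> 0^'] --> l.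
  apply/cvgrPdist_le => /= e e0.
  have : \forall h \near (0 : R)^', `|h| <= e / (M + 1).
    apply: dnbhs0_le; apply: divr_gt0 => //; lra.
  move=> H; near=> h.
  have h0 : h != 0 by near: h; exact: nbhs_dnbhs_neq.
  have hle : `|h| <= e / (M + 1) by near: h.
  have hn : 0 < `|h| by rewrite normr_gt0.
  rewrite /GRing.scale/= mulr1 (addrC h a).
  have -> : l - h^-1 * (f (a + h) - f a) = - h^-1 * (f (a + h) - f a - h * l).
    by field.
  rewrite normrM normrN normfV ler_pdivrMl//.
  apply: le_trans (hM h) _; rewrite -real_normK ?num_real// expr2 mulrA mulrC.
  rewrite ler_pM2l//.
  have M1 : 0 < M + 1 by lra.
  have : M * `|h| <= M * (e / (M + 1)) by rewrite ler_wpM2l.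
  move/le_trans; apply.
  by rewrite mulrCA ler_piMr ?(ltW e0)// ler_pdivrMr// mul1r; lra.
apply: DeriveDef; first by apply/cvg_ex; exists l.
exact: cvg_lim cv.
Unshelve. all: by end_near. Qed.

End Calculus.

(** * Trigonometric polynomials: derivatives, heat semigroup, products *)

Section TrigonometricPolynomials.
Variables (R : realType) (q : nat).
Implicit Types (u v x b : 'rV[R]_q) (t : R).

Definition dot u v : R := \sum_i u 0 i * v 0 i.

Lemma dotC u v : dot u v = dot v u.
Proof. by apply: eq_bigr => i _; rewrite mulrC. Qed.

Lemma dotDr u v w : dot u (v + w) = dot u v + dot u w.
Proof. by rewrite -big_split; apply: eq_bigr => i _; rewrite mxE mulrDr. Qed.

Lemma dotDl u v w : dot (u + v) w = dot u w + dot v w.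
Proof. by rewrite dotC dotDr !(dotC w). Qed.

Lemma dotZr t u v : dot u (t *: v) = t * dot u v.
Proof. by rewrite mulr_sumr; apply: eq_bigr => i _; rewrite mxE mulrCA. Qed.

Lemma dotZl t u v : dot (t *: u) v = t * dot u v.
Proof. by rewrite dotC dotZr dotC. Qed.

Lemma dotNr u v : dot u (- v) = - dot u v.
Proof. by rewrite -scaleN1r dotZr mulN1r. Qed.

Lemma dotNl u v : dot (- u) v = - dot u v.
Proof. by rewrite dotC dotNr dotC. Qed.

Lemma dot_sumr (I : finType) u (V : I -> 'rV[R]_q) :
  dot u (\sum_i V i) = \sum_i dot u (V i).
Proof.
rewrite /dot exchange_big /=; apply: eq_bigr => i _.
by rewrite summxE mulr_sumr.
Qed.

(* The entry (c, xi, phi) stands for the monomial [c * cos (dot xi x + phi)]. *)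
Definition trig : Type := seq (R * 'rV[R]_q * R).
Implicit Types s : trig.

Definition ev s x : R := \sum_(a <- s) a.1.1 * cos (dot a.1.2 x + a.2).

(** Directional derivative along [b]: as [- sin y = cos (y + pi / 2)], a quarter-period phase shift
    keeps the list in cosine form. *)
Definition trigD b s : trig :=
  [seq (a.1.1 * dot a.1.2 b, a.1.2, a.2 + pi / 2) | a <- s].

(** Heat semigroup at time [t]: the frequency [xi] is damped by [exp (- t Q(xi) / 2)], the
    characteristic function of a centered Gaussian with form [t * Q]. *)
Definition trigH (Q : 'rV[R]_q -> R) t s : trig :=
  [seq (a.1.1 * expR (- (t * Q a.1.2 / 2)), a.1.2, a.2) | a <- s].

Lemma ev_trigD b s x :
  ev (trigD b s) x = - \sum_(a <- s) a.1.1 * dot a.1.2 b * sin (dot a.1.2 x + a.2).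
Proof.
rewrite /ev /trigD big_map -sumrN; apply: eq_bigr => a _ /=.
by rewrite addrA cosDpihalf mulrN.
Qed.

Lemma ev_trigDD b s x : ev (trigD b (trigD b s)) x =
  - \sum_(a <- s) a.1.1 * dot a.1.2 b ^+ 2 * cos (dot a.1.2 x + a.2).
Proof.
rewrite ev_trigD big_map; congr (- _); apply: eq_bigr => a _ /=.
by rewrite addrA sinDpihalf expr2 !mulrA.
Qed.

Lemma trigHD Q b t s : trigH Q t (trigD b s) = trigD b (trigH Q t s).
Proof.
rewrite /trigH /trigD -!map_comp; apply: eq_map => a /=.
by rewrite mulrAC.
Qed.

Lemma trigHH Q t t' s : trigH Q t (trigH Q t' s) = trigH Q (t + t') s.
Proof.
rewrite /trigH -!map_comp; apply: eq_map => a /=.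
rewrite -mulrA -expRD; congr (_ * expR _, _, _).
by rewrite mulrDl [in RHS]mulrDl opprD addrC.
Qed.

Lemma is_derive_ev s x b t :
  is_derive t 1 (fun r : R => ev s (x + r *: b)) (ev (trigD b s) (x + t *: b)).
Proof.
rewrite ev_trigD /ev; elim: s => [|a s IH].
  have -> : (fun r : R => \sum_(a <- [::]) a.1.1 * cos (dot a.1.2 (x + r *: b) + a.2))
    = cst (0 : R) by apply/funext => r; rewrite big_nil.
  by rewrite big_nil oppr0; exact: is_derive_cst.
under eq_fun do rewrite big_cons.
rewrite big_cons opprD.
apply: (is_deriveD _ IH).
set c := dot a.1.2 x + a.2; set k := dot a.1.2 b.
have dE r : dot a.1.2 (x + r *: b) + a.2 = c + k * r.
  by rewrite dotDr dotZr /c /k; ring.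
under eq_fun do rewrite dE.
have H : is_derive t 1 (a.1.1 \*: (fun r => cos (c + k * r)))
    (a.1.1 *: (- sin (c + k * t) * k)).
  by apply: is_deriveZ; apply: is_derive_comp_affine.
apply: is_derive_eq H _.
by rewrite dE -[LHS]/(a.1.1 * (- sin (c + k * t) * k)); ring.
Qed.

Lemma ev_lipschitz s x b t M : (forall y, `|ev (trigD b s) y| <= M) ->
  `|ev s (x + t *: b) - ev s x| <= M * `|t|.
Proof.
move=> hM.
have := @lipschitz_derive _ (fun r => ev s (x + r *: b)) _ M 0 t
  (is_derive_ev s x b).
by rewrite add0r scale0r addr0; apply => r; exact: hM.
Qed.

Lemma ev_taylor2 s x b t M : (forall y, `|ev (trigD b (trigD b s)) y| <= M) ->
  `|ev s (x + t *: b) - ev s x - t * ev (trigD b s) x| <= M * t ^+ 2 / 2.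
Proof.
move=> hM.
have := @taylor2_derive _ (fun r => ev s (x + r *: b)) _ _ M 0 t
  (is_derive_ev s x b) (is_derive_ev (trigD b s) x b).
by rewrite add0r scale0r addr0; apply => r; exact: hM.
Qed.

Lemma ev_cat s s' x : ev (s ++ s') x = ev s x + ev s' x.
Proof. by rewrite /ev big_cat. Qed.

Definition is_trig (f : 'rV[R]_q -> R) := exists s, forall x, f x = ev s x.

Lemma eq_is_trig (f g : 'rV[R]_q -> R) : f =1 g -> is_trig f -> is_trig g.
Proof. by move=> fg [s hs]; exists s => x; rewrite -fg hs. Qed.

Lemma is_trig_cst (c : R) : is_trig (fun=> c).
Proof.
exists [:: (c, 0, 0)] => x; rewrite /ev big_seq1 /= addr0.
by rewrite (_ : dot _ _ = 0) ?cos0 ?mulr1// /dot big1// => i _; rewrite mxE mul0r.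
Qed.

Lemma is_trigD f g : is_trig f -> is_trig g -> is_trig (fun x => f x + g x).
Proof. by move=> [s hs] [s' hs']; exists (s ++ s') => x; rewrite ev_cat hs hs'. Qed.

Lemma is_trig_cos xi (phi : R) : is_trig (fun x => cos (dot xi x + phi)).
Proof. by exists [:: (1, xi, phi)] => x; rewrite /ev big_seq1/= mul1r. Qed.

Lemma is_trigZ (c : R) f : is_trig f -> is_trig (fun x => c * f x).
Proof.
move=> [s hs]; exists [seq (c * a.1.1, a.1.2, a.2) | a <- s] => x.
rewrite hs /ev big_map mulr_sumr; apply: eq_bigr => a _ /=; exact: mulrA.
Qed.

Lemma cosMcos (a b : R) : cos a * cos b = (cos (a + b) + cos (a - b)) / 2.
Proof. by rewrite cosB cosD; field. Qed.

(** Product-to-sum formula, monomial by monomial. This closure admits polynomials in sines and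
    products over coordinates as test functions. *)
Lemma is_trigM f g : is_trig f -> is_trig g -> is_trig (fun x => f x * g x).
Proof.
move=> [s hs] [s' hs'].
suff : is_trig (fun x => ev s x * ev s' x).
  by apply: eq_is_trig => x; rewrite hs hs'.
elim: s {hs} => [|a s IH].
  apply: eq_is_trig (is_trig_cst 0) => x; by rewrite /ev big_nil mul0r.
have {}IH : is_trig (fun x => cos (dot a.1.2 x + a.2) * ev s' x) ->
    is_trig (fun x => ev (a :: s) x * ev s' x).
  move=> /(is_trigZ a.1.1) /is_trigD /(_ IH).
  by apply: eq_is_trig => x; rewrite [in RHS]/ev big_cons mulrDl mulrA.
apply: IH; elim: s' {hs'} => [|a' s' IH].
  apply: eq_is_trig (is_trig_cst 0) => x; by rewrite /ev big_nil mulr0.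
have H := is_trigZ (a'.1.1 / 2) (is_trigD (is_trig_cos (a.1.2 + a'.1.2) (a.2 + a'.2))
     (is_trig_cos (a.1.2 - a'.1.2) (a.2 - a'.2))).
apply: eq_is_trig (is_trigD H IH) => x.
rewrite [in RHS]/ev big_cons [in RHS]mulrDr; congr (_ + _).
rewrite mulrCA cosMcos dotDl dotDl dotNl !mulrA mulrAC -!mulrA; congr (_ * (_ * _)).
by congr (cos _ + cos _); ring.
Qed.

End TrigonometricPolynomials.

(** * Real-valued expectation and integrability *)

Section Expectation.
Context d (T : measurableType d) (R : realType) (P : probability T R).
Implicit Types (f g : T -> R) (M : R).

Definition Ex f : R := \int[P]_w f w.
Definition integ f : Prop := P.-integrable setT (EFin \o f).

Lemma integ_measurable f : integ f -> measurable_fun setT f.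
Proof. by move=> /measurable_int /measurable_EFinP. Qed.

Lemma integ_le f g : measurable_fun setT f -> integ g ->
  (forall w, `|f w| <= g w) -> integ f.
Proof.
move=> mf ig fg; apply: le_integrable ig => //; first exact/measurable_EFinP.
move=> w _ /=; rewrite lee_fin; apply: le_trans (fg w) _; exact: ler_norm.
Qed.

Lemma integ_cst (c : R) : integ (fun=> c).
Proof. exact: finite_measure_integrable_cst. Qed.

Lemma integ_bounded f M : measurable_fun setT f -> (forall w, `|f w| <= M) -> integ f.
Proof. by move=> mf; apply: integ_le => //; exact: integ_cst. Qed.

Lemma integD f g : integ f -> integ g -> integ (fun w => f w + g w).
Proof. exact: integrableD. Qed.

Lemma integZ c f : integ f -> integ (fun w => c * f w).
Proof. exact: integrableZl. Qed.

Lemma integN f : integ f -> integ (fun w => - f w).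
Proof.
by move=> /(integZ (-1)); congr integ; apply/funext => w; rewrite mulN1r.
Qed.

Lemma integB f g : integ f -> integ g -> integ (fun w => f w - g w).
Proof. by move=> hf hg; apply: integD => //; exact: integN. Qed.

Lemma integ_sum (I : Type) (r : seq I) (F : I -> T -> R) :
  (forall i, integ (F i)) -> integ (fun w => \sum_(i <- r) F i w).
Proof.
move=> hF; elim: r => [|i r IH].
  by under eq_fun do rewrite big_nil; exact: integ_cst.
by under eq_fun do rewrite big_cons; exact: integD.
Qed.

Lemma integ_norm f : integ f -> integ (fun w => `|f w|).
Proof. by move=> hf; have := integrable_norm hf. Qed.

Lemma integ_mul_bounded f g M : integ f -> measurable_fun setT g ->
  (forall w, `|g w| <= M) -> integ (fun w => f w * g w).
Proof.
move=> hf mg gM.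
apply: integ_le (integZ M (integ_norm hf)) _.
  by apply: measurable_funM => //; exact: integ_measurable.
by move=> w; rewrite normrM mulrC ler_wpM2r.
Qed.

Lemma integ_sqr f : measurable_fun setT f -> integ (fun w => f w ^+ 2) -> integ f.
Proof.
move=> mf hf2; apply: integ_le (integD (integ_cst 1) hf2) _ => // w.
have := sqr_ge0 (`|f w| - 1); rewrite sqrrB -normrX ger0_norm ?sqr_ge0//.
have := sqr_ge0 (f w); have := normr_ge0 (f w); lra.
Qed.

Lemma ExD f g : integ f -> integ g -> Ex (fun w => f w + g w) = Ex f + Ex g.
Proof. by move=> hf hg; rewrite /Ex RintegralD. Qed.

Lemma ExZ c f : integ f -> Ex (fun w => c * f w) = c * Ex f.
Proof. by move=> hf; rewrite /Ex RintegralZl. Qed.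

Lemma ExN f : integ f -> Ex (fun w => - f w) = - Ex f.
Proof.
by move=> hf; rewrite -mulN1r -ExZ//; congr Ex; apply/funext => w; rewrite mulN1r.
Qed.

Lemma ExB f g : integ f -> integ g -> Ex (fun w => f w - g w) = Ex f - Ex g.
Proof. by move=> hf hg; rewrite ExD ?ExN//; exact: integN. Qed.

Lemma Ex_cst c : Ex (fun=> c) = c.
Proof. by rewrite /Ex Rintegral_cst//= probability_setT mulr1. Qed.

Lemma Ex_sum (I : Type) (r : seq I) (F : I -> T -> R) :
  (forall i, integ (F i)) ->
  Ex (fun w => \sum_(i <- r) F i w) = \sum_(i <- r) Ex (F i).
Proof.
move=> hF; elim: r => [|i r IH].
  by under eq_fun do rewrite big_nil; rewrite Ex_cst big_nil.
under eq_fun do rewrite big_cons.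
by rewrite ExD ?IH ?big_cons//; exact: integ_sum.
Qed.

Lemma Ex_le f g : integ f -> integ g -> (forall w, f w <= g w) -> Ex f <= Ex g.
Proof. by move=> hf hg fg; apply: le_Rintegral. Qed.

Lemma Ex_ge0 f : (forall w, 0 <= f w) -> 0 <= Ex f.
Proof. by move=> f0; apply: Rintegral_ge0. Qed.

Lemma normr_Ex_le f g : integ f -> integ g -> (forall w, `|f w| <= g w) ->
  `|Ex f| <= Ex g.
Proof.
move=> hf hg fg; apply: le_trans (le_normr_Rintegral measurableT hf) _.
by apply: Ex_le => //; exact: integ_norm.
Qed.

Lemma normr_Ex_le_cst f M : integ f -> (forall w, `|f w| <= M) -> `|Ex f| <= M.
Proof.
by move=> hf fM; rewrite -[M]Ex_cst; apply: normr_Ex_le => //; exact: integ_cst.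
Qed.

(** Jensen for the square: the variance of [|f|] about its mean [m] is nonnegative. *)
Lemma Ex_sqr_norm_le f : integ (fun w => f w ^+ 2) -> measurable_fun setT f ->
  Ex (fun w => `|f w|) ^+ 2 <= Ex (fun w => f w ^+ 2).
Proof.
move=> hf2 mf; have hf := integ_norm (integ_sqr mf hf2).
set m := Ex _; have : 0 <= Ex (fun w => (`|f w| - m) ^+ 2).
  by apply: Ex_ge0 => w; exact: sqr_ge0.
have -> : (fun w => (`|f w| - m) ^+ 2) =
    (fun w => f w ^+ 2 + ((- (2 * m)) * `|f w| + m ^+ 2)).
  by apply/funext => w; rewrite -[f w ^+ 2]real_normK ?num_real//; ring.
rewrite ExD//; last by apply: integD; [exact: integZ|exact: integ_cst].
rewrite ExD//; [|exact: integZ|exact: integ_cst].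
rewrite ExZ// Ex_cst -/m; lra.
Qed.

Lemma Ex_probability (A : set T) : measurable A -> Ex (\1_A) = fine (P A).
Proof. by move=> mA; rewrite /Ex /Rintegral integral_indic// setIT. Qed.

Lemma integ_indic (A : set T) : measurable A -> integ (\1_A).
Proof.
move=> mA; apply: (@integ_bounded _ 1); first exact: measurable_indic.
by move=> w; rewrite indicE; case: (_ \in _); rewrite ?normr1 ?normr0.
Qed.

(** The Taylor remainder of cosine is at most [(h * Y)^2 / 2], so its expectation is quadratic in
    [h], with the second moment of [Y] as constant. *)
Lemma is_derive_Ex_cos (Y Z : T -> R) (a : R) :
  measurable_fun setT Y -> measurable_fun setT Z -> integ (fun w => Y w ^+ 2) ->
  is_derive a 1 (fun t : R => Ex (fun w => cos (t * Y w + Z w)))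
    (- Ex (fun w => Y w * sin (a * Y w + Z w))).
Proof.
move=> mY mZ Y2.
have mA t : measurable_fun setT (fun w => t * Y w + Z w).
  by apply: measurable_funD => //; exact: measurable_funM.
have icos t : integ (fun w => cos (t * Y w + Z w)).
  apply: (@integ_bounded _ 1); last by move=> w; exact: cos_max.
  by apply: measurableT_comp => //; apply: continuous_measurable_fun; exact: continuous_cos.
have isin : integ (fun w => Y w * sin (a * Y w + Z w)).
  apply: (@integ_mul_bounded _ _ 1); first exact: integ_sqr.
  - by apply: measurableT_comp => //; apply: continuous_measurable_fun; exact: continuous_sin.
  - by move=> w; exact: sin_max.
apply: (@is_derive_quadratic_error _ _ _ _ (Ex (fun w => Y w ^+ 2) / 2)) => h.
have -> : Ex (fun w => cos ((a + h) * Y w + Z w)) -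
    Ex (fun w => cos (a * Y w + Z w)) - h * - Ex (fun w => Y w * sin (a * Y w + Z w))
  = Ex (fun w => (cos ((a + h) * Y w + Z w) - cos (a * Y w + Z w)) +
     h * (Y w * sin (a * Y w + Z w))).
  by rewrite ExD ?ExB ?ExZ ?mulrN ?opprK//; [exact: integB|exact: integZ].
have -> : Ex (fun w => Y w ^+ 2) / 2 * h ^+ 2 = Ex (fun w => h ^+ 2 / 2 * Y w ^+ 2).
  by rewrite ExZ//; field.
apply: normr_Ex_le.
- by apply: integD; [exact: integB|exact: integZ].
- exact: integZ.
- move=> w; have := cos_taylor2 (a * Y w + Z w) (h * Y w).
  have -> : a * Y w + Z w + h * Y w = (a + h) * Y w + Z w by ring.
  by rewrite -mulrA exprMn mulrAC.
Qed.

End Expectation.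

(** * The normal law through its density *)

Section NormalLaw.
Variable R : realType.
Local Notation mu := (@lebesgue_measure R).

(** The Radon-Nikodym derivative and [normal_pdf] have the same integral over every measurable set,
    so they agree almost everywhere and the general change of variables applies. *)
Lemma ge0_integral_normal_prob (m s : R) (f : R -> \bar R) :
  measurable_fun setT f -> (forall x, 0 <= f x)%E ->
  (\int[normal_prob m s]_x f x = \int[mu]_x (f x * (normal_pdf m s x)%:E))%E.
Proof.
move=> mf f0.
have dom := normal_prob_dominates m s.
rewrite -(Radon_Nikodym_SigmaFinite.change_of_variables dom)//=.
have irn := Radon_Nikodym_SigmaFinite.f_integrable dom.
apply: ae_eq_integral => //.
- by apply: emeasurable_funM => //; exact: measurable_int irn.
- apply: emeasurable_funM => //; apply/measurable_EFinP.
  exact: measurable_normal_pdf.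
- apply: ae_eqe_mul2l; apply: integral_ae_eq => //.
  + by apply/measurable_EFinP; exact: measurable_normal_pdf.
  + by move=> E _ mE; rewrite -Radon_Nikodym_SigmaFinite.f_integral.
Qed.

(** Fundamental theorem of calculus on growing intervals, passed to the limit by dominated
    convergence. *)
Lemma integral_derivative_eq0 (K dK : R -> R) :
  (forall x : R, is_derive x 1 K (dK x)) -> continuous dK ->
  mu.-integrable setT (EFin \o dK) ->
  K n%:R @[n --> \oo] --> (0 : R) -> K (- n%:R) @[n --> \oo] --> (0 : R) ->
  (\int[mu]_x (dK x)%:E = 0)%E.
Proof.
move=> hK cdK idK Ky KNy.
(* With [n.+1] the interval never shrinks to a point: the fundamental theorem is applied with
   strictly ordered endpoints. *)
pose I (n : nat) : set R := `[- n.+1%:R, n.+1%:R]%classic.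
have cvI : (\int[mu]_x ((EFin \o dK) \_ (I n)) x)%E @[n --> \oo] -->
    (\int[mu]_x (dK x)%:E)%E.
  apply: (@dominated_cvg _ _ _ mu setT measurableT
    (fun n => (EFin \o dK) \_ (I n)) _ (fun x => `|(dK x)%:E|)%E) => //.
  - move=> n; apply/(measurable_restrict _ _ _) => //; first exact: measurable_itv.
    by apply: measurable_funTS; exact: measurable_int idK.
  - move=> x _; apply: cvg_near_cst.
    near=> n; rewrite patchE mem_set//= /I/= in_itv/= -ler_norml.
    near: n; exists `|Num.ceil `|x| |%N => // n /= hn.
    apply: le_trans (_ : (n%:R <= _)); last by rewrite ler_nat.
    apply: le_trans (ceil_ge _) _.
    apply: le_trans (ler_norm _) _.
    by rewrite -intr_norm -[`|_|%Z]abszE -pmulrn ler_nat.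
  - exact: integrable_abse.
  - move=> n x _; rewrite patchE; case: ifPn => //= _; rewrite normr0 lee_fin.
    exact: normr_ge0.
have contK : continuous K.
  move=> x; apply: differentiable_continuous; apply/derivable1_diffP.
  exact: (@ex_derive _ _ _ _ _ _ _ (hK x)).
have IE n : (\int[mu]_x ((EFin \o dK) \_ (I n)) x)%E = (K n.+1%:R - K (- n.+1%:R))%:E.
  rewrite -integral_mkcond/= /I (@continuous_FTC2 _ dK K)//.
  - by rewrite (@lt_trans _ _ 0)// oppr_lt0.
  - by apply: continuous_subspaceT.
  - split; first by move=> x _; exact: (@ex_derive _ _ _ _ _ _ _ (hK x)).
      exact/cvg_at_right_filter/contK.
    exact/cvg_at_left_filter/contK.
  - by move=> x _; rewrite derive1E (@derive_val _ _ _ _ _ _ _ (hK x)).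
have cv0 : (\int[mu]_x ((EFin \o dK) \_ (I n)) x)%E @[n --> \oo] --> (0%:E : \bar R).
  have h : K n.+1%:R - K (- n.+1%:R) @[n --> \oo] --> (0 : R).
    rewrite -[X in _ --> X](subr0 0); apply: cvgB.
      by move: Ky; rewrite -(cvg_shiftS (fun n => K n%:R)).
    by move: KNy; rewrite -(cvg_shiftS (fun n => K (- n%:R))).
  under eq_fun do rewrite IE.
  by apply: cvg_EFin; [near=> n|exact: h].
exact: (cvg_unique _ cvI cv0).
Unshelve. all: by end_near. Qed.

End NormalLaw.

(** * Moments, characteristic function and interval bound of the normal law *)

Section NormalMoments.
Variables (R : realType) (m s : R).
Hypothesis s0 : 0 < s.
Local Notation mu := (@lebesgue_measure R).
Local Notation phi := (normal_pdf m s).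
Local Notation N := (normal_prob m s).

Let sn0 : s != 0. Proof. by rewrite gt_eqF. Qed.

Let phiE x : phi x = normal_peak s * expR (- (x - m) ^+ 2 / (s ^+ 2 *+ 2)).
Proof. by rewrite normal_pdfE. Qed.

Let mphi : measurable_fun setT phi. Proof. exact: measurable_normal_pdf. Qed.

Lemma is_derive_normal_pdf (x : R) : is_derive x 1 phi (- (x - m) / s ^+ 2 * phi x).
Proof.
have -> : phi = normal_peak s \*: (expR \o (fun x => - (x - m) ^+ 2 / (s ^+ 2 *+ 2))).
  by apply/funext => y; rewrite phiE.
have d1 : is_derive x 1 (fun y : R => - (y - m) ^+ 2 / (s ^+ 2 *+ 2))
    (- (x - m) / s ^+ 2).
  have H : is_derive x 1 (fun y => (- (s ^+ 2)^-1) * (- m + 1 * y) ^+ 2 / 2)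
      ((- (s ^+ 2)^-1 * (- m + 1 * x)) * 1).
    exact: (is_derive_comp_affine (is_derive_sqr_half (- (s ^+ 2)^-1) _)).
  have -> : (fun y : R => - (y - m) ^+ 2 / (s ^+ 2 *+ 2)) =
      (fun y => (- (s ^+ 2)^-1) * (- m + 1 * y) ^+ 2 / 2).
    by apply/funext => y; rewrite -(mulr_natr (s ^+ 2)); field.
  by apply: is_derive_eq H _; field.
have d2 := @is_derive1_comp _ expR _ _ _ _ (is_derive_expR _) d1.
apply: is_derive_eq (is_deriveZ (normal_peak s) d2) _.
set E := expR _; rewrite -[LHS]/(normal_peak s * (E * (- (x - m) / s ^+ 2))).
by rewrite -[RHS]/(- (x - m) / s ^+ 2 * (normal_peak s * E)); ring.
Qed.

(** With [u = 3 y^2 / (8 s^2)] the ratio of the two densities is [2 exp (- u)], and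
    [u exp (- u) <= 1]. Domination by a wider normal density gives a finite second moment and decay
    at infinity without computing an integral. *)
Lemma sqr_normal_pdf_le x :
  (x - m) ^+ 2 * phi x <= (16 / 3) * s ^+ 2 * normal_pdf m (2 * s) x.
Proof.
have s20 : 2 * s != 0 by rewrite mulf_neq0.
rewrite phiE (normal_pdfE _ s20) /normal_fun; set y := x - m.
have pk : normal_peak (2 * s) = normal_peak s / 2.
  rewrite /normal_peak.
  have -> : (2 * s) ^+ 2 * pi *+ 2 = 2 ^+ 2 * (s ^+ 2 * pi *+ 2) by rewrite exprMn -mulrA mulrnAr.
  by rewrite sqrtrM ?sqr_ge0// sqrtr_sqr ger0_norm// invfM mulrC.
rewrite pk.
pose u := 3 * y ^+ 2 / (8 * s ^+ 2).
have -> : - y ^+ 2 / (s ^+ 2 *+ 2) = - u + - y ^+ 2 / ((2 * s) ^+ 2 *+ 2).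
  by rewrite -(mulr_natr (s ^+ 2)) -(mulr_natr ((2 * s) ^+ 2)) /u; field.
rewrite expRD; set e := expR (- y ^+ 2 / _).
have e0 : 0 <= e by exact: expR_ge0.
have p0 := normal_peak_ge0 s.
have -> : y ^+ 2 * (normal_peak s * (expR (- u) * e)) =
    8 / 3 * s ^+ 2 * (normal_peak s * e) * (u * expR (- u)).
  by rewrite /u; field.
have -> : 16 / 3 * s ^+ 2 * (normal_peak s / 2 * e) =
  8 / 3 * s ^+ 2 * (normal_peak s * e) * 1 by field.
rewrite ler_wpM2l//.
  by apply: mulr_ge0; [apply: mulr_ge0; [lra|exact: sqr_ge0]|exact: mulr_ge0].
rewrite expRN ler_pdivrMr ?expR_gt0// mul1r.
have := expR_ge1Dx u; lra.
Qed.

Lemma integral_normal_prob (h : R -> R) : integ N h ->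
  mu.-integrable setT (fun x => (h x * phi x)%:E) /\
  (\int[N]_x (h x)%:E = \int[mu]_x (h x * phi x)%:E)%E.
Proof.
move=> ih; have mh := integ_measurable ih.
have mhp : measurable_fun setT (fun x => h x * phi x) by exact: measurable_funM.
split.
  apply/integrableP; split; first exact/measurable_EFinP.
  move/integrableP : ih => [_].
  rewrite ge0_integral_normal_prob//; last first.
    by apply: measurableT_comp => //; exact/measurable_EFinP.
  congr (_ < _)%E; apply: eq_integral => x _ /=.
  by rewrite -EFinM normrM (ger0_norm (normal_pdf_ge0 _ _ _)).
have pE (g : R -> R) : measurable_fun setT g ->
    (\int[N]_x maxe (g x)%:E 0 = \int[mu]_x maxe (g x * phi x)%:E 0)%E.
  move=> mg; rewrite ge0_integral_normal_prob//.
  - apply: eq_integral => x _; rewrite -!EFin_max -EFinM; congr EFin.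
    by rewrite mulrC maxr_pMr ?normal_pdf_ge0// mulr0 mulrC.
  - by apply: measurable_maxe => //; exact/measurable_EFinP.
  - by move=> x; rewrite le_max lexx orbT.
rewrite [LHS]integralE [RHS]integralE.
congr (_ - _)%E.
  apply: etrans (etrans _ (pE h mh)) _; apply: eq_integral => x _;
    by rewrite funeposE.
have mNh : measurable_fun setT (fun x => - h x) by exact: measurableT_comp.
apply: etrans (etrans _ (pE _ mNh)) _; apply: eq_integral => x _;
  by rewrite funenegE ?mulNr.
Qed.

Lemma integ_normal_sqr : integ N (fun x => (x - m) ^+ 2).
Proof.
have m2 : measurable_fun setT (fun x : R => (x - m) ^+ 2).
  by apply: measurable_funX; exact: measurable_funB.
apply/integrableP; split; first exact/measurable_EFinP.
rewrite ge0_integral_normal_prob//; last first.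
  by apply: measurableT_comp => //; exact/measurable_EFinP.
apply: (@le_lt_trans _ _
    (\int[mu]_x ((16 / 3 * s ^+ 2)%:E * (normal_pdf m (2 * s) x)%:E))%E).
  apply: ge0_le_integral => //.
  - by move=> x _; rewrite mule_ge0// lee_fin normal_pdf_ge0.
  - apply: emeasurable_funM; last exact/measurable_EFinP.
    by apply: measurableT_comp => //; exact/measurable_EFinP.
  - apply: emeasurable_funM => //; apply/measurable_EFinP.
    exact: measurable_normal_pdf.
  - move=> x _ /=; rewrite -!EFinM lee_fin ger0_norm ?sqr_ge0//.
    exact: sqr_normal_pdf_le.
rewrite ge0_integralZl//.
- by rewrite integral_normal_pdf mule1 ltry.
- by apply/measurable_EFinP; exact: measurable_normal_pdf.
- by move=> x _; rewrite lee_fin normal_pdf_ge0.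
- by rewrite lee_fin; apply: mulr_ge0; [lra|exact: sqr_ge0].
Qed.

(** Stein's identity: the integrand times the density is the derivative of [F * phi], which vanishes
    at infinity. Mean, variance and characteristic function follow with [F] equal to 1, to [x - m]
    and to a sine. *)
Lemma normal_ibp (F dF : R -> R) (C : R) :
  (forall x : R, is_derive x 1 F (dF x)) -> continuous dF ->
  (forall x, `|F x| <= C * (1 + `|x - m|)) -> (forall x, `|dF x| <= C) ->
  Ex N (fun x => dF x - (x - m) / s ^+ 2 * F x) = 0.
Proof.
move=> hF cdF FC dFC.
have C0 : 0 <= C by apply: le_trans (dFC 0).
have cF : continuous F.
  move=> x; apply: differentiable_continuous; apply/derivable1_diffP.
  exact: (@ex_derive _ _ _ _ _ _ _ (hF x)).
have cphi : continuous phi by exact: continuous_normal_pdf.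
pose h x := dF x - (x - m) / s ^+ 2 * F x.
have ch : continuous h.
  move=> x; apply: cvgB; first exact: cdF.
  apply: cvgM; last exact: cF.
  by apply: cvgMr_tmp; apply: cvgB; [exact: cvg_id|exact: cvg_cst].
have is2 : 0 <= (s ^+ 2)^-1 by rewrite invr_ge0 sqr_ge0.
have ih : integ N h.
  apply: integ_le (integD (integ_cst N (C + 2 * C / s ^+ 2))
     (integZ (2 * C / s ^+ 2) integ_normal_sqr)) _.
    exact: continuous_measurable_fun.
  move=> x; rewrite /h; apply: le_trans (ler_normB _ _) _.
  rewrite -addrA; apply: lerD => //.
  rewrite normrM normrM (ger0_norm is2).
  have y2 : `|x - m| * (1 + `|x - m|) <= 2 + 2 * (x - m) ^+ 2.
    rewrite -(real_normK (num_real (x - m))).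
    by have := sqr_ge0 (`|x - m| - 1); have := sqr_ge0 `|x - m|; nra.
  apply: le_trans (_ : `|x - m| * (s ^+ 2)^-1 * (C * (1 + `|x - m|)) <= _).
    by rewrite ler_wpM2l// mulr_ge0.
  have := ler_wpM2l (mulr_ge0 C0 is2) y2; rewrite -/(x - m).
  set i := (s ^+ 2)^-1; lra.
have dK (x : R) : is_derive x 1 (F * phi) (h x * phi x).
  apply: is_derive_eq (is_deriveM (hF x) (is_derive_normal_pdf x)) _.
  rewrite -[LHS]/(F x * (- (x - m) / s ^+ 2 * phi x) + phi x * dF x) /h; ring.
have [ihp hE] := integral_normal_prob ih.
pose C1 := 16 / 3 * s ^+ 2 * normal_peak (2 * s).
have C10 : 0 <= C1.
  apply: mulr_ge0; last exact: normal_peak_ge0.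
  by apply: mulr_ge0; [lra|exact: sqr_ge0].
have tail (g : nat -> R) : (forall n, n%:R - `|m| <= `|g n - m|) ->
    (F * phi) (g n) @[n --> \oo] --> (0 : R).
  move=> hg; apply/cvgrPdist_le => /= e e0.
  (* At distance [y >= 1] from [m], [|F| <= 2 C y]; with [y^2 phi <= C1] this gives
     [|F| phi <= 2 C C1 / y], which is below [e] once [y >= B]. *)
  pose B := 1 + 2 * C * C1 / e.
  have : \forall n \near \oo, B + `|m| <= n%:R by exact: nbhs_infty_ger.
  apply: filterS => n hn.
  have yB : B <= `|g n - m| by apply: le_trans (hg n); lra.
  set y := `|g n - m| in yB; rewrite sub0r normrN.
  have B1 : 1 <= B.
    rewrite /B lerDl; apply: divr_ge0 (ltW e0).
    exact: (mulr_ge0 (mulr_ge0 (ler0n _ 2) C0) C10).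
  have phi0 := normal_pdf_ge0 m s (g n).
  rewrite -[X in `|X|]/(F (g n) * phi (g n)) normrM (ger0_norm phi0).
  have y0 : 0 < y by lra.
  have y2 : y ^+ 2 * phi (g n) <= C1.
    rewrite /y real_normK ?num_real//; apply: le_trans (sqr_normal_pdf_le _) _.
    rewrite ler_wpM2l//; first by apply: mulr_ge0; [lra|exact: sqr_ge0].
    by apply: normal_pdf_ub; rewrite mulf_neq0.
  have le1 : y * (`|F (g n)| * phi (g n)) <= 2 * C * C1.
    apply: le_trans (_ : y * (C * (1 + y) * phi (g n)) <= _).
      by apply: ler_wpM2l (ltW y0) _ _ _; apply: ler_wpM2r phi0 _ _ (FC _).
    apply: le_trans (_ : 2 * C * (y ^+ 2 * phi (g n)) <= _).
      rewrite -subr_ge0.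
      have -> : 2 * C * (y ^+ 2 * phi (g n)) - y * (C * (1 + y) * phi (g n)) =
        C * phi (g n) * y * (y - 1) by ring.
      by rewrite !mulr_ge0// ?subr_ge0 ?(ltW y0)//; lra.
    by rewrite ler_wpM2l ?mulr_ge0.
  rewrite -(ler_pM2l y0); apply: le_trans le1 _.
  have : 2 * C * C1 / e <= y by rewrite /B in yB; lra.
  by rewrite ler_pdivrMr.
have cdK : continuous (fun x => h x * phi x).
  by move=> x; apply: cvgM; [exact: ch|exact: cphi].
have := integral_derivative_eq0 dK cdK ihp (tail (fun n => n%:R) _)
  (tail (fun n => - n%:R) _).
rewrite -hE => H; rewrite /Ex /Rintegral H//.
- move=> n; have := ler_normD (n%:R - m) m; rewrite subrK normr_nat; lra.
- move=> n; have := ler_normD (- n%:R - m) m; rewrite subrK normrN normr_nat; lra.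
Qed.

Lemma normal_mean : Ex N (fun x => x - m) = 0.
Proof.
have H := @normal_ibp (cst 1) (cst 0) 1.
have {H} : Ex N (fun x => 0 - (x - m) / s ^+ 2 * 1) = 0.
  apply: H => x.
  - exact: cvg_cst.
  - by rewrite normr1 mul1r lerDl.
  - by rewrite normr0.
have -> : (fun x => 0 - (x - m) / s ^+ 2 * 1) = (fun x => - (s ^+ 2)^-1 * (x - m)).
  by apply/funext => x; ring.
rewrite ExZ.
  by move/eqP; rewrite mulf_eq0 oppr_eq0 invr_eq0 expf_eq0/= (negbTE sn0) => /eqP.
apply: integ_sqr; last exact: integ_normal_sqr.
exact: measurable_funB.
Qed.

Lemma normal_variance : Ex N (fun x => (x - m) ^+ 2) = s ^+ 2.
Proof.
have H := @normal_ibp (fun x => - m + 1 * x) (cst 1) 1.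
have {H} : Ex N (fun x => 1 - (x - m) / s ^+ 2 * (- m + 1 * x)) = 0.
  apply: H => x.
  - exact: is_derive_affine.
  - exact: cvg_cst.
  - by rewrite !mul1r (addrC (- m)) lerDr.
  - by rewrite normr1.
have -> : (fun x => 1 - (x - m) / s ^+ 2 * (- m + 1 * x)) =
    (fun x => 1 - (s ^+ 2)^-1 * (x - m) ^+ 2).
  by apply/funext => x; ring.
rewrite ExB; [|exact: integ_cst|exact/integZ/integ_normal_sqr].
rewrite Ex_cst ExZ; last exact: integ_normal_sqr.
move/eqP; rewrite subr_eq0 eq_sym => /eqP E.
have := congr1 ( *%R (s ^+ 2)) E.
by rewrite mulrA divff ?expf_neq0// mul1r mulr1.
Qed.

(** Integration by parts against a sine gives [psi' = - s^2 u psi], so [psi(u) exp (s^2 u^2 / 2)] is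
    constant. The phase [c] carries the real and imaginary parts together. *)
Lemma normal_charfun (t c : R) :
  Ex N (fun x => cos (t * (x - m) + c)) = expR (- (s ^+ 2 * t ^+ 2 / 2)) * cos c.
Proof.
pose psi t := Ex N (fun x => cos (t * (x - m) + c)).
have mY : measurable_fun setT (fun x : R => x - m) by exact: measurable_funB.
have iY : integ N (fun x => x - m).
  by apply: integ_sqr; [exact: mY|exact: integ_normal_sqr].
have marg u : measurable_fun setT (fun x : R => u * (x - m) + c).
  by apply: measurable_funD => //; exact: measurable_funM.
have icos u : integ N (fun x => cos (u * (x - m) + c)).
  apply: (@integ_bounded _ _ _ _ _ 1); last by move=> w; exact: cos_max.
  apply: (measurableT_comp _ (marg u)).
  by apply: continuous_measurable_fun; exact: continuous_cos.
have dpsi : forall u : R, is_derive u 1 psi (- (s ^+ 2 * u * psi u)).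
  move=> u.
  have H := @is_derive_Ex_cos _ _ _ N (fun x => x - m) (cst c) u mY
    (measurable_cst c) integ_normal_sqr.
  apply: is_derive_eq H _; congr (- _).
  have C := @normal_ibp (fun x => sin ((c - u * m) + u * x))
    (fun x => cos ((c - u * m) + u * x) * u) (1 + `|u|).
  have E x : c - u * m + u * x = u * (x - m) + c by ring.
  have {C} : Ex N (fun x => cos (c - u * m + u * x) * u -
      (x - m) / s ^+ 2 * sin (c - u * m + u * x)) = 0.
    apply: C => x.
    - by apply: is_derive_comp_affine; exact: is_derive_sin.
    - apply: cvgMr_tmp; apply: continuous_comp; last exact: continuous_cos.
      by apply: cvgD; [exact: cvg_cst|apply: cvgMl_tmp; exact: cvg_id].
    - apply: le_trans (sin_max _) _; rewrite mulrDr mulr1.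
      rewrite -[leLHS]addr0 lerD ?lerDl// mulr_ge0 ?addr_ge0//.
    - rewrite normrM; apply: le_trans (ler_piMl _ (cos_max _)) _ => //.
      by rewrite lerDr.
  have -> : (fun x => cos (c - u * m + u * x) * u -
      (x - m) / s ^+ 2 * sin (c - u * m + u * x)) =
    (fun x => u * cos (u * (x - m) + c) - (s ^+ 2)^-1 * ((x - m) * sin (u * (x - m) + c))).
    by apply/funext => x; rewrite E; ring.
  have isin : integ N (fun x => (x - m) * sin (u * (x - m) + c)).
    apply: (@integ_mul_bounded _ _ _ _ _ _ 1) => //.
    - apply: (measurableT_comp _ (marg u)).
      by apply: continuous_measurable_fun; exact: continuous_sin.
    - by move=> w; exact: sin_max.
  rewrite ExB ?ExZ//; [|exact: integZ|exact: integZ].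
  rewrite -/(psi u) => /eqP; rewrite subr_eq0 => /eqP K.
  by rewrite -mulrA K mulrA divff ?expf_neq0// mul1r.
have dg : forall u : R,
    is_derive u 1 (psi * (fun v => expR (s ^+ 2 * v ^+ 2 / 2))) 0.
  move=> u.
  have d2 := @is_derive1_comp _ expR _ u _ _ (is_derive_expR _)
    (is_derive_sqr_half (s ^+ 2) u).
  apply: is_derive_eq (is_deriveM (dpsi u) d2) _.
  set e := expR _.
  rewrite -[LHS]/(psi u * (e * (s ^+ 2 * u)) + e * - (s ^+ 2 * u * psi u)); ring.
have := is_derive_0_is_cst t 0 dg.
rewrite -[LHS]/(psi t * expR (s ^+ 2 * t ^+ 2 / 2)).
rewrite -[RHS]/(psi 0 * expR (s ^+ 2 * 0 ^+ 2 / 2)).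
rewrite expr0n/= mulr0 mul0r expR0 mulr1 {2}/psi.
have -> : (fun x => cos (0 * (x - m) + c)) = (fun=> cos c).
  by apply/funext => x; rewrite mul0r add0r.
rewrite Ex_cst => K; rewrite -/(psi t) expRN -K mulrC mulfK//.
by rewrite gt_eqF// expR_gt0.
Qed.

(** The peak [1 / (s sqrt (2 pi))] of the density is at most [1 / s]. *)
Lemma normal_prob_le (a b : R) : a <= b -> fine (N `[a, b]%classic) <= (b - a) / s.
Proof.
move=> ab.
have pk : normal_peak s <= s^-1.
  rewrite /normal_peak lef_pV2 ?posrE//; last first.
    by rewrite sqrtr_gt0 pmulrn_lgt0// mulr_gt0 ?exprn_gt0// pi_gt0.
  rewrite -{1}(gtr0_norm s0) -sqrtr_sqr ler_sqrt; last first.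
    by rewrite pmulrn_lge0// mulr_ge0 ?sqr_ge0// pi_ge0.
  rewrite -mulrnAr ler_peMr ?sqr_ge0//.
  by have := pi_ge2 R; rewrite -mulr_natr; lra.
rewrite -lee_fin fineK ?fin_num_measure//.
rewrite /normal_prob.
apply: (@le_trans _ _ (\int[mu]_(x in `[a, b]) (s^-1)%:E)%E).
  apply: ge0_le_integral => //.
  - by move=> x _; rewrite lee_fin normal_pdf_ge0.
  - by apply/measurable_funTS/measurable_EFinP.
  - by move=> x _; rewrite lee_fin (le_trans _ pk)// normal_pdf_ub.
rewrite integral_cst//=.
rewrite lebesgue_measure_itv/=; case: ifPn => _.
  by rewrite -EFinB -EFinM mulrC.
by rewrite mule0 lee_fin divr_ge0 ?subr_ge0// ltW.
Qed.

End NormalMoments.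

(** * Transfer of expectations along a law *)

Section LawTransfer.
Context d (T : measurableType d) (R : realType) (P : probability T R).
Variables (X : T -> R) (nu : probability (measurableTypeR R) R).
Hypothesis mX : measurable_fun setT X.
Hypothesis lawX : forall A : set R, measurable A -> P (X @^-1` A) = nu A.

Let X' : T -> measurableTypeR R := X.
Let mX' : measurable_fun setT X'. Proof. exact: mX. Qed.

Lemma law_ge0_integral (f : R -> \bar R) : measurable_fun setT f ->
  (forall x, 0 <= f x)%E -> (\int[P]_w f (X w) = \int[nu]_x f x)%E.
Proof.
move=> mf f0.
rewrite [RHS](@eq_measure_integral _ (measurableTypeR R) R setT (pushforward P X')).
  rewrite ge0_integral_pushforward//.
by move=> A mA _; exact/esym/lawX.
Qed.

Lemma law_integ (f : R -> R) : integ nu f -> integ P (fun w => f (X w)).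
Proof.
move=> inuf; have mf := integ_measurable inuf.
apply/integrableP; split.
  by apply/measurable_EFinP; apply: (measurableT_comp mf mX').
move/integrableP : inuf => [_].
rewrite -law_ge0_integral//.
by apply: measurableT_comp => //; exact/measurable_EFinP.
Qed.

Lemma law_Ex (f : R -> R) : integ nu f -> Ex P (fun w => f (X w)) = Ex nu f.
Proof.
move=> inuf; have mf := integ_measurable inuf; rewrite /Ex /Rintegral; congr fine.
rewrite [RHS](@eq_measure_integral _ (measurableTypeR R) R setT (pushforward P X')).
  rewrite (@integral_pushforward _ _ _ _ _ X' mX' P setT (EFin \o f))//.
  - exact/measurable_EFinP.
  - by rewrite preimage_setT; exact: law_integ.
by move=> A mA _; exact/esym/lawX.
Qed.

End LawTransfer.

(** * A real Gaussian variable, possibly degenerate *)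

Section GaussianVariable.
Context d (T : measurableType d) (R : realType) (P : probability T R).
Variables (X : T -> R) (m s : R).
Hypothesis mX : measurable_fun setT X.
Hypothesis s0 : 0 <= s.
Hypothesis lawX : forall A : set R, measurable A ->
  P (X @^-1` A) = gaussian_law m s A.

(** For [s = 0] the law is a point mass, so integration is evaluation at [m]; the moment lemmas
    below split on this case. *)
Let degenerate : s = 0 -> forall f : R -> R,
  measurable_fun setT f -> integ P (fun w => f (X w)) /\ Ex P (fun w => f (X w)) = f m.
Proof.
move=> s00 f mf.
have law' (A : set R) : measurable A -> P (X @^-1` A) = (@dirac _ (measurableTypeR R) m R : probability (measurableTypeR R) R) A.
  by move=> mA; rewrite lawX// /gaussian_law s00 eqxx.
have id : integ (@dirac _ (measurableTypeR R) m R : probability (measurableTypeR R) R) f.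
  apply/integrableP; split; first exact/measurable_EFinP.
  rewrite integral_dirac//; last first.
    by apply: measurableT_comp => //; exact/measurable_EFinP.
  by rewrite diracT mul1e ltry.
split; first exact: (law_integ mX law').
rewrite (law_Ex mX law')// /Ex /Rintegral integral_dirac//.
  by rewrite diracT mul1e.
exact/measurable_EFinP.
Qed.

Let nondegenerate : s != 0 -> forall A : set R, measurable A ->
  P (X @^-1` A) = (normal_prob m s : probability (measurableTypeR R) R) A.
Proof. by move=> sn0 A mA; rewrite lawX// /gaussian_law (negbTE sn0). Qed.

Lemma gaussian_integ_sqr : integ P (fun w => (X w - m) ^+ 2).
Proof.
have msq : measurable_fun setT (fun x : R => (x - m) ^+ 2).
  by apply: measurable_funX; exact: measurable_funB.
have [s00|sn0] := eqVneq s 0; first exact: (degenerate s00 msq).1.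
apply: (law_integ mX (nondegenerate sn0) (f := fun x => (x - m) ^+ 2)).
by apply: integ_normal_sqr; rewrite lt_neqAle eq_sym sn0.
Qed.

Lemma gaussian_mean : Ex P X = m.
Proof.
have [s00|sn0] := eqVneq s 0.
  have mid : measurable_fun setT (fun x : R => x) by exact: measurable_id.
  exact: (degenerate s00 mid).2.
have sp : 0 < s by rewrite lt_neqAle eq_sym sn0.
have i1 : integ P (fun w => X w - m).
  by apply: integ_sqr gaussian_integ_sqr; exact: measurable_funB.
have -> : X = (fun w => (X w - m) + m) by apply/funext => w; rewrite subrK.
rewrite ExD//; last exact: integ_cst.
rewrite Ex_cst (law_Ex mX (nondegenerate sn0) (f := fun x => x - m)).
  by rewrite normal_mean// add0r.
by apply: integ_sqr; [exact: measurable_funB|exact: integ_normal_sqr].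
Qed.

Lemma gaussian_variance : Ex P (fun w => (X w - m) ^+ 2) = s ^+ 2.
Proof.
have msq : measurable_fun setT (fun x : R => (x - m) ^+ 2).
  by apply: measurable_funX; exact: measurable_funB.
have [s00|sn0] := eqVneq s 0.
  by rewrite (degenerate s00 msq).2 subrr expr0n s00 expr0n.
have sp : 0 < s by rewrite lt_neqAle eq_sym sn0.
rewrite (law_Ex mX (nondegenerate sn0) (f := fun x => (x - m) ^+ 2)).
  exact: normal_variance.
exact: integ_normal_sqr.
Qed.

Lemma gaussian_charfun (t c : R) : Ex P (fun w => cos (t * (X w - m) + c)) =
  expR (- (s ^+ 2 * t ^+ 2 / 2)) * cos c.
Proof.
have mc : measurable_fun setT (fun x : R => cos (t * (x - m) + c)).
  apply: (@measurableT_comp _ _ _ _ _ _ (@cos R)).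
    by apply: continuous_measurable_fun; exact: continuous_cos.
  by apply: measurable_funD => //; apply: measurable_funM => //; exact: measurable_funB.
have [s00|sn0] := eqVneq s 0.
  rewrite (degenerate s00 mc).2 subrr mulr0 add0r s00.
  by rewrite expr0n/= !mul0r oppr0 expR0 mul1r.
have sp : 0 < s by rewrite lt_neqAle eq_sym sn0.
rewrite (law_Ex mX (nondegenerate sn0) (f := fun x => cos (t * (x - m) + c))).
  exact: normal_charfun.
by apply: (@integ_bounded _ _ _ _ _ 1) => // x; exact: cos_max.
Qed.

Lemma gaussian_anticoncentration (a b : R) : 0 < s -> a <= b ->
  fine (P (X @^-1` `[a, b])) <= (b - a) / s.
Proof.
move=> sp ab; rewrite nondegenerate ?gt_eqF//; exact: normal_prob_le.
Qed.

End GaussianVariable.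

(** * The heat semigroup as Gaussian averaging, and its smoothing estimates *)

Section GaussianSmoothing.
Context d (T : measurableType d) (R : realType) (P : probability T R) (q : nat).
Variables (G : T -> 'rV[R]_q) (S : 'M[R]_q).
Implicit Types (xi eta x : 'rV[R]_q) (s : trig R q) (t c M : R).

Definition qform xi : R := dot xi (xi *m S).

Hypothesis mG : forall i, measurable_fun setT (fun w => G w 0 i).
Hypothesis symS : forall xi eta, dot xi (eta *m S) = dot eta (xi *m S).
Hypothesis charG : forall xi c,
  Ex P (fun w => cos (dot xi (G w) + c)) = expR (- (qform xi / 2)) * cos c.
Hypothesis integG : forall eta, integ P (fun w => dot eta (G w) ^+ 2).
Hypothesis varG : forall eta, Ex P (fun w => dot eta (G w) ^+ 2) = qform eta.

Lemma qformZ t xi : qform (t *: xi) = t ^+ 2 * qform xi.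
Proof. by rewrite /qform -scalemxAl dotZl dotZr mulrA expr2. Qed.

Lemma qformD t xi eta : qform (xi + t *: eta) =
  qform xi + 2 * dot xi (eta *m S) * t + qform eta * t ^+ 2.
Proof.
rewrite /qform mulmxDl -scalemxAl !(dotDl, dotDr, dotZl, dotZr).
by rewrite (symS eta xi); ring.
Qed.

Lemma qform_ge0 eta : 0 <= qform eta.
Proof. by rewrite -varG; apply: Ex_ge0 => w; exact: sqr_ge0. Qed.

Lemma measurable_dot eta : measurable_fun setT (fun w => dot eta (G w)).
Proof. by apply: measurable_sum => i; exact: measurable_funM. Qed.

Let mdot := measurable_dot.

Let mcosd xi c : measurable_fun setT (fun w => cos (dot xi (G w) + c)).
Proof.
apply: (@measurableT_comp _ _ _ _ _ _ (@cos R)).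
  by apply: continuous_measurable_fun; exact: continuous_cos.
by apply: measurable_funD.
Qed.

Let icosd xi c : integ P (fun w => cos (dot xi (G w) + c)).
Proof. by apply: (@integ_bounded _ _ _ _ _ 1) => // w; exact: cos_max. Qed.

Let integ_dot eta : integ P (fun w => dot eta (G w)).
Proof. exact: integ_sqr. Qed.

(** The characteristic function along [xi + t * eta] is differentiated at [t = 0] in two ways, under
    the expectation and in closed form. This gives the sine version [E0]; replacing [c] by
    [c + pi / 2] gives the cosine. *)
Lemma gaussian_ibp xi eta c :
  Ex P (fun w => dot eta (G w) * cos (dot xi (G w) + c)) =
  - (dot xi (eta *m S) * expR (- (qform xi / 2)) * sin c).
Proof.
pose Z c w := dot xi (G w) + c.
have E0 (c' : R) : Ex P (fun w => dot eta (G w) * sin (dot xi (G w) + c')) =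
    dot xi (eta *m S) * expR (- (qform xi / 2)) * cos c'.
  have mZ : measurable_fun setT (Z c') by apply: measurable_funD.
  have H := is_derive_Ex_cos 0 (mdot eta) mZ (integG eta).
  have eqF : (fun t => Ex P (fun w => cos (t * dot eta (G w) + Z c' w))) =
      (fun t => cos c' * expR (- (qform xi / 2) + (- dot xi (eta *m S)) * t +
          - qform eta * t ^+ 2 / 2)).
    apply/funext => t; rewrite mulrC.
    have := charG (xi + t *: eta) c'; rewrite qformD => K.
    transitivity (Ex P (fun w => cos (dot (xi + t *: eta) (G w) + c'))).
      by congr Ex; apply/funext => w; rewrite /Z dotDl dotZl; congr cos; ring.
    by rewrite K; congr (expR _ * _); field.
  rewrite eqF in H.
  have d1 : is_derive (0 : R) 1 (fun t : R => (- (qform xi / 2) +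
      (- dot xi (eta *m S)) * t) + - qform eta * t ^+ 2 / 2)
      (- dot xi (eta *m S) + - qform eta * 0).
    by apply: is_deriveD; [exact: is_derive_affine|exact: is_derive_sqr_half].
  have d2 := is_deriveZ (cos c') (@is_derive1_comp _ expR _ _ _ _ (is_derive_expR _) d1).
  have := derive_val (is_derive := H).
  rewrite (derive_val (is_derive := d2)).
  move=> /(congr1 -%R); rewrite opprK.
  have -> : (fun w => dot eta (G w) * sin (0 * dot eta (G w) + Z c' w)) =
      (fun w => dot eta (G w) * sin (dot xi (G w) + c')).
    by apply/funext => w; rewrite mul0r add0r.
  move=> <-; rewrite expr0n/= !mulr0 mul0r !addr0.
  set e := expR _; rewrite -[LHS]/(- (cos c' * (e * - dot xi (eta *m S)))); ring.
rewrite -mulrN -cosDpihalf -E0; congr Ex; apply/funext => w.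
by rewrite addrA sinDpihalf.
Qed.

(** Averaging a cosine over [sqrt t * G] multiplies it by the characteristic function. Sup-norm
    bounds, invisible in the coefficients, come from this side. *)
Lemma heatE t s x : 0 <= t ->
  ev (trigH qform t s) x = Ex P (fun w => ev s (x + Num.sqrt t *: G w)).
Proof.
move=> t0; rewrite /ev big_map.
have E a w : dot a.1.2 (x + Num.sqrt t *: G w) + a.2 =
    dot (Num.sqrt t *: a.1.2) (G w) + (dot a.1.2 x + a.2) :> R.
  by rewrite dotDr dotZr dotZl; ring.
under [in RHS]eq_fun do under eq_bigr do rewrite E.
rewrite Ex_sum; last by move=> a; exact: integZ.
apply: eq_bigr => a _ /=.
by rewrite ExZ// charG qformZ sqr_sqrtr// mulrA.
Qed.

Lemma measurable_ev s x t : measurable_fun setT (fun w => ev s (x + t *: G w)).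
Proof.
apply: measurable_sum => a; apply: measurable_funM => //.
apply: (@measurableT_comp _ _ _ _ _ _ (@cos R)).
  by apply: continuous_measurable_fun; exact: continuous_cos.
apply: measurable_funD => //.
under eq_fun do rewrite dotDr dotZr.
by apply: measurable_funD => //; exact: measurable_funM.
Qed.

(** Gaussian integration by parts on each monomial moves the derivative to the weight
    [<eta, G> / sqrt t]. Directions are written [eta *m S], so a singular [S] is no obstacle. *)
Lemma heat_derivativeE t s x eta : 0 < t ->
  ev (trigD (eta *m S) (trigH qform t s)) x =
  (Num.sqrt t)^-1 * Ex P (fun w => dot eta (G w) * ev s (x + Num.sqrt t *: G w)).
Proof.
move=> t0; have r0 : Num.sqrt t != 0 by rewrite gt_eqF// sqrtr_gt0.
rewrite ev_trigD big_map -sumrN /=.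
have E a w : dot a.1.2 (x + Num.sqrt t *: G w) + a.2 =
    dot (Num.sqrt t *: a.1.2) (G w) + (dot a.1.2 x + a.2) :> R.
  by rewrite dotDr dotZr dotZl; ring.
rewrite /ev.
under [in RHS]eq_fun do (rewrite mulr_sumr; under eq_bigr do rewrite E mulrCA).
rewrite Ex_sum; last first.
  move=> a; apply: integZ; apply: (@integ_mul_bounded _ _ _ _ _ _ 1) => // w.
  exact: cos_max.
rewrite mulr_sumr; apply: eq_bigr => a _ /=.
rewrite ExZ; last first.
  by apply: (@integ_mul_bounded _ _ _ _ _ _ 1) => // w; exact: cos_max.
rewrite gaussian_ibp qformZ sqr_sqrtr ?(ltW t0)// dotZl.
by field.
Qed.

(** Once [s] is bounded by [M], only the first absolute moment of [<eta, G>] remains, and it is at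
    most the standard deviation. *)
Lemma heat_smoothing t s x eta M : 0 < t -> (forall y, `|ev s y| <= M) ->
  `|ev (trigD (eta *m S) (trigH qform t s)) x| <=
  Num.sqrt (qform eta) / Num.sqrt t * M.
Proof.
move=> t0 sM; have M0 : 0 <= M by apply: le_trans (sM 0).
rewrite heat_derivativeE// normrM normfV (ger0_norm (sqrtr_ge0 _)).
rewrite -mulrA mulrCA; apply: ler_wpM2l; first by rewrite invr_ge0 sqrtr_ge0.
apply: (@le_trans _ _ (Ex P (fun w => M * `|dot eta (G w)|))).
  apply: normr_Ex_le.
  - by apply: (@integ_mul_bounded _ _ _ _ _ _ M) => //; exact: measurable_ev.
  - by apply: integZ; exact: integ_norm.
  - by move=> w; rewrite normrM mulrC ler_wpM2r.
rewrite ExZ; last exact: integ_norm.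
rewrite mulrC ler_wpM2r//.
rewrite -(ger0_norm (Ex_ge0 _ _)); last by move=> w; exact: normr_ge0.
rewrite -sqrtr_sqr ler_wsqrtr// -varG; exact: Ex_sqr_norm_le.
Qed.

(** Each of two half-time steps absorbs one derivative; the factor 2 is the cost of [t / 2] in place
    of [t]. *)
Lemma heat_smoothing2 t s x eta M : 0 < t -> (forall y, `|ev s y| <= M) ->
  `|ev (trigD (eta *m S) (trigD (eta *m S) (trigH qform t s))) x| <=
  2 * qform eta / t * M.
Proof.
move=> t0 sM; have t20 : 0 < t / 2 by rewrite divr_gt0.
have -> : trigH qform t s = trigH qform (t / 2) (trigH qform (t / 2) s).
  by rewrite trigHH -splitr.
rewrite -(trigHD qform (eta *m S) (t / 2) (trigH qform (t / 2) s)).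
apply: le_trans (heat_smoothing _ _ t20
  (fun y => heat_smoothing y eta t20 sM)) _.
rewrite mulrA -expr2 exprMn exprVn !sqr_sqrtr ?qform_ge0 ?(ltW t20)//.
by rewrite invf_div mulrA (mulrC (qform eta)).
Qed.

End GaussianSmoothing.

(** * Independence and factorization of expectations *)

Section IndependentPair.
Context d d1 d2 (T : measurableType d) (T1 : measurableType d1)
  (T2 : measurableType d2) (R : realType) (P : probability T R).
Variables (X : {RV P >-> T1}) (Y : {RV P >-> T2}).
Hypothesis indXY : forall A B, measurable A -> measurable B ->
  P (X @^-1` A `&` Y @^-1` B) = (P (X @^-1` A) * P (Y @^-1` B))%E.

(** The joint law agrees with the product of the marginals on rectangles, hence everywhere; Fubini
    then factors the integral. *)
Lemma Ex_mul_independent (u : T1 -> R) (h : T2 -> R) (Mu Mh : R) :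
  measurable_fun setT u -> measurable_fun setT h ->
  (forall x, `|u x| <= Mu) -> (forall y, `|h y| <= Mh) ->
  Ex P (fun w => u (X w) * h (Y w)) = Ex P (fun w => u (X w)) * Ex P (fun w => h (Y w)).
Proof.
move=> mu mh uM hM.
pose m1 : probability T1 R := distribution P X.
pose m2 : probability T2 R := distribution P Y.
pose Z (w : T) : T1 * T2 := (X w, Y w).
have mZ : measurable_fun setT Z by apply/measurable_fun_pairP; split.
pose f (z : T1 * T2) := u z.1 * h z.2.
have mf : measurable_fun setT f.
  by apply: measurable_funM; apply: measurableT_comp.
have fM z : `|f z| <= Mu * Mh by rewrite normrM ler_pM.
have prodE A : measurable A -> (m1 \x m2)%E A = pushforward P Z A.
  by move=> mA; apply: (@product_measure_unique _ _ _ _ _ m1 m2 (pushforward P Z)).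
have ifZ : integ P (fun w => f (Z w)).
  by apply: (@integ_bounded _ _ _ _ _ (Mu * Mh)) => //; exact: measurableT_comp.
have if' : (m1 \x m2)%E.-integrable setT (EFin \o f).
  apply: measurable_bounded_integrable => //.
    rewrite [X in (X < _)%E](prodE setT measurableT) /pushforward preimage_setT.
    by rewrite probability_setT ltry.
  exists (Mu * Mh); split; first exact: num_real.
  by move=> M MM z _; apply: le_trans (fM z) (ltW MM).
have iu : P.-integrable setT (EFin \o (fun w => u (X w))).
  by apply: (@integ_bounded _ _ _ _ _ Mu) => //; exact: measurableT_comp.
have ih : P.-integrable setT (EFin \o (fun w => h (Y w))).
  by apply: (@integ_bounded _ _ _ _ _ Mh) => //; exact: measurableT_comp.
have ih2 : m2.-integrable setT (EFin \o h) by apply: (@integ_bounded _ _ _ m2 _ Mh).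
have iu1 : m1.-integrable setT (EFin \o u) by apply: (@integ_bounded _ _ _ m1 _ Mu).
have E1 : (\int[P]_w (f (Z w))%:E = \int[m1 \x m2]_z (f z)%:E)%E.
  rewrite [RHS](@eq_measure_integral _ _ _ _ (pushforward P Z)); last first.
    by move=> A mA _; exact: prodE.
  rewrite (@integral_pushforward _ _ _ _ _ Z mZ P setT (EFin \o f))//.
  exact/measurable_EFinP.
have Eh : (\int[P]_w (h (Y w))%:E = \int[m2]_y (h y)%:E)%E.
  rewrite /m2 integral_distribution//; exact/measurable_EFinP.
have Eu : (\int[P]_w (u (X w))%:E = \int[m1]_y (u y)%:E)%E.
  rewrite /m1 integral_distribution//; exact/measurable_EFinP.
rewrite /Ex /Rintegral -fineM ?integrable_fin_num//; congr fine.
rewrite (_ : (fun w => (u (X w) * h (Y w))%:E) = (fun w => (f (Z w))%:E))//.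
rewrite E1 -(integral12_prod_meas1 if') Eu Eh.
under eq_integral => x _.
  rewrite /fubini_F /=.
  under eq_integral do rewrite /f /= EFinM.
  rewrite integralZl//.
  over.
rewrite -(@fineK _ (\int[m2]_y (h y)%:E)%E) ?integralZr//.
exact: integrable_fin_num.
Qed.

End IndependentPair.

Section IndependenceFromOthers.
Context d d' (T : measurableType d) (T' : measurableType d') (R : realType)
  (P : probability T R) (n : nat) (X : 'I_n -> {RV P >-> T'}) (c : T').
Hypothesis indX : independent_RVs X.

(** Entry [j] is overwritten by the constant [c]: the tuple keeps its length but no longer depends
    on [X j]. *)
Definition others (j : 'I_n) (w : T) : n.-tuple T' :=
  [tuple (if k == j then c else X k w) | k < n].

Lemma measurable_others j : measurable_fun setT (others j).
Proof.
apply/measurable_fun_tnthP => k.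
rewrite (_ : _ \o _ = fun w => if k == j then c else X k w).
  by case: (k == j).
by apply/funext => w; rewrite /= tnth_mktuple.
Qed.

Let rect : set (set (n.-tuple T')) :=
  [set A | exists2 B : 'I_n -> set T', (forall k, measurable (B k)) &
    A = [set x | forall k, B k (tnth x k)]].

Let rect_measurable A : rect A -> measurable A.
Proof.
move=> [B mB ->].
rewrite (_ : [set _ | _] = \bigcap_(k in [set: 'I_n]) ((fun x : n.-tuple T' => tnth x k) @^-1` B k)).
  apply: fin_bigcap_measurable => // k _.
  by rewrite -[X in measurable X]setTI; exact: measurable_tnth.
by apply/seteqP; split => [x xB k _|x xB k]; [exact: xB|exact: (xB k I)].
Qed.

Let measurable_rect : @measurable _ (n.-tuple T') = <<s rect >>.
Proof.
apply/seteqP; split; last first.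
  apply: smallest_sub; first exact: sigma_algebra_measurable.
  exact: rect_measurable.
apply: smallest_sub; first exact: smallest_sigma_algebra.
move=> A; rewrite -bigcup_seq/= => -[i _ [B mB <-]].
apply: sub_sigma_algebra; exists (fun k => if k == i then B else setT).
  by move=> k; case: ifP.
apply/seteqP; split => [x [_ xB] k|x xB].
  by case: eqP => [->|].
by split => //; have := xB i; rewrite eqxx.
Qed.

(** For fixed [A] both sides are finite measures in [B], and they agree on rectangles, a generating
    family closed under intersection. *)
Lemma independent_of_others j A B : measurable A -> measurable B ->
  P (X j @^-1` A `&` others j @^-1` B) =
  (P (X j @^-1` A) * P (others j @^-1` B))%E.
Proof.
move=> mA mB.
have mE : measurable (X j @^-1` A) by rewrite -[Y in measurable Y]setTI; exact: measurable_funP.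
have mo := measurable_others j.
have fE : P (X j @^-1` A) \is a fin_num by exact: fin_num_measure.
have pE : 0 <= fine (P (X j @^-1` A)) by exact: fine_ge0.
pose k1 : {measure set (n.-tuple T') -> \bar R} := pushforward (mrestr P mE) (others j).
pose k2 : {measure set (n.-tuple T') -> \bar R} :=
  mscale (NngNum pE) (pushforward P (others j)).
have rT : rect setT.
  by exists (fun=> setT) => //; apply/seteqP; split.
have k1E C : k1 mo C = P (X j @^-1` A `&` others j @^-1` C) by rewrite setIC.
have k2E C : k2 mo C = (P (X j @^-1` A) * P (others j @^-1` C))%E.
  by rewrite -[in RHS](fineK fE).
rewrite -k1E -k2E.
apply: (@measure_unique _ R _ rect (fun=> setT) measurable_rect _ _ _ (k1 mo) (k2 mo)) => //.
- move=> _ _ [B1 mB1 ->] [B2 mB2 ->]; exists (fun k => B1 k `&` B2 k).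
    by move=> k; exact: measurableI.
  apply/seteqP; split => [x [h1 h2] k|x h]; first by split.
  by split => k; have [] := h k.
- by apply/seteqP; split => // x _; exists 0%N.
- move=> _ [C mC ->]; rewrite k1E k2E.
  (* Coordinate [j] of the tuple is always [c]. A rectangle missing [c] there has empty preimage;
     otherwise its side [j] imposes nothing and is replaced by [A] or by the whole space in the
     product rule. *)
  have [Cc|nCc] := pselect (C j c); last first.
    rewrite (_ : others j @^-1` _ = set0) ?setI0 ?measure0 ?mule0//.
    apply/seteqP; split => // w /= /(_ j).
    by rewrite tnth_mktuple eqxx.
  pose C' (D : set T') k := if k == j then D else C k.
  have mC' D : measurable D -> forall k, measurable (C' D k).
    by move=> mD k; rewrite /C'; case: ifP.
  have capE D : \bigcap_(k in [set: 'I_n]) (X k @^-1` C' D k) =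
      X j @^-1` D `&` others j @^-1` [set x | forall k, C k (tnth x k)].
    apply/seteqP; split => [w h|w [hD h] k _].
      split => /=; first by have := h j I; rewrite /C' /= eqxx.
      move=> k; rewrite tnth_mktuple; case: eqP => [->//|/eqP kj].
      by have := h k I; rewrite /C' /= (negbTE kj).
    rewrite /C' /=; case: eqP => [->//|/eqP kj].
    by have := h k; rewrite tnth_mktuple (negbTE kj).
  have := indX (mC' _ mA); rewrite capE => ->.
  have := indX (mC' _ measurableT); rewrite capE preimage_setT setTI => ->.
  rewrite (bigD1 j)//= [in RHS](bigD1 j)//= /C' eqxx preimage_setT probability_setT mul1e.
  by congr (_ * _)%E; apply: eq_bigr => k kj; rewrite (negbTE kj).
- by move=> _; rewrite k1E preimage_setT setIT -ge0_fin_numE.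
Qed.

Lemma Ex_mul_others j (u : T' -> R) (h : n.-tuple T' -> R) (Mu Mh : R) :
  measurable_fun setT u -> measurable_fun setT h ->
  (forall x, `|u x| <= Mu) -> (forall y, `|h y| <= Mh) ->
  Ex P (fun w => u (X j w) * h (others j w)) =
  Ex P (fun w => u (X j w)) * Ex P (fun w => h (others j w)).
Proof.
pose Y : {RV P >-> n.-tuple T'} := HB.pack (others j)
  (isMeasurableFun.Build _ _ _ _ (others j) (measurable_others j)).
move=> mu mh uM hM.
by apply: (@Ex_mul_independent _ _ _ _ _ _ _ _ (X j) Y _ u h Mu Mh) => // A B mA mB;
  exact: independent_of_others.
Qed.

End IndependenceFromOthers.

(** * The algebra of bounded measurable functions *)

Section BoundedMeasurable.
Context d (T : measurableType d) (R : realType) (P : probability T R).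
Implicit Types f g : T -> R.

(** Closed under the operations applied to the summands, so that integrability follows without
    tracking explicit bounds. *)
Definition bounded_measurable f : Prop :=
  measurable_fun setT f /\ exists M, forall w, `|f w| <= M.

Local Notation bm := bounded_measurable.

Lemma bm_integ f : bm f -> integ P f.
Proof. by move=> [mf [M fM]]; exact: integ_bounded fM. Qed.

Lemma bm_cst (c : R) : bm (fun=> c).
Proof. by split; [exact: measurable_cst|exists `|c|]. Qed.

Lemma bmD f g : bm f -> bm g -> bm (fun w => f w + g w).
Proof.
move=> [mf [M fM]] [mg [N gN]]; split; first exact: measurable_funD.
exists (M + N) => w; exact: le_trans (ler_normD _ _) (lerD (fM w) (gN w)).
Qed.

Lemma bmM f g : bm f -> bm g -> bm (fun w => f w * g w).
Proof.
move=> [mf [M fM]] [mg [N gN]]; split; first exact: measurable_funM.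
by exists (M * N) => w; rewrite normrM ler_pM.
Qed.

Lemma bmZ c f : bm f -> bm (fun w => c * f w).
Proof. by move=> hf; apply: bmM => //; exact: bm_cst. Qed.

Lemma bmN f : bm f -> bm (fun w => - f w).
Proof.
move=> [mf [M fM]]; split; first exact: measurableT_comp.
by exists M => w; rewrite normrN.
Qed.

Lemma bmB f g : bm f -> bm g -> bm (fun w => f w - g w).
Proof. by move=> hf hg; apply: bmD => //; exact: bmN. Qed.

Lemma bmX f k : bm f -> bm (fun w => f w ^+ k).
Proof.
move=> [mf [M fM]]; split; first exact: measurable_funX.
by exists (M ^+ k) => w; rewrite normrX lerXn2r ?nnegrE// (le_trans _ (fM w)).
Qed.

Lemma bm_sum (I : Type) (r : seq I) (F : I -> T -> R) :
  (forall i, bm (F i)) -> bm (fun w => \sum_(i <- r) F i w).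
Proof.
move=> hF; elim: r => [|i r IH].
  by under eq_fun do rewrite big_nil; exact: bm_cst.
by under eq_fun do rewrite big_cons; exact: bmD.
Qed.

Lemma bm_continuous (k : R -> R) f : continuous k -> bm f ->
  (exists M, forall w, `|k (f w)| <= M) -> bm (fun w => k (f w)).
Proof.
move=> ck [mf _] kM; split => //.
by apply: (@measurableT_comp _ _ _ _ _ _ k) => //; exact: continuous_measurable_fun.
Qed.

Lemma bm_cos f : bm f -> bm (fun w => cos (f w)).
Proof.
move=> hf; apply: bm_continuous => //; first exact: continuous_cos.
by exists 1 => w; exact: cos_max.
Qed.

Lemma bm_sin f : bm f -> bm (fun w => sin (f w)).
Proof.
move=> hf; apply: bm_continuous => //; first exact: continuous_sin.
by exists 1 => w; exact: sin_max.
Qed.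

Lemma bm_sqrt f : bm f -> bm (fun w => Num.sqrt (f w)).
Proof.
move=> hf; have [mf [M fM]] := hf; apply: bm_continuous => //.
  exact: sqrt_continuous.
exists (Num.sqrt M) => w; rewrite ger0_norm ?sqrtr_ge0// ler_wsqrtr//.
exact: le_trans (ler_norm _) (fM w).
Qed.

Lemma bm_dot (q : nat) (U V : T -> 'rV[R]_q) :
  (forall i, bm (fun w => U w 0 i)) -> (forall i, bm (fun w => V w 0 i)) ->
  bm (fun w => dot (U w) (V w)).
Proof. by move=> hU hV; apply: bm_sum => i; exact: bmM. Qed.

Lemma bm_dotr (q : nat) (xi : 'rV[R]_q) (V : T -> 'rV[R]_q) :
  (forall i, bm (fun w => V w 0 i)) -> bm (fun w => dot xi (V w)).
Proof. by move=> hV; apply: bm_dot => // i; exact: bm_cst. Qed.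

Lemma bm_ev_trigD (q : nat) (s : trig R q) (U V : T -> 'rV[R]_q) :
  (forall i, bm (fun w => U w 0 i)) -> (forall i, bm (fun w => V w 0 i)) ->
  bm (fun w => ev (trigD (U w) s) (V w)).
Proof.
move=> hU hV; under eq_fun do rewrite ev_trigD; apply: bmN; apply: bm_sum => a.
apply: bmM; first by apply: bmZ; exact: bm_dotr.
by apply: bm_sin; apply: bmD; [exact: bm_dotr|exact: bm_cst].
Qed.

Lemma bm_ev_trigDD (q : nat) (s : trig R q) (U V : T -> 'rV[R]_q) :
  (forall i, bm (fun w => U w 0 i)) -> (forall i, bm (fun w => V w 0 i)) ->
  bm (fun w => ev (trigD (U w) (trigD (U w) s)) (V w)).
Proof.
move=> hU hV; under eq_fun do rewrite ev_trigDD; apply: bmN; apply: bm_sum => a.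
apply: bmM; first by apply: bmZ; apply: bmX; exact: bm_dotr.
by apply: bm_cos; apply: bmD; [exact: bm_dotr|exact: bm_cst].
Qed.

End BoundedMeasurable.

(** A full-rank factorization [A = C B] of an idempotent satisfies [B C = 1], and the trace is
    invariant under swapping the factors. *)
Lemma mxtrace_idempotent (F : fieldType) (q : nat) (A : 'M[F]_q) :
  A *m A = A -> \tr A = (\rank A)%:R.
Proof.
move=> AA; rewrite -{1}(mulmx_base A) mxtrace_mulC.
suff -> : row_base A *m col_base A = 1%:M by rewrite mxtrace1.
apply: (row_free_inj (row_base_free A)); apply: (row_full_inj (col_base_full A)).
by rewrite mul1mx -mulmxA (mulmxA (col_base A)) mulmx_base.
Qed.

Lemma mxtrace_pinvmx_le (R : numFieldType) (q : nat) (A : 'M[R]_q) :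
  \tr (pinvmx A *m A) <= q%:R.
Proof.
rewrite mxtrace_idempotent; first by rewrite ler_nat rank_leq_row.
by rewrite mulmxA -(mulmxA (pinvmx A) A) -mulmxA mulmxKpV.
Qed.

Lemma is_derive_bigsum (R : realType) (I : Type) (r : seq I) (F : I -> R -> R)
    (dF : I -> R) (x : R) : (forall i, is_derive x 1 (F i) (dF i)) ->
  is_derive x 1 (fun t : R => \sum_(i <- r) F i t) (\sum_(i <- r) dF i).
Proof.
move=> hF; elim: r => [|i r IH].
  under eq_fun do rewrite big_nil.
  by rewrite big_nil; exact: is_derive_cst.
under eq_fun do rewrite big_cons.
rewrite big_cons; exact: is_deriveD.
Qed.

(** * Interpolation between the sum and the Gaussian *)

Section SteinInterpolation.
Context d (T : measurableType d) (R : realType) (P : probability T R).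
Variables (q n : nat) (Y : 'I_n -> T -> 'rV[R]_q) (tau : R) (S : 'M[R]_q).

Definition total (w : T) : 'rV[R]_q := \sum_j Y j w.
Definition rest (j : 'I_n) (w : T) : 'rV[R]_q := total w - Y j w.
(** The squared Mahalanobis length of [Y j], written as the form of the preimage [Y j *m pinvmx S]:
    that preimage is the [eta] given to the smoothing bounds, and nonnegativity is immediate. *)
Definition weight (j : 'I_n) (w : T) : R := qform S (Y j w *m pinvmx S).

Local Notation W := total.
Local Notation E := (Ex P).
Local Notation Q := (qform S).

Hypothesis mY : forall j i, measurable_fun setT (fun w => Y j w 0 i).
Hypothesis bY : forall j w i, `|Y j w 0 i| <= tau.
Hypothesis rangeY : forall j w, (Y j w <= S)%MS.
Hypothesis covS : forall i k, S i k = \sum_j E (fun w => Y j w 0 i * Y j w 0 k).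
Hypothesis uncorrelated : forall j xi zeta c,
  E (fun w => dot xi (Y j w) * sin (dot zeta (rest j w) + c)) = 0.
Hypothesis independent_sqr : forall j xi zeta c,
  E (fun w => dot xi (Y j w) ^+ 2 * cos (dot zeta (rest j w) + c)) =
  E (fun w => dot xi (Y j w) ^+ 2) * E (fun w => cos (dot zeta (rest j w) + c)).

Hypothesis smoothing1 : forall (t : R) s x eta (M : R), 0 < t -> (forall y, `|ev s y| <= M) ->
  `|ev (trigD (eta *m S) (trigH Q t s)) x| <= Num.sqrt (Q eta) / Num.sqrt t * M.
Hypothesis smoothing2 : forall (t : R) s x eta (M : R), 0 < t -> (forall y, `|ev s y| <= M) ->
  `|ev (trigD (eta *m S) (trigD (eta *m S) (trigH Q t s))) x| <= 2 * Q eta / t * M.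
Hypothesis Q_ge0 : forall eta, 0 <= Q eta.

Variables (f : trig R q) (K : R).
Hypothesis gradf : forall b : 'rV[R]_q, (forall i, `|b 0 i| <= tau) ->
  forall x, `|ev (trigD b f) x| <= K.

Let bmY j i : bounded_measurable (fun w => Y j w 0 i).
Proof. by split; [exact: mY|exists tau => w; exact: bY]. Qed.

Let bmW i : bounded_measurable (fun w => W w 0 i).
Proof. by under eq_fun do rewrite summxE; exact: bm_sum. Qed.

Let bmrest j i : bounded_measurable (fun w => rest j w 0 i).
Proof. by under eq_fun do rewrite !mxE; exact: bmB. Qed.

Let bmZmx (c : R) (V : T -> 'rV[R]_q) :
  (forall i, bounded_measurable (fun w => V w 0 i)) ->
  forall i, bounded_measurable (fun w => (c *: V w) 0 i).
Proof. by move=> hV i; under eq_fun do rewrite mxE; exact: bmZ. Qed.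

Let YE j w : Y j w = Y j w *m pinvmx S *m S.
Proof. by rewrite mulmxKpV. Qed.

Let weightE j w : weight j w = dot (Y j w *m pinvmx S) (Y j w).
Proof. by rewrite /weight /qform -YE. Qed.

Lemma weight_ge0 j w : 0 <= weight j w. Proof. exact: Q_ge0. Qed.

Let bmweight j : bounded_measurable (weight j).
Proof.
rewrite (_ : weight j = fun w => dot (Y j w *m pinvmx S) (Y j w)); last first.
  by apply/funext => w; rewrite weightE.
apply: bm_dot => // i.
under eq_fun do rewrite mxE; apply: bm_sum => k; apply: bmM => //; exact: bm_cst.
Qed.

(** By linearity and [covS] the sum is the trace of [pinvmx S *m S], a projection. *)
Lemma sum_weight_le : \sum_j E (weight j) <= q%:R.
Proof.
apply: le_trans (mxtrace_pinvmx_le S); rewrite le_eqVlt; apply/orP; left; apply/eqP.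
have bmYY j k i : bounded_measurable (fun w => Y j w 0 i * Y j w 0 k) by exact: bmM.
transitivity (\sum_j \sum_i \sum_k
    pinvmx S k i * E (fun w => Y j w 0 i * Y j w 0 k)).
  apply: eq_bigr => j _.
  have -> : weight j = (fun w => \sum_i \sum_k pinvmx S k i * (Y j w 0 i * Y j w 0 k)).
    apply/funext => w; rewrite weightE; apply: eq_bigr => i _.
    by rewrite mxE mulr_suml; apply: eq_bigr => k _; ring.
  rewrite Ex_sum; last by move=> i; apply/bm_integ/bm_sum => k; exact: bmZ.
  apply: eq_bigr => i _; rewrite Ex_sum; last by move=> k; apply/bm_integ/bmZ.
  by apply: eq_bigr => k _; rewrite ExZ//; exact: bm_integ.
rewrite exchange_big/= /mxtrace; under eq_bigr do rewrite exchange_big/=.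
rewrite exchange_big/=; apply: eq_bigr => k _; rewrite mxE; apply: eq_bigr => i _.
by rewrite covS mulr_sumr.
Qed.

(** Pointwise [sqrt x <= (r / 2) x + 1 / (2 r)]. With [r = sqrt n] the two parts sum to at most
    [r q / 2] and exactly [r / 2], together at most [r q] since [q >= 1]. *)
Lemma sum_sqrt_weight_le : (0 < n)%N -> (0 < q)%N ->
  \sum_j E (fun w => Num.sqrt (weight j w)) <= Num.sqrt n%:R * q%:R.
Proof.
move=> n0 q0; set r := Num.sqrt n%:R.
have r0 : 0 < r by rewrite sqrtr_gt0 ltr0n.
have le1 j : E (fun w => Num.sqrt (weight j w)) <= (r / 2) * E (weight j) + (r^-1 / 2).
  rewrite -ExZ; last exact: bm_integ.
  rewrite -[X in _ <= _ + X](Ex_cst P) -ExD; [|by apply/bm_integ/bmZ|exact: integ_cst].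
  apply: Ex_le; first by apply/bm_integ/bm_sqrt.
    by apply: bm_integ; apply: bmD; [exact: bmZ|exact: bm_cst].
  move=> w; set x := Num.sqrt _.
  have -> : weight j w = x ^+ 2 by rewrite sqr_sqrtr ?weight_ge0.
  have -> : r / 2 * x ^+ 2 + r^-1 / 2 = x + (r * x - 1) ^+ 2 / (2 * r).
    by field; rewrite gt_eqF.
  by rewrite lerDl divr_ge0 ?sqr_ge0// mulr_ge0// ltW.
apply: le_trans (ler_sum _ (fun j _ => le1 j)) _.
rewrite big_split /= -mulr_sumr sumr_const card_ord -(mulr_natr (r^-1 / 2)).
have h1 : r / 2 * (\sum_j E (weight j)) <= r / 2 * q%:R.
  by rewrite ler_wpM2l ?sum_weight_le// divr_ge0// ltW.
have h2 : r^-1 / 2 * n%:R = r / 2.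
  have -> : n%:R = r ^+ 2 by rewrite sqr_sqrtr.
  by field; rewrite gt_eqF.
have h3 : r * 1 <= r * q%:R by rewrite ler_pM2l// ler1n.
rewrite h2; lra.
Qed.

Lemma trigDC b b' (s : trig R q) : trigD b (trigD b' s) = trigD b' (trigD b s).
Proof. by rewrite /trigD -!map_comp; apply: eq_map => a /=; rewrite mulrAC. Qed.

(** The second derivative at [x] along an independent copy of [Y j], averaged over that copy; the
    average is taken on the coefficients. *)
Let cov_term (g : trig R q) j x := - \sum_(e <- g)
  e.1.1 * E (fun w => dot e.1.2 (Y j w) ^+ 2) * cos (dot e.1.2 x + e.2).

Let cov_termE g j x :
  cov_term g j x = E (fun w => ev (trigD (Y j w) (trigD (Y j w) g)) x).
Proof.
under eq_fun do rewrite ev_trigDD.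
have bme (e : R * 'rV[R]_q * R) : bounded_measurable
    (fun w => e.1.1 * dot e.1.2 (Y j w) ^+ 2 * cos (dot e.1.2 x + e.2)).
  apply: bmM; last exact: bm_cst.
  by apply: bmZ; apply: bmX; exact: bm_dotr.
rewrite ExN; last by apply/bm_integ/bm_sum.
rewrite Ex_sum; last by move=> e; exact: bm_integ.
congr (- _); apply: eq_bigr => e _.
under [in RHS]eq_fun do rewrite mulrAC.
rewrite ExZ; last by apply: bm_integ; apply: bmX; exact: bm_dotr.
by rewrite mulrAC.
Qed.

(** The share of [j] in the derivative of the interpolation, up to the factor [cos theta]: the drift
    caused by scaling the sum, minus the drift of the heat semigroup. *)
Let gap (g : trig R q) (a : R) j :=
  E (fun w => ev (trigD (Y j w) g) (a *: W w)) - a * E (fun w => cov_term g j (a *: W w)).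

Let aWE (a : R) j w : a *: W w = a *: rest j w + a *: Y j w.
Proof. by rewrite -scalerDr subrK. Qed.

Let bmDg g a j : bounded_measurable (fun w => ev (trigD (Y j w) g) (a *: W w)).
Proof. by apply: bm_ev_trigD => //; exact: bmZmx. Qed.

Let bmDr g a j : bounded_measurable (fun w => ev (trigD (Y j w) g) (a *: rest j w)).
Proof. by apply: bm_ev_trigD => //; exact: bmZmx. Qed.

Let bmDDr g a j :
  bounded_measurable (fun w => ev (trigD (Y j w) (trigD (Y j w) g)) (a *: rest j w)).
Proof. by apply: bm_ev_trigDD => //; exact: bmZmx. Qed.

Let bmcov g j (V : T -> 'rV[R]_q) : (forall i, bounded_measurable (fun w => V w 0 i)) ->
  bounded_measurable (fun w => cov_term g j (V w)).
Proof.
move=> hV; apply: bmN; apply: bm_sum => e; apply: bmZ; apply: bm_cos.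
by apply: bmD; [exact: bm_dotr|exact: bm_cst].
Qed.

(** [Y j] enters linearly and is centered given the rest, so the first-order term of the expansion
    around [rest] vanishes. *)
Let ExD_rest0 g a j : E (fun w => ev (trigD (Y j w) g) (a *: rest j w)) = 0.
Proof.
under eq_fun do rewrite ev_trigD.
have bme (e : R * 'rV[R]_q * R) : bounded_measurable
    (fun w => dot e.1.2 (Y j w) * sin (dot e.1.2 (a *: rest j w) + e.2)).
  apply: bmM; first exact: bm_dotr.
  by apply: bm_sin; apply: bmD; [apply: bm_dotr; exact: bmZmx|exact: bm_cst].
under eq_fun do under eq_bigr do rewrite -mulrA.
rewrite ExN; last by apply/bm_integ/bm_sum => e; exact: bmZ.
rewrite Ex_sum; last by move=> e; apply/bm_integ/bmZ.
rewrite big1 ?oppr0// => e _; rewrite ExZ; last exact: bm_integ.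
under eq_fun do rewrite dotZr -dotZl.
by rewrite uncorrelated mulr0.
Qed.

(** At a point depending only on the rest, [Y j] and its independent copy are interchangeable: the
    second-order terms of [gap] cancel there. *)
Let ExDD_rest g a j : E (fun w => ev (trigD (Y j w) (trigD (Y j w) g)) (a *: rest j w)) =
  E (fun w => cov_term g j (a *: rest j w)).
Proof.
under eq_fun do rewrite ev_trigDD.
have bmc (e : R * 'rV[R]_q * R) :
    bounded_measurable (fun w => cos (dot e.1.2 (a *: rest j w) + e.2)).
  by apply: bm_cos; apply: bmD; [apply: bm_dotr; exact: bmZmx|exact: bm_cst].
have bme (e : R * 'rV[R]_q * R) : bounded_measurable
    (fun w => dot e.1.2 (Y j w) ^+ 2 * cos (dot e.1.2 (a *: rest j w) + e.2)).
  exact: (bmM (bmX 2 (bm_dotr _ (bmY j))) (bmc e)).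
under eq_fun do under eq_bigr do rewrite -mulrA.
rewrite ExN; last by apply/bm_integ/bm_sum => e; exact: bmZ.
rewrite Ex_sum; last by move=> e; apply/bm_integ/bmZ.
rewrite /cov_term ExN; last by apply/bm_integ/bm_sum => e; exact: bmZ.
rewrite Ex_sum; last by move=> e; apply/bm_integ/bmZ.
congr (- _); apply: eq_bigr => e _.
rewrite !ExZ; [|exact: bm_integ|exact: bm_integ].
have cE w : cos (dot e.1.2 (a *: rest j w) + e.2) =
    cos (dot (a *: e.1.2) (rest j w) + e.2) by rewrite dotZr dotZl.
rewrite (_ : (fun w => cos (dot e.1.2 (a *: rest j w) + e.2)) =
    (fun w => cos (dot (a *: e.1.2) (rest j w) + e.2))); last exact/funext.
rewrite -mulrA -independent_sqr; congr (_ * Ex _ _); apply/funext => w.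
by rewrite cE.
Qed.

(* Third-order Taylor bound; two of the three derivatives are absorbed by the heat kernel. *)
Lemma gap_le3 t a j : 0 < t -> 0 <= a ->
  `|gap (trigH Q t f) a j| <= 3 * a ^+ 2 * K / t * E (weight j).
Proof.
move=> t0 a0; set g := trigH Q t f.
have bound (b : 'rV[R]_q) w x : (forall i, `|b 0 i| <= tau) ->
    `|ev (trigD b (trigD (Y j w) (trigD (Y j w) g))) x| <= 2 * weight j w / t * K.
  move=> hb; rewrite trigDC (trigDC b) /g -trigHD.
  have := smoothing2 x (Y j w *m pinvmx S) t0 (gradf hb).
  by rewrite -YE.
(* [A] is the second-order remainder around [rest], bounded by [a^2 K / t] times the weight. [B] is
   the change of the covariance term between [rest] and [W], bounded by [2 a K / t] times the mean
   weight, and it is multiplied by [a]; hence the constant 3. *)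
pose A w := ev (trigD (Y j w) g) (a *: W w) - ev (trigD (Y j w) g) (a *: rest j w) -
  a * ev (trigD (Y j w) (trigD (Y j w) g)) (a *: rest j w).
pose B w := cov_term g j (a *: rest j w) - cov_term g j (a *: W w).
have bmA : bounded_measurable A by apply: bmB; [exact: bmB|exact: bmZ].
have bmB' : bounded_measurable B by apply: bmB; apply: bmcov; exact: bmZmx.
have -> : gap g a j = E A + a * E B.
  rewrite /A /B ExB; [|exact/bm_integ/bmB|exact/bm_integ/bmZ].
  rewrite ExB; [|exact: bm_integ|exact: bm_integ].
  rewrite ExB; [|by apply/bm_integ/bmcov; exact: bmZmx|by apply/bm_integ/bmcov; exact: bmZmx].
  rewrite ExZ; last exact: bm_integ.
  by rewrite ExD_rest0 ExDD_rest /gap; ring.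
have leA : `|E A| <= a ^+ 2 * K / t * E (weight j).
  rewrite -ExZ; last exact: bm_integ.
  apply: normr_Ex_le; [exact: bm_integ|exact/bm_integ/bmZ|move=> w].
  rewrite /A (aWE a j w).
  apply: le_trans (ev_taylor2 _ _ (fun y => bound _ w y (bY j w))) _.
  by rewrite le_eqVlt; apply/orP; left; apply/eqP; field; rewrite gt_eqF.
have leB : `|E B| <= 2 * a * K / t * E (weight j).
  apply: normr_Ex_le_cst; first exact: bm_integ.
  move=> w; rewrite /B !cov_termE distrC -ExB; last 2 first.
  - by apply/bm_integ/bm_ev_trigDD => // i; exact: bm_cst.
  - by apply/bm_integ/bm_ev_trigDD => // i; exact: bm_cst.
  rewrite -ExZ; last exact: bm_integ.
  apply: normr_Ex_le.
  - apply: bm_integ; apply: bmB; apply: bm_ev_trigDD => // i; exact: bm_cst.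
  - exact/bm_integ/bmZ.
  move=> w'; rewrite (aWE a j w).
  apply: le_trans (ev_lipschitz _ _ (fun y => bound _ w' y (bY j w))) _.
  rewrite (ger0_norm a0).
  by rewrite le_eqVlt; apply/orP; left; apply/eqP; field; rewrite gt_eqF.
apply: le_trans (ler_normD _ _) _; rewrite normrM (ger0_norm a0).
have -> : 3 * a ^+ 2 * K / t * E (weight j) =
    a ^+ 2 * K / t * E (weight j) + a * (2 * a * K / t * E (weight j)).
  by field; rewrite gt_eqF.
by rewrite lerD// ler_wpM2l.
Qed.

(** With one derivative absorbed the singularity is only [1 / sqrt t], which the factor [cos theta]
    of the interpolation cancels. The two parts of [gap] are bounded separately and contribute
    equally. *)
Lemma gap_le2 t a j : 0 < t -> 0 <= a ->
  `|gap (trigH Q t f) a j| <=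
  2 * a * K / Num.sqrt t * E (fun w => Num.sqrt (weight j w)).
Proof.
move=> t0 a0; set g := trigH Q t f.
have rt0 : Num.sqrt t != 0 by rewrite gt_eqF// sqrtr_gt0.
have bound w x : `|ev (trigD (Y j w) (trigD (Y j w) g)) x| <=
    Num.sqrt (weight j w) / Num.sqrt t * K.
  rewrite /g -trigHD.
  have := smoothing1 x (Y j w *m pinvmx S) t0 (gradf (bY j w)).
  by rewrite -YE.
have bmr : bounded_measurable (fun w => Num.sqrt (weight j w)) by exact: bm_sqrt.
have le1 : `|E (fun w => ev (trigD (Y j w) g) (a *: W w))| <=
    a * K / Num.sqrt t * E (fun w => Num.sqrt (weight j w)).
  rewrite -[X in `|X|]subr0 -(ExD_rest0 g a j) -ExB; [|exact: bm_integ|exact: bm_integ].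
  rewrite -ExZ; last exact: bm_integ.
  apply: normr_Ex_le; [exact/bm_integ/bmB|exact/bm_integ/bmZ|move=> w].
  rewrite (aWE a j w); apply: le_trans (ev_lipschitz _ _ (bound w)) _.
  by rewrite (ger0_norm a0) le_eqVlt; apply/orP; left; apply/eqP; field.
have le2 : `|E (fun w => cov_term g j (a *: W w))| <=
    K / Num.sqrt t * E (fun w => Num.sqrt (weight j w)).
  apply: normr_Ex_le_cst; first by apply/bm_integ/bmcov; exact: bmZmx.
  move=> w; rewrite cov_termE -ExZ; last exact: bm_integ.
  apply: normr_Ex_le; [|exact/bm_integ/bmZ|move=> w'].
    by apply/bm_integ/bm_ev_trigDD => // i; exact: bm_cst.
  apply: le_trans (bound w' _) _.
  by rewrite le_eqVlt; apply/orP; left; apply/eqP; ring.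
apply: le_trans (ler_normB _ _) _; rewrite normrM (ger0_norm a0).
have -> : 2 * a * K / Num.sqrt t * E (fun w => Num.sqrt (weight j w)) =
    a * K / Num.sqrt t * E (fun w => Num.sqrt (weight j w)) +
    a * (K / Num.sqrt t * E (fun w => Num.sqrt (weight j w))) by field.
by rewrite lerD// ler_wpM2l.
Qed.

Lemma qform_sum xi : Q xi = \sum_j E (fun w => dot xi (Y j w) ^+ 2).
Proof.
have bmYY j k i : bounded_measurable (fun w => Y j w 0 i * Y j w 0 k) by exact: bmM.
transitivity (\sum_j \sum_i \sum_k xi 0 i * xi 0 k * E (fun w => Y j w 0 k * Y j w 0 i)).
  rewrite exchange_big/=; apply: eq_bigr => i _; rewrite exchange_big/=.
  rewrite mxE mulr_sumr; apply: eq_bigr => k _.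
  by rewrite covS mulrA mulr_sumr.
apply: eq_bigr => j _.
have -> : (fun w => dot xi (Y j w) ^+ 2) = (fun w => \sum_i \sum_k
    xi 0 i * xi 0 k * (Y j w 0 k * Y j w 0 i)).
  apply/funext => w; rewrite expr2 {1}/dot mulr_suml; apply: eq_bigr => i _.
  by rewrite mulr_sumr; apply: eq_bigr => k _; ring.
rewrite Ex_sum; last by move=> i; apply/bm_integ/bm_sum => k; exact: bmZ.
apply: eq_bigr => i _; rewrite Ex_sum; last by move=> k; apply/bm_integ/bmZ.
by apply: eq_bigr => k _; rewrite ExZ//; exact: bm_integ.
Qed.

Let Phi (theta : R) := \sum_(e <- f) e.1.1 * (expR (- Q e.1.2 * cos theta ^+ 2 / 2) *
  E (fun w => cos (sin theta * dot e.1.2 (W w) + e.2))).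

(** On each coefficient, scaling the sum brings down [<xi, W>], the sum of the [<xi, Y j>], and the
    heat factor brings down [Q xi], the sum of the second moments of [<xi, Y j>]. Both therefore
    split over [j]. *)
Lemma is_derive_interpolation (theta : R) : is_derive theta 1 Phi
  (cos theta * \sum_j gap (trigH Q (cos theta ^+ 2) f) (sin theta) j).
Proof.
pose A (e : R * 'rV[R]_q * R) := E (fun w => cos (sin theta * dot e.1.2 (W w) + e.2)).
pose B (e : R * 'rV[R]_q * R) :=
  E (fun w => dot e.1.2 (W w) * sin (sin theta * dot e.1.2 (W w) + e.2)).
pose E1 (e : R * 'rV[R]_q * R) := expR (- Q e.1.2 * cos theta ^+ 2 / 2).
have bmdW xi : bounded_measurable (fun w => dot xi (W w)) by exact: bm_dotr.
have bmdY j xi : bounded_measurable (fun w => dot xi (Y j w)) by exact: bm_dotr.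
have dterm e : is_derive theta 1 (fun t => e.1.1 * (expR (- Q e.1.2 * cos t ^+ 2 / 2) *
    E (fun w => cos (sin t * dot e.1.2 (W w) + e.2))))
    (e.1.1 * (E1 e * (- B e * cos theta) + A e * (E1 e * (- Q e.1.2 * cos theta * - sin theta)))).
  have d1 := @is_derive1_comp _ _ cos theta _ _
    (is_derive_sqr_half (- Q e.1.2) (cos theta)) (is_derive_cos theta).
  have d2 := @is_derive1_comp _ expR _ theta _ _ (is_derive_expR _) d1.
  have d3 := @is_derive1_comp _ _ sin theta _ _
    (@is_derive_Ex_cos _ _ _ P (fun w => dot e.1.2 (W w)) (fun=> e.2) (sin theta)
      (bmdW _).1 (measurable_cst _) (bm_integ P (bmX 2 (bmdW _)))) (is_derive_sin theta).
  exact: (is_deriveZ e.1.1 (is_deriveM d2 d3)).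
apply: is_derive_eq (is_derive_bigsum f dterm) _.
rewrite /gap sumrB -mulr_sumr.
set g := trigH _ _ _.
have g1 : \sum_j E (fun w => ev (trigD (Y j w) g) (sin theta *: W w)) =
    - \sum_(e <- f) e.1.1 * E1 e * B e.
  have bme j (e : R * 'rV[R]_q * R) : bounded_measurable (fun w =>
      dot e.1.2 (Y j w) * sin (dot e.1.2 (sin theta *: W w) + e.2)).
    apply: bmM => //; apply: bm_sin; apply: bmD; last exact: bm_cst.
    by apply: bm_dotr; exact: bmZmx.
  transitivity (\sum_j - \sum_(e <- g) e.1.1 * E (fun w =>
      dot e.1.2 (Y j w) * sin (dot e.1.2 (sin theta *: W w) + e.2))).
    apply: eq_bigr => j _.
    under eq_fun do rewrite ev_trigD.
    under eq_fun do under eq_bigr do rewrite -mulrA.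
    rewrite ExN; last by apply/bm_integ/bm_sum => e; exact: bmZ.
    rewrite Ex_sum; last by move=> e; apply/bm_integ/bmZ.
    by congr (- _); apply: eq_bigr => e _; rewrite ExZ//; exact: bm_integ.
  rewrite sumrN exchange_big/= /g big_map; congr (- _); apply: eq_bigr => e _ /=.
  rewrite -mulr_sumr -Ex_sum; last by move=> j; exact: bm_integ.
  congr (_ * _); first by rewrite /E1; congr (_ * expR _); ring.
  rewrite /B; congr Ex.
  apply/funext => w; rewrite -mulr_suml -dot_sumr dotZr.
  by [].
have g2 : \sum_j E (fun w => cov_term g j (sin theta *: W w)) =
    - \sum_(e <- f) e.1.1 * E1 e * Q e.1.2 * A e.
  have bmc (e : R * 'rV[R]_q * R) :
      bounded_measurable (fun w => cos (dot e.1.2 (sin theta *: W w) + e.2)).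
    apply: bm_cos; apply: bmD; last exact: bm_cst.
    by apply: bm_dotr; exact: bmZmx.
  transitivity (\sum_j - \sum_(e <- g) e.1.1 * E (fun w => dot e.1.2 (Y j w) ^+ 2) *
      E (fun w => cos (dot e.1.2 (sin theta *: W w) + e.2))).
    apply: eq_bigr => j _; rewrite /cov_term.
    rewrite ExN; last by apply/bm_integ/bm_sum => e; exact: bmZ.
    rewrite Ex_sum; last by move=> e; apply/bm_integ/bmZ.
    by congr (- _); apply: eq_bigr => e _; rewrite ExZ//; exact: bm_integ.
  rewrite sumrN exchange_big/= /g big_map; congr (- _); apply: eq_bigr => e _ /=.
  rewrite -mulr_suml -mulr_sumr -qform_sum.
  congr (_ * _ * _); first by rewrite /E1; congr (_ * expR _); ring.
  rewrite /A; congr Ex; by apply/funext => w; rewrite dotZr.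
rewrite g1 g2 mulrN opprK mulr_sumr addrC -sumrB mulr_sumr.
by apply: eq_bigr => e _; ring.
Qed.

(** The angle 0 is the Gaussian and [pi / 2] the sum. Up to [acos (1 / sqrt n)], [3 K q tan]
    integrates to [3 K q ln (sqrt n)]. Beyond, [2 K q sqrt n sin] integrates to [2 K q], because the
    cosine starts at [1 / sqrt n]. *)
Theorem stein_bound : (0 < n)%N -> (0 < q)%N -> 0 <= K ->
  `|E (fun w => ev f (W w)) - ev (trigH Q 1 f) 0| <= K * q%:R * (3 / 2 * ln n%:R + 2).
Proof.
move=> n0 q0 K0; set r : R := Num.sqrt n%:R.
have r1 : 1 <= r by rewrite -[1]sqrtr1 ler_wsqrtr// ler1n.
have r0 : 0 < r by lra.
have ir : -1 <= r^-1 <= 1.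
  by rewrite (@le_trans _ _ 0) ?invr_ge0 ?(ltW r0)// invf_le1.
pose theta := acos r^-1.
have costheta : cos theta = r^-1 by rewrite acosK// in_itv.
have th0 : 0 <= theta by apply: acos_ge0.
have thpi : theta <= pi / 2.
  rewrite leNgt; apply/negP => h.
  have : cos theta < 0.
    have := @ltr_cos R (pi / 2) theta.
    rewrite cos_pihalf => ->//.
    - by rewrite in_itv/= divr_ge0 ?pi_ge0//=; have := pi_ge0 R; lra.
    - by rewrite in_itv/= th0/= acos_lepi.
  by rewrite costheta; apply/negP; rewrite -leNgt invr_ge0 ltW.
have Phi0 : Phi 0 = ev (trigH Q 1 f) 0.
  rewrite /Phi /ev big_map; apply: eq_bigr => e _ /=.
  rewrite cos0 sin0 mulrA; congr (_ * expR _ * _); first by field.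
  have -> : (fun w => cos (0 * dot e.1.2 (W w) + e.2)) = (fun=> cos (dot e.1.2 0 + e.2)).
    by apply/funext => w; rewrite mul0r -(scale0r (0 : 'rV[R]_q)) dotZr mul0r.
  by rewrite Ex_cst.
have Phi1 : Phi (pi / 2) = E (fun w => ev f (W w)).
  rewrite /Phi /ev Ex_sum; last first.
    move=> e; apply: bm_integ; apply: bmZ; apply: bm_cos; apply: bmD; last exact: bm_cst.
    exact: bm_dotr.
  apply: eq_bigr => e _; rewrite cos_pihalf sin_pihalf expr0n/= mulr0 mul0r expR0 mul1r.
  rewrite -ExZ; last first.
    apply: bm_integ; apply: bm_cos; apply: bmD; last exact: bm_cst.
    by apply: bmZ; exact: bm_dotr.
  by congr Ex; apply/funext => w; rewrite mul1r.
have sinpos (x : R) : 0 <= x <= pi / 2 -> 0 <= sin x.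
  by move=> /andP[x0 x1]; apply: sin_ge0_pi; rewrite x0/=; have := pi_ge0 R; lra.
have gap3 (x : R) : 0 <= x <= pi / 2 -> 0 < cos x ->
   `|cos x * \sum_j gap (trigH Q (cos x ^+ 2) f) (sin x) j| <=
   3 * K * q%:R * (sin x / cos x).
  move=> hx cx; have s0 := sinpos _ hx.
  have t0 : 0 < cos x ^+ 2 by rewrite exprn_gt0.
  rewrite normrM (gtr0_norm cx).
  apply: le_trans (_ : cos x * (3 * sin x ^+ 2 * K / cos x ^+ 2 * q%:R) <= _).
    rewrite ler_wpM2l ?(ltW cx)//; apply: le_trans (ler_norm_sum _ _ _) _.
    apply: le_trans (ler_sum _ (fun j _ => gap_le3 j t0 s0)) _.
    rewrite -mulr_sumr ler_wpM2l ?sum_weight_le// divr_ge0 ?(ltW t0)//.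
    by rewrite !mulr_ge0// sqr_ge0.
  have -> : cos x * (3 * sin x ^+ 2 * K / cos x ^+ 2 * q%:R) =
      3 * K * q%:R * (sin x / cos x) * sin x.
    by field; rewrite gt_eqF.
  apply: ler_piMr; last by have := sin_max x; rewrite ler_norml => /andP[].
  by apply: mulr_ge0; [rewrite !mulr_ge0|rewrite divr_ge0 ?(ltW cx)].
have gap2 (x : R) : 0 <= x <= pi / 2 -> 0 <= cos x ->
   `|cos x * \sum_j gap (trigH Q (cos x ^+ 2) f) (sin x) j| <=
   2 * K * r * q%:R * sin x.
  move=> hx; rewrite le_eqVlt => /predU1P[<-|cx].
    by rewrite mul0r normr0 !mulr_ge0// ?sinpos// ltW.
  have s0 := sinpos _ hx.
  have t0 : 0 < cos x ^+ 2 by rewrite exprn_gt0.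
  rewrite normrM (gtr0_norm cx).
  apply: le_trans (_ : cos x * (2 * sin x * K / cos x * (r * q%:R)) <= _).
    rewrite ler_wpM2l ?(ltW cx)//; apply: le_trans (ler_norm_sum _ _ _) _.
    apply: le_trans (ler_sum _ (fun j _ => gap_le2 j t0 s0)) _.
    rewrite sqrtr_sqr (gtr0_norm cx).
    rewrite -mulr_sumr ler_wpM2l ?sum_sqrt_weight_le// divr_ge0 ?(ltW cx)//.
    by rewrite !mulr_ge0.
  by rewrite le_eqVlt; apply/orP; left; apply/eqP; field; rewrite gt_eqF.
have cosdec (x y : R) : 0 <= x -> x <= y -> y <= pi / 2 -> cos y <= cos x.
  move=> x0 xy ypi; have p0 := pi_ge0 R.
  by rewrite leNgt ltr_cos -?leNgt// in_itv/=; apply/andP; split; lra.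
have part1 : `|Phi theta - Phi 0| <= 3 * K * q%:R * (ln n%:R / 2).
  have := @norm_increment_le R Phi
    (fun x => cos x * \sum_j gap (trigH Q (cos x ^+ 2) f) (sin x) j)
    (fun x => (- (3 * K * q%:R)) * ln (cos x))
    (fun x => 3 * K * q%:R * (sin x / cos x)) 0 theta th0.
  have -> : - (3 * K * q%:R) * ln (cos theta) - - (3 * K * q%:R) * ln (cos 0) =
      3 * K * q%:R * (ln n%:R / 2).
    rewrite cos0 ln1 mulr0 subr0 costheta lnV ?posrE//.
    have -> : ln n%:R = 2 * ln r.
      by rewrite mulr_natl -lnXn// sqr_sqrtr.
    by field.
  have cpos (x : R) : 0 <= x <= theta -> 0 < cos x.
    move=> /andP[x0 xt]; apply: lt_le_trans (cosdec _ _ x0 xt thpi).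
    by rewrite costheta invr_gt0.
  apply => x hx.
  - exact: is_derive_interpolation.
  - have dln := @is_derive1_comp _ _ cos x _ _ (is_derive1_ln (cpos x hx)) (is_derive_cos x).
    apply: is_derive_eq (is_deriveZ (- (3 * K * q%:R)) dln) _.
    rewrite -[LHS]/(- (3 * K * q%:R) * ((cos x)^-1 * - sin x)); ring.
  - by apply: gap3 (cpos _ hx); move/andP : hx => [-> /le_trans ->].
have part2 : `|Phi (pi / 2) - Phi theta| <= 2 * K * q%:R.
  have := @norm_increment_le R Phi
    (fun x => cos x * \sum_j gap (trigH Q (cos x ^+ 2) f) (sin x) j)
    (fun x => (- (2 * K * r * q%:R)) * cos x)
    (fun x => 2 * K * r * q%:R * sin x) theta (pi / 2) thpi.
  have -> : - (2 * K * r * q%:R) * cos (pi / 2) - - (2 * K * r * q%:R) * cos theta =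
      2 * K * q%:R.
    by rewrite cos_pihalf costheta; field; rewrite gt_eqF.
  apply => x hx.
  - exact: is_derive_interpolation.
  - apply: is_derive_eq (is_deriveZ (- (2 * K * r * q%:R)) (is_derive_cos x)) _.
    rewrite -[LHS]/(- (2 * K * r * q%:R) * - sin x); ring.
  - move/andP : hx => [tx xpi]; have x0 := le_trans th0 tx.
    by apply: gap2; [rewrite x0|rewrite -(cos_pihalf R); exact: cosdec].
rewrite -Phi1 -Phi0.
have -> : Phi (pi / 2) - Phi 0 = (Phi (pi / 2) - Phi theta) + (Phi theta - Phi 0) by ring.
apply: le_trans (ler_normD _ _) _.
have -> : K * q%:R * (3 / 2 * ln n%:R + 2) = 2 * K * q%:R + 3 * K * q%:R * (ln n%:R / 2).
  by field.
exact: lerD.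
Qed.

End SteinInterpolation.

(** * Anticoncentration for a sum of independent bounded variables *)

Section SumAnticoncentration.
Context d (T : measurableType d) (R : realType) (P : probability T R).
Variables (n : nat).
Local Notation E := (Ex P).

Lemma Ex_sqr_sum (B : 'I_n -> T -> R) : (forall j, bounded_measurable (B j)) ->
  (forall j k : 'I_n, j != k -> E (fun w => B j w * B k w) = 0) ->
  E (fun w => (\sum_j B j w) ^+ 2) = \sum_j E (fun w => B j w ^+ 2).
Proof.
move=> bmB0 orth.
under eq_fun do rewrite expr2 mulr_suml.
have bmBB j k : bounded_measurable (fun w => B j w * B k w) by exact: bmM.
under eq_fun do under eq_bigr do rewrite mulr_sumr.
rewrite Ex_sum; last by move=> j; apply/bm_integ/bm_sum.
apply: eq_bigr => j _; rewrite Ex_sum; last by move=> k; exact: bm_integ.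
rewrite (bigD1 j)//= big1 ?addr0// => k kj.
by apply: orth; rewrite eq_sym.
Qed.

Variables (Z : 'I_n -> T -> R) (tau sigma : R).
Let U w := \sum_j Z j w.

Hypothesis mZ : forall j, measurable_fun setT (Z j).
Hypothesis bZ : forall j w, `|Z j w| <= tau.
Hypothesis sigma_gt0 : 0 < sigma.
Hypothesis varZ : \sum_j E (fun w => Z j w ^+ 2) = sigma ^+ 2.
Hypothesis uncorrelated : forall j (h : R -> R) (M : R), measurable_fun setT h ->
  (forall x, `|h x| <= M) -> E (fun w => Z j w * h (U w - Z j w)) = 0.
Hypothesis orthZ : forall j k : 'I_n, j != k -> E (fun w => Z j w * Z k w) = 0.
Hypothesis indZ : forall j k : 'I_n, j != k ->
  E (fun w => Z j w ^+ 2 * Z k w ^+ 2) = E (fun w => Z j w ^+ 2) * E (fun w => Z k w ^+ 2).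

Let bmZj j : bounded_measurable (Z j).
Proof. by split; [exact: mZ|exists tau => w; exact: bZ]. Qed.

Let bmU : bounded_measurable U.
Proof. exact: bm_sum. Qed.

Let bmZ2 j : bounded_measurable (fun w => Z j w ^+ 2).
Proof. exact: bmX. Qed.

Let V w := \sum_j Z j w ^+ 2.

(** The variances of the [Z j ^+ 2] add up, and each is at most the fourth moment, hence at most
    [tau^2] times the second. *)
Let Ex_V_sqr : E (fun w => (V w - sigma ^+ 2) ^+ 2) <= tau ^+ 2 * sigma ^+ 2.
Proof.
pose s j := E (fun w => Z j w ^+ 2).
pose B j w := Z j w ^+ 2 - s j.
have bmB' j : bounded_measurable (B j) by apply: bmB => //; exact: bm_cst.
have -> : (fun w => (V w - sigma ^+ 2) ^+ 2) = (fun w => (\sum_j B j w) ^+ 2).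
  by apply/funext => w; rewrite /V -varZ -sumrB.
rewrite Ex_sqr_sum//; last first.
  move=> j k jk; rewrite /B.
  have -> : (fun w => (Z j w ^+ 2 - s j) * (Z k w ^+ 2 - s k)) =
      (fun w => (Z j w ^+ 2 * Z k w ^+ 2 - s k * Z j w ^+ 2) -
                (s j * Z k w ^+ 2 - s j * s k)).
    by apply/funext => w; ring.
  have i1 := bmM (bmZ2 j) (bmZ2 k).
  have i2 := bmZ (s k) (bmZ2 j).
  have i3 := bmZ (s j) (bmZ2 k).
  have i4 := bm_cst T (s j * s k).
  rewrite ExB; [|exact/bm_integ/bmB|exact/bm_integ/bmB].
  rewrite ExB; [|exact: bm_integ|exact: bm_integ].
  rewrite ExB; [|exact: bm_integ|exact: bm_integ].
  rewrite Ex_cst !ExZ; [|exact: bm_integ|exact: bm_integ].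
  by rewrite indZ// -/(s j) -/(s k); ring.
rewrite -varZ mulr_sumr; apply: ler_sum => j _.
rewrite -ExZ; last exact: bm_integ.
apply: le_trans (_ : E (fun w => Z j w ^+ 2 * Z j w ^+ 2) <= _); last first.
  apply: Ex_le; [exact/bm_integ/bmM|exact/bm_integ/bmZ|move=> w].
  rewrite ler_wpM2r ?sqr_ge0// -[Z j w ^+ 2]real_normK ?num_real//.
  by rewrite ler_sqr ?nnegrE// (le_trans _ (bZ j w)).
have -> : (fun w => B j w ^+ 2) = (fun w => Z j w ^+ 2 * Z j w ^+ 2 -
    (2 * s j * Z j w ^+ 2 - s j ^+ 2)).
  by apply/funext => w; rewrite /B; ring.
have i1 := bmM (bmZ2 j) (bmZ2 j).
have i2 := bmZ (2 * s j) (bmZ2 j).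
have i3 := bm_cst T (s j ^+ 2).
rewrite ExB; [|exact: bm_integ|exact/bm_integ/bmB].
rewrite ExB; [|exact: bm_integ|exact: bm_integ].
rewrite ExZ; last exact: bm_integ.
rewrite Ex_cst -/(s j) lerBlDr lerDl.
have -> : 2 * s j * s j - s j ^+ 2 = s j ^+ 2 by ring.
exact: sqr_ge0.
Qed.

(* Stein's argument: test against the function [h] that is the identity near
   the interval and constant away from it. *)
Lemma sum_anticoncentration (a b : R) : a <= b ->
  fine (P (U @^-1` `[a, b])) <= (b - a + 2 * tau) / sigma + tau ^+ 2 / sigma ^+ 2.
Proof.
move=> ab.
have [j0|noj] := pselect (exists j : 'I_n, True); last first.
  exfalso; move: sigma_gt0; rewrite lt0r => /andP[/negP s0 _]; apply: s0.
  rewrite -sqrf_eq0 -varZ big1// => j _; exfalso; apply: noj; by exists j.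
case: j0 => j0 _.
have [tau0|tauN] := leP 0 tau; last first.
  exfalso; move: sigma_gt0; rewrite lt0r => /andP[/negP s0 _]; apply: s0.
  rewrite -sqrf_eq0 -varZ big1// => j _.
  rewrite (_ : (fun w => _) = cst 0) ?Ex_cst//; apply/funext => w; exfalso.
  by have := le_lt_trans (le_trans (normr_ge0 _) (bZ j w)) tauN; rewrite ltxx.
(* The margin [tau] keeps [U - Z j] in the zone where [h] is the identity whenever [U] is in
   [[a, b]]. *)
pose c := (a + b) / 2; pose L := (b - a) / 2 + tau.
have L0 : 0 <= L by rewrite /L; lra.
pose h (x : R) := Num.max (- L) (Num.min L (x - c)).
have mh : measurable_fun setT h.
  apply: measurable_maxr => //; apply: measurable_minr => //; exact: measurable_funB.
have hL x : `|h x| <= L.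
  rewrite /h ler_norml; apply/andP; split; first by rewrite le_max lexx.
  by rewrite ge_max ge_min lexx andbT; lra.
have hid x : c - L <= x <= c + L -> h x = x - c.
  move=> /andP[x1 x2]; rewrite /h.
  have -> : Num.min L (x - c) = x - c by apply/min_idPr; lra.
  by apply/max_idPr; lra.
have hmono x y : x <= y -> h x <= h y.
  move=> xy; rewrite /h ge_max le_max lexx /= le_max le_min !ge_min lexx /=.
  by apply/orP; right; apply/orP; right; lra.
have bmh (f : T -> R) : bounded_measurable f -> bounded_measurable (fun w => h (f w)).
  by move=> [mf _]; split; [exact: measurableT_comp|exists L].
pose A := U @^-1` `[a, b].
have mA : measurable A.
  by rewrite -[X in measurable X]setTI; apply: bmU.1 => //; exact: measurable_itv.
have bmA : bounded_measurable (\1_A : T -> R).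
  split; first exact: measurable_indic.
  by exists 1 => w; rewrite indicE; case: (_ \in _); rewrite ?normr1 ?normr0.
have bmUj j : bounded_measurable (fun w => U w - Z j w) by exact: bmB.
have upper : E (fun w => U w * h (U w)) <= L * sigma.
  apply: le_trans (_ : E (fun w => L * `|U w|) <= _).
    apply: Ex_le; first by apply/bm_integ/bmM => //; exact: bmh.
      by apply: integZ; apply: integ_norm; exact: bm_integ.
    move=> w; apply: le_trans (ler_norm _) _.
    by rewrite normrM mulrC ler_wpM2r.
  rewrite ExZ; last by apply: integ_norm; exact: bm_integ.
  rewrite ler_wpM2l// -(ger0_norm (Ex_ge0 _ _)); last by move=> w; exact: normr_ge0.
  rewrite -(gtr0_norm sigma_gt0) -!sqrtr_sqr ler_wsqrtr// -varZ -Ex_sqr_sum//.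
  by apply: Ex_sqr_norm_le; [exact/bm_integ/bmX|exact: bmU.1].
(* [h (U - Z j)] may be subtracted since it is uncorrelated with [Z j]. The product
   [Z j * (h U - h (U - Z j))] is then nonnegative by monotonicity, and equals [Z j ^+ 2] on the
   event. *)
have lower : E (fun w => \1_A w * V w) <= E (fun w => U w * h (U w)).
  have -> : E (fun w => U w * h (U w)) =
      \sum_j E (fun w => Z j w * (h (U w) - h (U w - Z j w))).
    under eq_fun do rewrite mulr_suml.
    rewrite Ex_sum; last by move=> j; apply/bm_integ/bmM => //; exact: bmh.
    apply: eq_bigr => j _.
    under [in RHS]eq_fun do rewrite mulrBr.
    rewrite ExB; [|by apply/bm_integ/bmM => //; exact: bmh
                  |by apply/bm_integ/bmM => //; exact: bmh].
    by rewrite (uncorrelated j mh hL) subr0.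
  have -> : E (fun w => \1_A w * V w) = \sum_j E (fun w => \1_A w * Z j w ^+ 2).
    by under eq_fun do rewrite mulr_sumr; rewrite Ex_sum// => j; exact/bm_integ/bmM.
  apply: ler_sum => j _; apply: Ex_le; first exact/bm_integ/bmM.
    by apply/bm_integ/bmM => //; apply: bmB; exact: bmh.
  move=> w; have [wA|wA] := pselect (A w).
    rewrite indicE mem_set// mul1r.
    have /andP[aU Ub] : a <= U w <= b by move: wA; rewrite /A /= in_itv.
    have /andP[z1 z2] : - tau <= Z j w <= tau by rewrite -ler_norml.
    rewrite !hid.
    - by rewrite le_eqVlt; apply/orP; left; apply/eqP; ring.
    - rewrite /c /L; apply/andP; split; lra.
    - rewrite /c /L; apply/andP; split; lra.
  rewrite indicE memNset// mul0r.
  have [z0|z0] := leP 0 (Z j w).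
    by rewrite mulr_ge0// subr_ge0; apply: hmono; lra.
  by rewrite mulr_le0 ?(ltW z0)// subr_le0; apply: hmono; lra.
(* [V] is random, so it is compared with its mean [x] through [V >= x / 2 - (V - x)^2 / (2 x)], an
   identity up to [V^2 / (2 x)]. The fluctuation costs [tau^2 / 2] by [Ex_V_sqr]. *)
have key : sigma ^+ 2 / 2 * E (\1_A) - tau ^+ 2 / 2 <= E (fun w => \1_A w * V w).
  have bmV : bounded_measurable V by exact: bm_sum.
  have bmV2 : bounded_measurable (fun w => (V w - sigma ^+ 2) ^+ 2).
    by apply: bmX; apply: bmB => //; exact: bm_cst.
  apply: le_trans (_ : E (fun w => sigma ^+ 2 / 2 * \1_A w -
      (2 * sigma ^+ 2)^-1 * (V w - sigma ^+ 2) ^+ 2) <= _).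
    rewrite ExB; [|exact/bm_integ/bmZ|exact/bm_integ/bmZ].
    rewrite !ExZ; [|exact: bm_integ|exact: bm_integ].
    rewrite lerB// ler_pdivrMl; last by rewrite mulr_gt0// exprn_gt0.
    apply: le_trans Ex_V_sqr _.
    by rewrite le_eqVlt; apply/orP; left; apply/eqP; field.
  apply: Ex_le; first by apply: bm_integ; apply: bmB; exact: bmZ.
    exact/bm_integ/bmM.
  move=> w; have V0 : 0 <= V w by apply: sumr_ge0 => j _; exact: sqr_ge0.
  have s2 : 0 < sigma ^+ 2 by rewrite exprn_gt0.
  set x := sigma ^+ 2 in s2 *.
  rewrite indicE; case: (_ \in _); rewrite ?mulr1 ?mul1r ?mulr0 ?mul0r.
    rewrite -subr_ge0.
    have -> : V w - (x / 2 - (2 * x)^-1 * (V w - x) ^+ 2) = V w ^+ 2 / (2 * x).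
      by field; rewrite gt_eqF.
    by rewrite divr_ge0 ?sqr_ge0// mulr_ge0// ltW.
  by rewrite sub0r oppr_le0 mulr_ge0 ?sqr_ge0// invr_ge0 mulr_ge0// ltW.
have := le_trans key (le_trans lower upper).
rewrite Ex_probability// -/A; set p := fine _ => H.
have s2 : 0 < sigma ^+ 2 by rewrite exprn_gt0.
rewrite -(ler_pM2l s2).
have -> : sigma ^+ 2 * ((b - a + 2 * tau) / sigma + tau ^+ 2 / sigma ^+ 2) =
    2 * (L * sigma + tau ^+ 2 / 2).
  by rewrite /L; field; rewrite gt_eqF.
lra.
Qed.

End SumAnticoncentration.

(** * Bernstein polynomials *)

Section Bernstein.
Variable R : realType.
Implicit Types (a b : nat -> R) (x y : R).

(* The Bernstein polynomial with coefficients [a], by de Casteljau's recursion. *)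
Fixpoint bern (N : nat) a y : R :=
  if N is N'.+1 then (1 - y) * bern N' a y + y * bern N' (fun k => a k.+1) y
  else a 0%N.

Definition fdiff a (k : nat) : R := a k.+1 - a k.

Lemma bern_le N a b y : 0 <= y <= 1 -> (forall k, a k <= b k) ->
  bern N a y <= bern N b y.
Proof.
move=> /andP[y0 y1]; elim: N a b => [|N IH] a b ab /=; first exact: ab.
apply: lerD; apply: ler_wpM2l; rewrite ?subr_ge0//; exact: IH.
Qed.

Lemma bern_cst N c y : bern N (fun=> c) y = c.
Proof. by elim: N => //= N ->; ring. Qed.

Lemma bernD N a b y : bern N (fun k => a k + b k) y = bern N a y + bern N b y.
Proof. by elim: N a b => //= N IH a b; rewrite !IH; ring. Qed.

Lemma bernZ N c a y : bern N (fun k => c * a k) y = c * bern N a y.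
Proof. by elim: N a => //= N IH a; rewrite !IH; ring. Qed.

(** For [y] in [0, 1], this is the second moment about [c] of a binomial variable: squared bias plus
    variance. *)
Lemma bern_sqr N c y :
  bern N (fun k => (k%:R - c) ^+ 2) y = (N%:R * y - c) ^+ 2 + N%:R * (y * (1 - y)).
Proof.
elim: N c => [|N IH] c /=; first by ring.
have -> : (fun k => (k.+1%:R - c) ^+ 2) = (fun k : nat => (k%:R - (c - 1)) ^+ 2).
  by apply/funext => k; rewrite -natr1; ring.
by rewrite !IH -natr1; ring.
Qed.

Lemma bern_norm_le N a M y : 0 <= y <= 1 -> (forall k, `|a k| <= M) -> `|bern N a y| <= M.
Proof.
move=> y01 aM; rewrite ler_norml; apply/andP; split.
  rewrite -[leLHS](bern_cst N _ y); apply: bern_le => // k.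
  by have := aM k; rewrite ler_norml => /andP[].
rewrite -[leRHS](bern_cst N _ y); apply: bern_le => // k.
by have := aM k; rewrite ler_norml => /andP[].
Qed.

Lemma is_derive_bern N a y :
  is_derive y 1 (bern N a) (N%:R * bern N.-1 (fdiff a) y).
Proof.
elim: N a => [|N IH] a.
  by rewrite mul0r; exact: is_derive_cst.
have d1 : is_derive y 1 (fun t : R => 1 + -1 * t) (-1) by exact: is_derive_affine.
have d2 : is_derive y 1 (fun t : R => t) 1 by exact: is_derive_id.
have := is_deriveD (is_deriveM d1 (IH a)) (is_deriveM d2 (IH (fun k => a k.+1))).
have -> : (fun t : R => 1 + -1 * t) * bern N a + (fun t : R => t) * bern N (fun k => a k.+1)
    = bern N.+1 a.
  by apply/funext => t; rewrite !fctE /= mulN1r.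
move=> H; apply: is_derive_eq H _.
rewrite -[LHS]/((1 + -1 * y) * (N%:R * bern N.-1 (fdiff a) y) + bern N a y * -1 +
  (y * (N%:R * bern N.-1 (fdiff (fun k => a k.+1)) y) + bern N (fun k => a k.+1) y * 1)).
have -> : bern N (fdiff a) y = bern N (fun k => a k.+1) y - bern N a y.
  rewrite -mulN1r -bernZ -bernD; congr (bern N _ y); apply/funext => k.
  by rewrite /fdiff mulN1r.
case: N {IH d1 d2} => [|N] /=.
  by ring.
have -> : bern N (fdiff a) y = bern N (fun k => a k.+1) y - bern N a y.
  rewrite -mulN1r -bernZ -bernD; congr (bern N _ y); apply/funext => k.
  by rewrite /fdiff mulN1r.
have -> : bern N (fdiff (fun k => a k.+1)) y =
    bern N (fun k => a k.+2) y - bern N (fun k => a k.+1) y.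
  rewrite -mulN1r -bernZ -bernD; congr (bern N _ y); apply/funext => k.
  by rewrite /fdiff mulN1r.
by rewrite -(natr1 N.+1); ring.
Qed.

(** Bernstein's argument: a tolerance quadratic in the distance to the mean [N y] averages to the
    binomial variance. *)
Lemma bern_approx N a A al be y : 0 <= y <= 1 ->
  (forall k : nat, `|a k - A| <= al + be * (k%:R - N%:R * y) ^+ 2) ->
  `|bern N a y - A| <= al + be * (N%:R * (y * (1 - y))).
Proof.
move=> y01 h.
have E : bern N (fun k => al + be * (k%:R - N%:R * y) ^+ 2) y =
    al + be * (N%:R * (y * (1 - y))).
  by rewrite bernD bern_cst bernZ bern_sqr subrr expr0n/= add0r.
have -> : bern N a y - A = bern N (fun k => a k + - A) y by rewrite bernD bern_cst.
rewrite ler_norml -E -mulN1r -bernZ.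
apply/andP; split; apply: bern_le => // k.
  by have := h k; rewrite ler_norml mulN1r => /andP[].
by have := h k; rewrite ler_norml => /andP[].
Qed.

End Bernstein.

(** * The quadratic spline *)

Section QuadraticSpline.
Variable R : realType.
Implicit Types (x u v al be : R).

Definition sqr_pos x : R := if 0 <= x then x ^+ 2 else 0.

(** The second derivative of [sqr_pos] is 0 or 2 away from the origin. Steps [(1, 1)], [(v - u, 1)]
    and [(de, de)] give respectively the range, the Lipschitz constant and the curvature of the
    spline. *)
Lemma sqr_pos_diff2 x al be : 0 <= al -> 0 <= be ->
  0 <= sqr_pos (x + al + be) - sqr_pos (x + al) - sqr_pos (x + be) + sqr_pos x <= 2 * al * be.
Proof.
move=> a0 b0; rewrite /sqr_pos.
case: (leP 0 x) => h1; case: (leP 0 (x + al)) => h2; case: (leP 0 (x + be)) => h3;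
  case: (leP 0 (x + al + be)) => h4; try (exfalso; lra);
  apply/andP; split; nra.
Qed.

(* The primitive of the hat function on [-1, 1]. *)
Definition spline u : R := (sqr_pos (u + 1) - 2 * sqr_pos u + sqr_pos (u - 1)) / 2.

Lemma spline_ge0_le1 u : 0 <= spline u <= 1.
Proof.
have := @sqr_pos_diff2 (u - 1) 1 1 ler01 ler01.
by rewrite subrK /spline => /andP[? ?]; apply/andP; split; lra.
Qed.

Lemma spline1 u : 1 <= u -> spline u = 1.
Proof.
move=> u1; rewrite /spline /sqr_pos.
have -> : 0 <= u + 1 by lra.
have -> : 0 <= u by lra.
have -> : 0 <= u - 1 by lra.
by field.
Qed.

Lemma spline0 u : u <= -1 -> spline u = 0.
Proof.
move=> u1; rewrite /spline /sqr_pos.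
have -> : (0 <= u - 1) = false by apply/negbTE; rewrite -ltNge; lra.
have -> : (0 <= u) = false by apply/negbTE; rewrite -ltNge; lra.
case: ifPn => h; last by lra.
have -> : u = -1 by lra.
by field.
Qed.

Lemma spline_lipschitz u v : `|spline v - spline u| <= `|v - u|.
Proof.
wlog uv : u v / u <= v.
  move=> H; have [/H//|/ltW/H] := leP u v.
  by rewrite distrC (distrC u v).
have d0 : 0 <= v - u by lra.
have := @sqr_pos_diff2 u (v - u) 1 d0 ler01.
have := @sqr_pos_diff2 (u - 1) (v - u) 1 d0 ler01.
have -> : u - 1 + (v - u) + 1 = v by ring.
have -> : u - 1 + (v - u) = v - 1 by ring.
have -> : u - 1 + 1 = u by ring.
have -> : u + (v - u) = v by ring.
rewrite (ger0_norm d0) /spline => /andP[? ?] /andP[? ?].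
by rewrite ler_norml; apply/andP; split; lra.
Qed.

Lemma spline_diff2 u de : 0 <= de ->
  `|spline (u + de + de) - 2 * spline (u + de) + spline u| <= 2 * de ^+ 2.
Proof.
move=> d0.
have := @sqr_pos_diff2 (u + 1) de de d0 d0.
have := @sqr_pos_diff2 u de de d0 d0.
have := @sqr_pos_diff2 (u - 1) de de d0 d0.
have -> : u - 1 + de + de = u + de + de - 1 by ring.
have -> : u - 1 + de = u + de - 1 by ring.
have -> : u + 1 + de + de = u + de + de + 1 by ring.
have -> : u + 1 + de = u + de + 1 by ring.
rewrite /spline => /andP[? ?] /andP[? ?] /andP[? ?].
by rewrite ler_norml; apply/andP; split; lra.
Qed.

End QuadraticSpline.

(** * The smooth step and its differential inequality *)

Section SmoothStep.
Variable R : realType.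

(** The quadratic Taylor upper bound, evaluated at its minimizer [t - dp t / M], must stay
    nonnegative. *)
Lemma sqr_derive_le (p dp ddp : R -> R) (M : R) : 0 < M ->
  (forall t : R, is_derive t 1 p (dp t)) -> (forall t : R, is_derive t 1 dp (ddp t)) ->
  (forall t, `|ddp t| <= M) -> (forall t, 0 <= p t) ->
  forall t, dp t ^+ 2 <= 2 * M * p t.
Proof.
move=> M0 d1 d2 ddM p0 t.
have := taylor2_derive t (- dp t / M) d1 d2 ddM.
rewrite ler_norml => /andP[_].
have := p0 (t + - dp t / M); set P := p (t + _).
have -> : M * (- dp t / M) ^+ 2 / 2 = dp t ^+ 2 / M / 2 by field; rewrite gt_eqF.
have -> : - dp t / M * dp t = - (dp t ^+ 2 / M) by field; rewrite gt_eqF.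
move=> ? ?.
have h : dp t ^+ 2 / M <= 2 * p t by lra.
by move: h; rewrite ler_pdivrMr// mulrAC.
Qed.

Lemma sin_ge_half (u : R) : 0 <= u <= 1 -> u / 2 <= sin u.
Proof.
move=> /andP[u0 u1].
have := @taylor2_derive R sin cos (fun y => - sin y) 1 0 u.
rewrite add0r sin0 cos0 subr0 mulr1 mul1r => H.
have {}H : `|sin u - u| <= u ^+ 2 / 2.
  by apply: H => y; rewrite normrN sin_max.
by move: H; rewrite ler_norml => /andP[? _]; nra.
Qed.

(* Frequency [1 / L] makes the step periodic; [N] is the degree in [sin (t / L)]. *)
Definition step (L rho : R) (N : nat) (t : R) : R :=
  bern N (fun k => spline (L * (2 * k%:R / N%:R - 1) / rho)) ((1 + sin (t / L)) / 2).

Section StepProperties.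
Variables (L rho : R) (N : nat).
Hypotheses (rho0 : 0 < rho) (Lrho : rho <= L) (N0 : (0 < N)%N).

Let L0 : 0 < L. Proof. exact: lt_le_trans rho0 Lrho. Qed.
Let Nr0 : 0 < N%:R :> R. Proof. by rewrite ltr0n. Qed.
Let a k : R := spline (L * (2 * k%:R / N%:R - 1) / rho).
Let y (t : R) := (1 + sin (t / L)) / 2.
Let de : R := 2 * L / (N%:R * rho).

Let y01 t : 0 <= y t <= 1.
Proof.
have := sin_max (t / L); rewrite ler_norml /y => /andP[? ?].
by apply/andP; split; lra.
Qed.

Let dy (t : R) : is_derive t 1 y (cos (t / L) / (2 * L)).
Proof.
have d1 : is_derive t 1 (fun s : R => sin (0 + L^-1 * s)) (cos (0 + L^-1 * t) * L^-1).
  by apply: is_derive_comp_affine; exact: is_derive_sin.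
have d2 : is_derive (sin (0 + L^-1 * t)) 1 (fun s : R => 2^-1 + 2^-1 * s) (2^-1).
  exact: is_derive_affine.
have := @is_derive1_comp _ _ (fun s : R => sin (0 + L^-1 * s)) t _ _ d2 d1.
have -> : (fun s : R => 2^-1 + 2^-1 * s) \o (fun s : R => sin (0 + L^-1 * s)) = y.
  by apply/funext => s; rewrite /y /= add0r (mulrC L^-1 s); field.
move=> H; apply: is_derive_eq H _; rewrite add0r (mulrC L^-1 t).
by field; rewrite gt_eqF.
Qed.

Let dstep (t : R) := N%:R * bern N.-1 (fdiff a) (y t) * (cos (t / L) / (2 * L)).

Lemma is_derive_step (t : R) : is_derive t 1 (step L rho N) (dstep t).
Proof. exact: (@is_derive1_comp _ _ y t _ _ (is_derive_bern N a (y t)) (dy t)). Qed.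

Let ddstep (t : R) := N%:R * (N.-1%:R * bern N.-2 (fdiff (fdiff a)) (y t) *
  (cos (t / L) / (2 * L))) * (cos (t / L) / (2 * L)) +
  N%:R * bern N.-1 (fdiff a) (y t) * (- sin (t / L) / (2 * L ^+ 2)).

Let is_derive_dstep (t : R) : is_derive t 1 dstep (ddstep t).
Proof.
have d1 := is_deriveZ (N%:R : R) (@is_derive1_comp _ _ y t _ _
  (is_derive_bern N.-1 (fdiff a) (y t)) (dy t)).
have d2 : is_derive t 1 (fun s : R => cos (s / L) / (2 * L)) (- sin (t / L) / (2 * L ^+ 2)).
  have d3 : is_derive t 1 (fun s : R => cos (0 + L^-1 * s)) (- sin (0 + L^-1 * t) * L^-1).
    by apply: is_derive_comp_affine; exact: is_derive_cos.
  have := is_deriveZ (2 * L)^-1 d3.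
  have -> : (2 * L)^-1 \*: (fun s : R => cos (0 + L^-1 * s)) =
      (fun s : R => cos (s / L) / (2 * L)).
    apply/funext => s; rewrite -[LHS]/((2 * L)^-1 * cos (0 + L^-1 * s)).
    by rewrite add0r (mulrC L^-1 s) [LHS]mulrC.
  move=> H; apply: is_derive_eq H _; rewrite add0r (mulrC L^-1 t).
  rewrite -[LHS]/((2 * L)^-1 * (- sin (t / L) * L^-1)).
  by field; rewrite gt_eqF.
apply: is_derive_eq (is_deriveM d1 d2) _.
rewrite -[LHS]/((N%:R * bern N.-1 (fdiff a) (y t)) * (- sin (t / L) / (2 * L ^+ 2)) +
  (cos (t / L) / (2 * L)) * (N%:R * (N.-1%:R * bern N.-2 (fdiff (fdiff a)) (y t) *
  (cos (t / L) / (2 * L))))).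
by rewrite /ddstep; ring.
Qed.

Let de0 : 0 <= de.
Proof. by rewrite /de divr_ge0 ?mulr_ge0 ?(ltW L0)// ltW. Qed.

Let argS k : L * (2 * k.+1%:R / N%:R - 1) / rho = L * (2 * k%:R / N%:R - 1) / rho + de.
Proof. by rewrite /de -natr1; field; rewrite !gt_eqF. Qed.

Let fdiff_a k : `|fdiff a k| <= de.
Proof.
rewrite /fdiff /a argS; apply: le_trans (spline_lipschitz _ _) _.
by rewrite addrC addKr ger0_norm.
Qed.

Let fdiff2_a k : `|fdiff (fdiff a) k| <= 2 * de ^+ 2.
Proof.
have := spline_diff2 (L * (2 * k%:R / N%:R - 1) / rho) de0.
rewrite -!argS -/(a k) -/(a k.+1) -/(a k.+2).
by rewrite (_ : a k.+2 - 2 * a k.+1 + a k = fdiff (fdiff a) k)// /fdiff; ring.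
Qed.

(** The powers of [N] cancel against the mesh [de]: second differences contribute [2 / rho^2] times
    [(N - 1) / N], first differences [1 / rho^2] times [rho / L]. The bound is thus uniform in [N]
    and [L], which can be refined freely. *)
Lemma ddstep_le t : `|ddstep t| <= 3 / rho ^+ 2.
Proof.
rewrite /ddstep; apply: le_trans (ler_normD _ _) _.
have b1 := bern_norm_le N.-1 (y01 t) fdiff_a.
have b2 := bern_norm_le N.-2 (y01 t) fdiff2_a.
have c1 := cos_max (t / L); have s1 := sin_max (t / L).
set B1 := bern N.-1 _ _ in b1 *; set B2 := bern N.-2 _ _ in b2 *.
have e1 : `|N%:R * (N.-1%:R * B2 * (cos (t / L) / (2 * L))) * (cos (t / L) / (2 * L))| <=
    2 / rho ^+ 2.
  have -> : N%:R * (N.-1%:R * B2 * (cos (t / L) / (2 * L))) * (cos (t / L) / (2 * L)) =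
      (N%:R * N.-1%:R / (4 * L ^+ 2)) * B2 * cos (t / L) ^+ 2.
    by field; rewrite gt_eqF.
  have n0 : 0 <= N%:R * N.-1%:R / (4 * L ^+ 2) :> R.
    by apply: divr_ge0; apply: mulr_ge0; rewrite ?sqr_ge0.
  rewrite normrM normrM (ger0_norm n0).
  apply: le_trans (_ : N%:R * N.-1%:R / (4 * L ^+ 2) * (2 * de ^+ 2) * 1 <= _).
    apply: ler_pM => //; first by rewrite mulr_ge0.
      by rewrite ler_wpM2l.
    by rewrite normrX exprn_ile1.
  rewrite mulr1.
  have -> : N%:R * N.-1%:R / (4 * L ^+ 2) * (2 * de ^+ 2) =
      2 / rho ^+ 2 * (N.-1%:R / N%:R).
    by rewrite /de; field; rewrite !gt_eqF.
  apply: ler_piMr; first by apply: divr_ge0; rewrite ?sqr_ge0.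
  by rewrite ler_pdivrMr// mul1r ler_nat leq_pred.
have e2 : `|N%:R * B1 * (- sin (t / L) / (2 * L ^+ 2))| <= 1 / rho ^+ 2.
  have -> : N%:R * B1 * (- sin (t / L) / (2 * L ^+ 2)) =
      (N%:R / (2 * L ^+ 2)) * B1 * - sin (t / L).
    by field; rewrite gt_eqF.
  have n0 : 0 <= N%:R / (2 * L ^+ 2) :> R.
    by apply: divr_ge0 => //; apply: mulr_ge0; rewrite ?sqr_ge0.
  rewrite normrM normrM (ger0_norm n0) normrN.
  apply: le_trans (_ : N%:R / (2 * L ^+ 2) * de * 1 <= _).
    apply: ler_pM => //; first by rewrite mulr_ge0.
    by rewrite ler_wpM2l.
  have -> : N%:R / (2 * L ^+ 2) * de * 1 = 1 / rho ^+ 2 * (rho / L).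
    by rewrite /de; field; rewrite !gt_eqF.
  apply: ler_piMr; first by apply: divr_ge0; rewrite ?sqr_ge0.
  by rewrite ler_pdivrMr// mul1r.
apply: le_trans (lerD e1 e2) _.
by rewrite -mulrDl (_ : 2 + 1 = 3 :> R)//; ring.
Qed.

Lemma step01 t : 0 <= step L rho N t <= 1.
Proof.
apply/andP; split.
  rewrite -[leLHS](bern_cst N _ (y t)); apply: (bern_le _ (y01 t)) => k.
  by have /andP[] := spline_ge0_le1 (L * (2 * k%:R / N%:R - 1) / rho).
rewrite -[leRHS](bern_cst N _ (y t)); apply: (bern_le _ (y01 t)) => k.
by have /andP[] := spline_ge0_le1 (L * (2 * k%:R / N%:R - 1) / rho).
Qed.

(** [sqr_derive_le] is applied to the step and to its complement. The smaller of [s] and [1 - s] is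
    at most [2 s (1 - s)], whence 12 as 4 times the 3 of [ddstep_le]. *)
Lemma dstep_sqr_le t : dstep t ^+ 2 <=
  12 / rho ^+ 2 * (step L rho N t * (1 - step L rho N t)).
Proof.
have M0 : 0 < 3 / rho ^+ 2 by rewrite divr_gt0// exprn_gt0.
have h1 := @sqr_derive_le (step L rho N) dstep ddstep _ M0 is_derive_step
  is_derive_dstep ddstep_le (fun t => (andP (step01 t)).1) t.
have h2 := @sqr_derive_le (fun t => 1 - step L rho N t) (fun t => - dstep t)
  (fun t => - ddstep t) _ M0.
have {}h2 : (- dstep t) ^+ 2 <= 2 * (3 / rho ^+ 2) * (1 - step L rho N t).
  apply: h2 => s.
  - have := is_deriveB (is_derive_cst (1 : R) s 1) (is_derive_step s).
    by rewrite sub0r.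
  - exact: is_deriveN.
  - by rewrite normrN ddstep_le.
  - by rewrite subr_ge0; have /andP[] := step01 s.
rewrite sqrrN in h2.
have -> : 12 / rho ^+ 2 = 4 * (3 / rho ^+ 2) by field; rewrite gt_eqF.
move: h1 h2 M0; set M := 3 / rho ^+ 2 => h1 h2 M0.
have /andP[s0 s1] := step01 t; set s := step _ _ _ _ in h1 h2 s0 s1 *.
have [hs|/ltW hs] := leP s (1 / 2).
  apply: le_trans h1 _.
  have -> : 2 * M * s = 4 * (M * s * (1 / 2)) by field.
  have -> : 4 * M * (s * (1 - s)) = 4 * (M * s * (1 - s)) by ring.
  apply: ler_wpM2l => //; apply: ler_wpM2l; [exact: mulr_ge0 (ltW M0) s0|lra].
apply: le_trans h2 _.
have -> : 2 * M * (1 - s) = 4 * (M * (1 - s) * (1 / 2)) by field.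
have -> : 4 * M * (s * (1 - s)) = 4 * (M * (1 - s) * s) by ring.
apply: ler_wpM2l => //; apply: ler_wpM2l; last by lra.
by apply: mulr_ge0 (ltW M0) _; rewrite subr_ge0.
Qed.

(** The Lipschitz bound is linear in the deviation [z], while [bern_approx] wants a quadratic one;
    [|z| <= e / 2 + z^2 / (2 e)] converts it, with [e] free to be optimized. *)
Lemma step_approx t (e : R) : 0 < e ->
  `|step L rho N t - spline (L * sin (t / L) / rho)| <=
  2 * L / rho * (e / 2 + (2 * e * N%:R)^-1).
Proof.
move=> e0; have Lr0 : 0 <= 2 * L / rho by rewrite divr_ge0 ?mulr_ge0 ?(ltW L0)// ltW.
have H := @bern_approx R N a (spline (L * sin (t / L) / rho)) (2 * L / rho * (e / 2))
  (2 * L / rho / (2 * e * N%:R ^+ 2)) (y t) (y01 t).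
have {}H := H _; rewrite /step -/a -/(y t); apply: le_trans (H _) _ => [k|].
  rewrite /a; apply: le_trans (spline_lipschitz _ _) _.
  have -> : L * (2 * k%:R / N%:R - 1) / rho - L * sin (t / L) / rho =
      2 * L / rho * ((k%:R - N%:R * y t) / N%:R).
    by rewrite /y; field; rewrite !gt_eqF.
  rewrite normrM (ger0_norm Lr0); set z := (k%:R - _) / _.
  have -> : 2 * L / rho * (e / 2) +
      2 * L / rho / (2 * e * N%:R ^+ 2) * (k%:R - N%:R * y t) ^+ 2 =
      2 * L / rho * (e / 2 + z ^+ 2 / (2 * e)).
    by rewrite /z; field; rewrite !gt_eqF.
  rewrite ler_wpM2l//.
  rewrite -subr_ge0 -(real_normK (num_real z)).
  have -> : e / 2 + `|z| ^+ 2 / (2 * e) - `|z| = (`|z| - e) ^+ 2 / (2 * e).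
    by field; rewrite gt_eqF.
  by rewrite divr_ge0 ?sqr_ge0// mulr_ge0// ltW.
have /andP[y0 y1] := y01 t.
have -> : 2 * L / rho * (e / 2) + 2 * L / rho / (2 * e * N%:R ^+ 2) *
    (N%:R * (y t * (1 - y t))) =
    2 * L / rho * (e / 2 + (2 * e * N%:R)^-1 * (y t * (1 - y t))).
  by field; rewrite !gt_eqF.
rewrite ler_wpM2l// lerD2l ler_piMr//; first by rewrite invr_ge0 !mulr_ge0// ltW.
by nra.
Qed.

Lemma is_trig_step (q : nat) (i : 'I_q) (m : R) :
  is_trig (fun x : 'rV[R]_q => step L rho N (x 0 i + m)).
Proof.
have ty : is_trig (fun x : 'rV[R]_q => y (x 0 i + m)).
  have h := is_trigZ (- 2^-1) (is_trig_cos (L^-1 *: delta_mx 0 i : 'rV[R]_q) (m / L + pi / 2)).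
  apply: eq_is_trig (is_trigD (is_trig_cst q (2^-1)) h) => x.
  rewrite addrA cosDpihalf /y.
  have -> : dot (L^-1 *: delta_mx 0 i) x + m / L = (x 0 i + m) / L.
    rewrite dotZl /dot (bigD1 i)//= big1 ?addr0.
      by rewrite mxE !eqxx mul1r; ring.
    by move=> k ki; rewrite mxE eqxx /= (negbTE ki) mul0r.
  by field.
suff gen M b : is_trig (fun x : 'rV[R]_q => bern M b (y (x 0 i + m))) by exact: gen.
elim: M b => [|M IH] b /=; first exact: is_trig_cst.
apply: is_trigD; apply: is_trigM => //.
apply: eq_is_trig (is_trigD (is_trig_cst q 1) (is_trigZ (-1) ty)) => x.
by rewrite mulN1r.
Qed.

End StepProperties.

(** The constant 48 does not involve [eta]: only the hidden period and degree depend on the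
    precision. *)
Lemma smooth_step (r eta : R) : 0 < r -> 0 < eta ->
  exists p dp : R -> R, [/\ forall t : R, is_derive t 1 p (dp t),
    forall t, 0 <= p t <= 1,
    forall t, dp t ^+ 2 <= 48 / r ^+ 2 * (p t * (1 - p t)),
    forall q (i : 'I_q) m, is_trig (fun x : 'rV[R]_q => p (x 0 i + m)) &
    forall t, `|p t - (0 <= t)%R%:R| <= (`|t| <= r)%R%:R + eta * (1 + t ^+ 2)].
Proof.
move=> r0 eta0.
(* For [0 <= t <= L] one has [L sin (t / L) >= t / 2], so with [rho = r / 2] the spline is already
   saturated at [t = r]. *)
pose rho := r / 2; have rho0 : 0 < rho by rewrite divr_gt0.
(* [L >= 1 + 1 / eta] makes [eta * t^2 >= 1] for [|t| > L], where periodicity leaves only the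
   trivial bound 1. *)
pose L := rho + r + (1 + eta^-1).
have ie0 : 0 < eta^-1 by rewrite invr_gt0.
have Lrho : rho <= L by rewrite /L; lra.
have L0 : 0 < L by lra.
pose La := 2 * L / rho; have La0 : 0 < La by rewrite divr_gt0// mulr_gt0.
(* Each of the two terms of [step_approx] is to be at most [eta / 2]: the first fixes [e], the
   second then fixes [N]. *)
pose e := eta / La; have e0 : 0 < e by rewrite divr_gt0.
pose N := (Num.truncn (La / (e * eta))).+1.
have Nr : La / (e * eta) <= N%:R.
  by rewrite /N ltW// truncnS_gt.
have approx t : `|step L rho N t - spline (L * sin (t / L) / rho)| <= eta.
  apply: le_trans (step_approx rho0 Lrho (ltn0Sn _) t e0) _.
  rewrite -/La mulrDr.
  have -> : La * (e / 2) = eta / 2 by rewrite /e; field; rewrite gt_eqF.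
  have Np : 0 < N%:R :> R by rewrite ltr0n.
  rewrite [leRHS]splitr lerD2l ler_pdivrMr; last by apply: mulr_gt0 => //; apply: mulr_gt0.
  have -> : eta / 2 * (2 * e * N%:R) = N%:R * (e * eta) by field.
  by move: Nr; rewrite (ler_pdivrMr _ _ (mulr_gt0 e0 eta0)).
exists (step L rho N), (fun t => N%:R * bern N.-1
  (fdiff (fun k => spline (L * (2 * k%:R / N%:R - 1) / rho)))
  ((1 + sin (t / L)) / 2) * (cos (t / L) / (2 * L))); split.
- by move=> t; apply: is_derive_step.
- by move=> t; apply: step01.
- move=> t; have := @dstep_sqr_le L rho N rho0 Lrho (ltn0Sn _) t.
  by rewrite (_ : 12 / rho ^+ 2 = 48 / r ^+ 2)// /rho; field; rewrite gt_eqF.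
- by move=> q i m; apply: is_trig_step.
- move=> t; have e1 : 0 <= eta * t ^+ 2 by rewrite mulr_ge0 ?sqr_ge0// ltW.
  have /andP[s0 s1] := step01 L rho N t.
  have triv : `|step L rho N t - (0 <= t)%R%:R| <= 1.
    by rewrite ler_norml; case: (0 <= t) => /=; apply/andP; split; lra.
  have [tr|rt] := leP `|t| r; first by rewrite /=; lra.
  have [tL|Lt] := leP `|t| L; last first.
    apply: le_trans triv _; rewrite /= add0r.
    have L1 : 1 <= L by rewrite /L; lra.
    have : eta * (1 + eta^-1) <= eta * t ^+ 2.
      rewrite ler_wpM2l ?(ltW eta0)// -(real_normK (num_real t)).
      have h1 : L * L <= `|t| ^+ 2 by rewrite expr2; apply: ler_pM => //; exact: ltW.
      have h2 : 1 + eta^-1 <= L by rewrite /L; lra.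
      apply: le_trans h2 (le_trans _ h1); apply: ler_peMr => //; exact: ltW.
    rewrite mulrDr mulr1 divff ?gt_eqF//; lra.
  suff -> : (0 <= t)%R%:R = spline (L * sin (t / L) / rho).
    apply: le_trans (approx t) _; rewrite /=; lra.
  have [t0|t0] := leP 0 t.
    rewrite (ger0_norm t0) in rt tL.
    rewrite spline1// ler_pdivlMr// mul1r.
    have := @sin_ge_half (t / L).
    rewrite divr_ge0 ?(ltW L0)//= ler_pdivrMr// mul1r tL => /(_ isT) h.
    have : L * (t / L / 2) <= L * sin (t / L) by rewrite ler_wpM2l// ltW.
    rewrite (_ : L * (t / L / 2) = t / 2); last by field; rewrite gt_eqF.
    by rewrite /rho; lra.
  rewrite (ltr0_norm t0) in rt tL.
  rewrite spline0// ler_pdivrMr// mulN1r.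
  have := @sin_ge_half (- t / L).
  rewrite divr_ge0 ?(ltW L0) ?oppr_ge0 ?(ltW t0)//= ler_pdivrMr// mul1r tL => /(_ isT).
  rewrite mulNr sinN => h.
  have : L * (- (t / L) / 2) <= L * - sin (t / L) by rewrite ler_wpM2l// ltW.
  rewrite (_ : L * (- (t / L) / 2) = - t / 2); last by field; rewrite gt_eqF.
  by rewrite /rho; lra.
Qed.

End SmoothStep.

(** * The multilinear extension of a Boolean function and its gradient *)

Section MultilinearExtension.
Variables (R : realType) (p dp : R -> R) (C : R).
Hypothesis derp : forall t : R, is_derive t 1 p (dp t).
Hypothesis p01 : forall t, 0 <= p t <= 1.
Hypothesis C0 : 0 <= C.
Hypothesis dp_le : forall t, dp t ^+ 2 <= C * (p t * (1 - p t)).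

(* Expectation of [F] when the k-th bit is set independently with probability
   [p (x k)]; bits are listed by decreasing index. *)
Fixpoint multilinear (k : nat) (F : seq bool -> R) (x : nat -> R) : R :=
  if k is k'.+1 then
    p (x k') * multilinear k' (fun s => F (true :: s)) x +
    (1 - p (x k')) * multilinear k' (fun s => F (false :: s)) x
  else F [::].

Definition signs (k : nat) (x : nat -> R) : seq bool :=
  rev (mkseq (fun i => 0 <= x i) k).

Lemma signsS k x : signs k.+1 x = (0 <= x k) :: signs k x.
Proof. by rewrite /signs mkseqS rev_rcons. Qed.

Lemma multilinear01 k F x : (forall s, 0 <= F s <= 1) ->
  0 <= multilinear k F x <= 1.
Proof.
elim: k F => [|k IH] F F01 /=; first exact: F01.
have /andP[a0 a1] := IH _ (fun s => F01 (true :: s)).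
have /andP[b0 b1] := IH _ (fun s => F01 (false :: s)).
have /andP[p0 p1] := p01 (x k).
apply/andP; split.
  by rewrite addr_ge0// mulr_ge0// subr_ge0.
set a := multilinear _ _ _ in a0 a1 *; set b := multilinear _ _ _ in b0 b1 *.
by nra.
Qed.

(** Replacing one random bit by the true sign bit moves the expectation by at most the probability
    that they differ; the costs add up. *)
Lemma multilinear_approx k F x : (forall s, 0 <= F s <= 1) ->
  `|multilinear k F x - F (signs k x)| <= \sum_(i < k) `|p (x i) - (0 <= x i)%R%:R|.
Proof.
elim: k F => [|k IH] F F01; first by rewrite big_ord0 /= /signs /= subrr normr0.
rewrite big_ord_recr /= signsS.
have /andP[a0 a1] := multilinear01 k x (fun s => F01 (true :: s)).
have /andP[b0 b1] := multilinear01 k x (fun s => F01 (false :: s)).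
have hA := IH _ (fun s => F01 (true :: s)).
have hB := IH _ (fun s => F01 (false :: s)).
have /andP[p0 p1] := p01 (x k).
set a := multilinear _ _ _ in a0 a1 hA *; set b := multilinear _ _ _ in b0 b1 hB *.
set S := \sum_(i < k) _ in hA hB *.
case: (0 <= x k).
  have -> : p (x k) * a + (1 - p (x k)) * b - F (true :: signs k x) =
      (a - F (true :: signs k x)) + (1 - p (x k)) * (b - a) by ring.
  apply: le_trans (ler_normD _ _) (lerD hA _).
  rewrite normrM (distrC (p _)) ger0_norm ?subr_ge0//.
  apply: ler_piMr; first by rewrite subr_ge0.
  by rewrite ler_norml; apply/andP; split; lra.
have -> : p (x k) * a + (1 - p (x k)) * b - F (false :: signs k x) =
    (b - F (false :: signs k x)) + p (x k) * (a - b) by ring.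
apply: le_trans (ler_normD _ _) (lerD hB _).
rewrite normrM subr0; apply: ler_piMr => //.
by rewrite ler_norml; apply/andP; split; lra.
Qed.

(** Cauchy-Schwarz for two terms: the cross term obeys [2 |x y| <= a v + b u]. *)
Lemma sqr_add_le (a b u v x y : R) : 0 <= a -> 0 <= b -> 0 <= u -> 0 <= v ->
  x ^+ 2 <= a * u -> y ^+ 2 <= b * v -> (x + y) ^+ 2 <= (a + b) * (u + v).
Proof.
move=> a0 b0 u0 v0 hx hy.
have h : (x * y) ^+ 2 <= (a * v) * (b * u).
  rewrite exprMn (_ : a * v * (b * u) = (a * u) * (b * v)); last by ring.
  by apply: ler_pM => //; exact: sqr_ge0.
have av : 0 <= a * v by exact: mulr_ge0.
have bu : 0 <= b * u by exact: mulr_ge0.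
have : `|2 * (x * y)| <= a * v + b * u.
  rewrite -ler_sqr ?nnegrE ?addr_ge0// real_normK ?num_real// exprMn.
  have := sqr_ge0 (a * v - b * u); nra.
rewrite ler_norml => /andP[_ ?].
have -> : (x + y) ^+ 2 = x ^+ 2 + 2 * (x * y) + y ^+ 2 by ring.
have -> : (a + b) * (u + v) = a * u + (a * v + b * u) + b * v by ring.
lra.
Qed.

(* Induction on the number of bits, using the variance decomposition
   f (1 - f) = p A (1 - A) + (1 - p) B (1 - B) + p (1 - p) (A - B)^2. *)
Lemma multilinear_gradient k F (c b : nat -> R) (t : R) :
  (forall s, 0 <= F s <= 1) ->
  exists2 l : R, is_derive t 1 (fun u : R => multilinear k F (fun i => c i + b i * u)) l &
    let f := multilinear k F (fun i => c i + b i * t) in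
    l ^+ 2 <= C * (\sum_(i < k) b i ^+ 2) * (f * (1 - f)).
Proof.
elim: k F => [|k IH] F F01.
  exists 0; first exact: is_derive_cst.
  by rewrite /= big_ord0 mulr0 mul0r expr0n.
have [la dA hA] := IH _ (fun s => F01 (true :: s)).
have [lb dB hB] := IH _ (fun s => F01 (false :: s)).
set x := fun i => c i + b i * t in hA hB *.
have /andP[a0 a1] := multilinear01 k x (fun s => F01 (true :: s)).
have /andP[b0 b1] := multilinear01 k x (fun s => F01 (false :: s)).
have dpk : is_derive t 1 (fun u : R => p (c k + b k * u)) (dp (x k) * b k).
  exact: is_derive_comp_affine.
have dqk : is_derive t 1 (fun u : R => 1 - p (c k + b k * u)) (- (dp (x k) * b k)).
  by have := is_deriveB (is_derive_cst (1 : R) t 1) dpk; rewrite sub0r.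
have := is_deriveD (is_deriveM dpk dA) (is_deriveM dqk dB).
set A := multilinear k (fun s => F (true :: s)) x in hA a0 a1 *.
set B := multilinear k (fun s => F (false :: s)) x in hB b0 b1 *.
set l := (X in is_derive _ _ _ X -> _) => dl.
exists l; first exact: dl.
have -> : l = dp (x k) * b k * (A - B) + (p (x k) * la + (1 - p (x k)) * lb).
  rewrite -[l]/(p (x k) * la + A * (dp (x k) * b k) +
    ((1 - p (x k)) * lb + B * - (dp (x k) * b k))); ring.
rewrite /= -/A -/B big_ord_recr /=.
have /andP[p0 p1] := p01 (x k); have dple := dp_le (x k).
set P := p (x k) in p0 p1 dple *; set s := \sum_(i < k) _ in hA hB *.
have s0 : 0 <= s by apply: sumr_ge0 => i _; exact: sqr_ge0.
have -> : (P * A + (1 - P) * B) * (1 - (P * A + (1 - P) * B)) =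
  P * (1 - P) * (A - B) ^+ 2 + (P * (A * (1 - A)) + (1 - P) * (B * (1 - B))) by ring.
have -> : C * (s + b k ^+ 2) = C * b k ^+ 2 + C * s by ring.
have q0 : 0 <= 1 - P by lra.
have A1 : 0 <= 1 - A by lra.
have B1 : 0 <= 1 - B by lra.
(* The derivative of bit [k] pairs [C * b k ^+ 2] with the between-branches variance; the remaining
   derivatives pair [C * s] with the mean variance within the branches. *)
apply: sqr_add_le.
- by rewrite mulr_ge0 ?sqr_ge0.
- exact: mulr_ge0.
- by rewrite mulr_ge0 ?sqr_ge0// mulr_ge0.
- by rewrite addr_ge0// mulr_ge0// mulr_ge0.
- have -> : (dp (x k) * b k * (A - B)) ^+ 2 = b k ^+ 2 * (A - B) ^+ 2 * dp (x k) ^+ 2 by ring.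
  have -> : C * b k ^+ 2 * (P * (1 - P) * (A - B) ^+ 2) =
    b k ^+ 2 * (A - B) ^+ 2 * (C * (P * (1 - P))) by ring.
  by apply: ler_wpM2l => //; rewrite mulr_ge0 ?sqr_ge0.
(* Convexity of the square; the induction hypotheses then apply to each branch. *)
- apply: le_trans (_ : P * la ^+ 2 + (1 - P) * lb ^+ 2 <= _).
    rewrite -subr_ge0.
    have -> : P * la ^+ 2 + (1 - P) * lb ^+ 2 - (P * la + (1 - P) * lb) ^+ 2 =
      P * (1 - P) * (la - lb) ^+ 2 by ring.
    by rewrite mulr_ge0 ?sqr_ge0// mulr_ge0.
  rewrite mulrDr lerD//.
  by rewrite [leRHS]mulrCA ler_wpM2l.
  by rewrite [leRHS]mulrCA ler_wpM2l.
Qed.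

Lemma is_trig_multilinear (q k : nat) F (g : nat -> 'rV[R]_q -> R) :
  (forall i, is_trig (fun x => p (g i x))) ->
  is_trig (fun x => multilinear k F (fun i => g i x)).
Proof.
move=> hg; elim: k F => [|k IH] F /=; first exact: is_trig_cst.
apply: is_trigD; apply: is_trigM => //.
apply: eq_is_trig (is_trigD (is_trig_cst q 1) (is_trigZ (-1) (hg k))) => x.
by rewrite mulN1r.
Qed.

End MultilinearExtension.

(** * The test function of a union of orthants *)

Section OrthantTestFunction.
Variables (R : realType) (q : nat).

Lemma union_of_orthants_sign (O : set (q.-tuple R)) (x y : q.-tuple R) :
  is_union_of_orthants O -> (forall i, (0 <= tnth x i) = (0 <= tnth y i)) ->
  O x -> O y.
Proof.
move=> [F [hF ->]] xy [A FA Ax]; exists A => //.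
have [b [_ AE]] := hF _ FA; move: Ax; rewrite AE /= => h i.
by rewrite -(h i) /sign xy.
Qed.

Lemma orthant_test_function (O : set (q.-tuple R)) (m : 'I_q -> R) (r eta tau : R) :
  is_union_of_orthants O -> 0 < r -> 0 < eta -> 0 <= tau ->
  exists f : trig R q,
    (forall b : 'rV[R]_q, (forall i, `|b 0 i| <= tau) ->
      forall x, `|ev (trigD b f) x| <= 4 * (tau * Num.sqrt q%:R) / r) /\
    (forall x, `|ev f x - \1_O [tuple x 0 i + m i | i < q]| <=
      \sum_i ((`|x 0 i + m i| <= r)%R%:R + eta * (1 + (x 0 i + m i) ^+ 2))).
Proof.
move=> hO r0 eta0 tau0.
have [p [dp [derp p01 dp_le ptrig papp]]] := smooth_step r0 eta0.
have C0 : 0 <= 48 / r ^+ 2 by rewrite divr_ge0 ?sqr_ge0.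
(* A canonical point with coordinates 1 or -1 in the orthant coded by [s]; it represents the orthant
   since membership in [O] depends on signs only. The reversal undoes the one in [signs]. *)
pose rep (s : seq bool) : q.-tuple R :=
  [tuple (if nth false (rev s) i then 1 else -1) | i < q].
pose F (s : seq bool) : R := \1_O (rep s).
have F01 s : 0 <= F s <= 1 by rewrite /F indicE; case: (_ \in _); rewrite /= ?lexx ler01.
(* Coordinates indexed by naturals, as [multilinear] wants; the default 0 is for indices from [q]
   on, which [multilinear q] does not read. *)
pose g (k : nat) (x : 'rV[R]_q) : R := if insub k is Some i then x 0 i + m i else 0.
have gE (i : 'I_q) x : g i x = x 0 i + m i.
  by rewrite /g; case: insubP => [j _ /val_inj ->//|]; rewrite ltn_ord.
have gtrig k : is_trig (fun x => p (g k x)).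
  by rewrite /g; case: insubP => [i _ _|_]; [exact: ptrig|exact: is_trig_cst].
have [f fE] := is_trig_multilinear q F gtrig.
exists f; split.
  move=> b bt x.
  pose c k := g k x; pose be (k : nat) : R := if insub k is Some i then b 0 i else 0.
  have gline (t : R) k : g k (x + t *: b) = c k + be k * t.
    rewrite /c /be /g; case: insubP => [i _ _|_]; last by rewrite mul0r addr0.
    by rewrite !mxE; ring.
  have [l dl hl] := multilinear_gradient derp p01 C0 dp_le q c be 0 F01.
  have dev := is_derive_ev f x b 0.
  have lineE : (fun u : R => ev f (x + u *: b)) =
      (fun u => multilinear p q F (fun i => c i + be i * u)).
    apply/funext => u; rewrite -fE; congr (multilinear p q F _).
    by apply/funext => k; rewrite gline.
  rewrite lineE scale0r addr0 in dev.
  have -> : ev (trigD b f) x = l.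
    by rewrite -(derive_val (is_derive := dev)) (derive_val (is_derive := dl)).
  have B0 : 0 <= 4 * (tau * Num.sqrt q%:R) / r.
    by rewrite divr_ge0 ?(ltW r0)// !mulr_ge0 ?sqrtr_ge0.
  rewrite -ler_sqr ?nnegrE// real_normK ?num_real//.
  apply: le_trans hl _; set v := multilinear _ _ _ _.
  have sumb : \sum_(i < q) be i ^+ 2 <= q%:R * tau ^+ 2.
    apply: le_trans (_ : \sum_(i < q) tau ^+ 2 <= _).
      apply: ler_sum => i _; rewrite /be.
      have -> : insub (i : nat) = Some i :> option 'I_q.
        by case: insubP => [j _ /val_inj ->//|]; rewrite ltn_ord.
      by rewrite -(real_normK (num_real (b 0 i))) ler_sqr ?nnegrE.
    by rewrite sumr_const card_ord mulr_natl.
  have v4 : v * (1 - v) <= 4^-1.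
    by rewrite -subr_ge0 [X in 0 <= X](_ : _ = (v - 2^-1) ^+ 2) ?sqr_ge0//; field.
  (* The variance factor [1 / 4] turns 48 into 12, which is rounded up to 16, the square of the 4 in
     the statement. *)
  apply: le_trans (_ : 48 / r ^+ 2 * (q%:R * tau ^+ 2) * 4^-1 <= _).
    apply: ler_pM.
    - by apply: mulr_ge0 => //; apply: sumr_ge0 => i _; exact: sqr_ge0.
    - have /andP[v0 v1] : 0 <= v <= 1 by apply: multilinear01.
      by rewrite mulr_ge0// subr_ge0.
    - by apply: ler_wpM2l.
    - exact: v4.
  have -> : (4 * (tau * Num.sqrt q%:R) / r) ^+ 2 = 16 * (tau ^+ 2 * q%:R) / r ^+ 2.
    rewrite -[in RHS](sqr_sqrtr (ler0n R q)); field; by rewrite gt_eqF.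
  have -> : 48 / r ^+ 2 * (q%:R * tau ^+ 2) / 4 = 12 * (tau ^+ 2 * q%:R) / r ^+ 2.
    by field; rewrite gt_eqF.
  rewrite ler_pM2r ?invr_gt0 ?exprn_gt0// ler_wpM2r ?mulr_ge0 ?sqr_ge0//; lra.
move=> x; rewrite -fE.
have -> : \1_O [tuple x 0 i + m i | i < q] = F (signs q (fun i => g i x)).
  have sE i : (0 <= tnth [tuple x 0 i + m i | i < q] i) =
      (0 <= tnth (rep (signs q (fun i => g i x))) i).
    rewrite !tnth_mktuple /signs revK nth_mkseq// gE.
    by case: (0 <= x 0 i + m i); rewrite ?ler01// ?lerN10// oppr_ge0 ler10.
  rewrite /F !indicE; congr ((_ : bool)%:R : R).
  by apply/idP/idP => /set_mem h; apply/mem_set; apply: union_of_orthants_sign h => // i.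
apply: le_trans (multilinear_approx p01 q _ F01) _.
by apply: ler_sum => i _; rewrite gE.
Qed.

End OrthantTestFunction.

(** * Almost sure equality, expectation and covariance *)

Section RealExpectation.
Context d (T : measurableType d) (R : realType) (P : probability T R).
Implicit Types f g : T -> R.

Lemma expectationEx f : integ P f -> 'E_P[f]%E = (Ex P f)%:E.
Proof. by move=> hf; rewrite unlock /Ex /Rintegral fineK//; exact: integrable_fin_num. Qed.

Lemma Ex_ae_eq f g : measurable_fun setT f -> measurable_fun setT g ->
  {ae P, forall w, f w = g w} -> Ex P f = Ex P g.
Proof.
move=> mf mg fg; rewrite /Ex /Rintegral; congr fine.
apply: ae_eq_integral => //; [exact/measurable_EFinP|exact/measurable_EFinP|].
by apply: filterS fg => w /= -> _.
Qed.

Lemma integ_ae_eq f g : measurable_fun setT f ->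
  {ae P, forall w, f w = g w} -> integ P g -> integ P f.
Proof.
move=> mf fg ig; have mg := integ_measurable ig.
apply/integrableP; split; first exact/measurable_EFinP.
move/integrableP : (ig) => [_]; congr (_ < _)%E; apply: ae_eq_integral => //.
- by apply: measurableT_comp => //; exact/measurable_EFinP.
- by apply: measurableT_comp => //; exact/measurable_EFinP.
- by apply: filterS fg => w /= ->.
Qed.

Lemma Ex_sqr_eq0 f : measurable_fun setT f -> Ex P (fun w => f w ^+ 2) = 0 ->
  integ P (fun w => f w ^+ 2) -> {ae P, forall w, f w = 0}.
Proof.
move=> mf f0 i2.
have m2 : measurable_fun setT (fun w => f w ^+ 2) by exact: measurable_funX.
have : (\int[P]_w `|(f w ^+ 2)%:E| = 0)%E.
  under eq_integral do rewrite gee0_abs ?lee_fin ?sqr_ge0//.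
  by rewrite -[LHS]fineK ?integrable_fin_num// -/(Rintegral _ _ _) -/(Ex P _) f0.
move/(ae_eq_integral_abs P measurableT); rewrite /ae_eq => H.
have /H {}H : measurable_fun setT (fun w => (f w ^+ 2)%:E) by exact/measurable_EFinP.
apply: filterS H => w /= /(_ I) [] /eqP.
by rewrite sqrf_eq0 => /eqP.
Qed.

Lemma covarianceEx f g (a b : R) : 'E_P[f]%E = a%:E -> 'E_P[g]%E = b%:E ->
  integ P (fun w => (f w - a) * (g w - b)) ->
  covariance P f g = (Ex P (fun w => (f w - a) * (g w - b)))%:E.
Proof.
move=> fa gb ifg; rewrite unlock fa gb /=.
by rewrite -expectationEx.
Qed.

End RealExpectation.

(** * Gaussian vectors with given mean and covariance *)

Section GaussianVector.
Context d (T : measurableType d) (R : realType) (P : probability T R) (q : nat).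
Variables (G : {RV P >-> q.-tuple R}) (m : 'I_q -> R) (S : 'M[R]_q).
Hypothesis gaussG : gaussian_vector G.
Hypothesis meanG : forall i, 'E_P[component G i]%E = (m i)%:E.
Hypothesis covG : forall i k,
  covariance P (component G i) (component G k) = (S i k)%:E.

Definition centered (w : T) : 'rV[R]_q := \row_i (component G i w - m i).
Local Notation Gc := centered.

Let mcomp i : measurable_fun setT (component G i).
Proof. by apply: (measurableT_comp (@measurable_tnth _ _ _ i)). Qed.

Lemma measurable_centered i : measurable_fun setT (fun w => Gc w 0 i).
Proof. by under eq_fun do rewrite mxE; exact: measurable_funB. Qed.

(** The linear form selecting coordinate [i] is Gaussian with an unspecified mean, which is
    identified by computing the expectation. *)
Let comp_law i : exists s : R, 0 <= s /\ forall A : set R, measurable A ->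
  P (component G i @^-1` A) = gaussian_law (m i) s A.
Proof.
have [m' [s [s0 hl]]] := gaussG (fun k => (k == i)%:R).
have E : (fun w => \sum_(k < q) (k == i)%:R * component G k w) = component G i.
  apply/funext => w; rewrite (bigD1 i)//= eqxx mul1r big1 ?addr0// => k /negbTE ->.
  by rewrite mul0r.
rewrite E in hl.
suff -> : m i = m' by exists s.
have i2 := gaussian_integ_sqr (mcomp i) s0 hl.
have i1 : integ P (component G i).
  have i1 : integ P (fun w => component G i w - m').
    by apply: integ_sqr i2; exact: measurable_funB.
  have := integD i1 (integ_cst P m'); congr integ.
  by apply/funext => w; rewrite subrK.
have := gaussian_mean (mcomp i) s0 hl.
by have := meanG i; rewrite expectationEx// => -[<-] <-.
Qed.

Let integGc i : integ P (fun w => Gc w 0 i ^+ 2).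
Proof.
have [s [s0 hl]] := comp_law i.
by under eq_fun do rewrite mxE; exact: gaussian_integ_sqr (mcomp i) s0 hl.
Qed.

Let integGcGc i k : integ P (fun w => Gc w 0 i * Gc w 0 k).
Proof.
apply: integ_le (integD (integGc i) (integGc k)) _.
  by apply: measurable_funM; exact: measurable_centered.
move=> w; rewrite normrM -(real_normK (num_real (Gc w 0 i))).
rewrite -(real_normK (num_real (Gc w 0 k))).
have := sqr_ge0 (`|Gc w 0 i| - `|Gc w 0 k|).
have := normr_ge0 (Gc w 0 i); have := normr_ge0 (Gc w 0 k); nra.
Qed.

Lemma Ex_centeredM i k : Ex P (fun w => Gc w 0 i * Gc w 0 k) = S i k.
Proof.
have := covG i k; rewrite (covarianceEx (meanG i) (meanG k)).
  by move=> [<-]; congr Ex; apply/funext => w; rewrite !mxE.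
by have := integGcGc i k; congr integ; apply/funext => w; rewrite !mxE.
Qed.

Lemma centered_symmetric xi eta : dot xi (eta *m S) = dot eta (xi *m S).
Proof.
rewrite /dot; under eq_bigr do rewrite mxE mulr_sumr.
under [in RHS]eq_bigr do rewrite mxE mulr_sumr.
rewrite exchange_big/=; apply: eq_bigr => i _; apply: eq_bigr => k _.
have -> : S i k = S k i.
  rewrite -!Ex_centeredM; congr Ex; apply/funext => w; exact: mulrC.
by ring.
Qed.

Let sqrE xi w : dot xi (Gc w) ^+ 2 =
  \sum_i \sum_k xi 0 i * xi 0 k * (Gc w 0 k * Gc w 0 i).
Proof.
rewrite expr2 {1}/dot mulr_suml; apply: eq_bigr => i _.
by rewrite mulr_sumr; apply: eq_bigr => k _; ring.
Qed.

Lemma centered_integ_sqr xi : integ P (fun w => dot xi (Gc w) ^+ 2).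
Proof.
under eq_fun do rewrite sqrE.
by apply: integ_sum => i; apply: integ_sum => k; exact: integZ.
Qed.

Lemma centered_variance xi : Ex P (fun w => dot xi (Gc w) ^+ 2) = qform S xi.
Proof.
under eq_fun do rewrite sqrE.
rewrite Ex_sum; last by move=> i; apply: integ_sum => k; exact: integZ.
apply: eq_bigr => i _; rewrite Ex_sum; last by move=> k; exact: integZ.
rewrite mxE mulr_sumr; apply: eq_bigr => k _.
by rewrite ExZ// Ex_centeredM mulrA.
Qed.

(** The linear form of [xi] is Gaussian with unspecified parameters; comparing means and variances
    shows that they are the expected ones, with [s^2 = qform S xi]. *)
Lemma centered_charfun xi (c : R) : Ex P (fun w => cos (dot xi (Gc w) + c)) =
  expR (- (qform S xi / 2)) * cos c.
Proof.
have [m' [s [s0 hl]]] := gaussG (fun k => xi 0 k).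
set X := fun w => \sum_(i < q) xi 0 i * component G i w in hl.
have mX : measurable_fun setT X.
  by apply: measurable_sum => i; exact: measurable_funM.
have XE w : X w = dot xi (Gc w) + \sum_i xi 0 i * m i.
  rewrite /X /dot -big_split /=; apply: eq_bigr => i _; rewrite mxE; ring.
have id : integ P (fun w => dot xi (Gc w)).
  apply: integ_sqr (centered_integ_sqr xi).
  by apply: measurable_dot; exact: measurable_centered.
have m0 : m' = \sum_i xi 0 i * m i.
  rewrite -(gaussian_mean mX s0 hl).
  have -> : X = (fun w => dot xi (Gc w) + \sum_i xi 0 i * m i) by exact/funext.
  rewrite ExD//; last exact: integ_cst.
  rewrite Ex_cst [X in X + _](_ : _ = 0) ?add0r//.
  have iGi i : integ P (fun w => Gc w 0 i).
    by apply: integ_sqr; [exact: measurable_centered|exact: integGc].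
  rewrite Ex_sum; last by move=> i; exact: integZ.
  rewrite big1// => i _; rewrite ExZ//.
  have [si [si0 hli]] := comp_law i.
  have -> : (fun w => Gc w 0 i) = (fun w => component G i w - m i).
    by apply/funext => w; rewrite mxE.
  have iG : integ P (component G i).
    have := integD (iGi i) (integ_cst P (m i)); congr integ.
    by apply/funext => w; rewrite mxE subrK.
  rewrite ExB//; last exact: integ_cst.
  by rewrite Ex_cst (gaussian_mean (mcomp i) si0 hli) subrr mulr0.
have XE' w : X w - m' = dot xi (Gc w) by rewrite XE m0 addrK.
have s2 : s ^+ 2 = qform S xi.
  rewrite -(gaussian_variance mX s0 hl) -centered_variance.
  by congr Ex; apply/funext => w; rewrite XE'.
have := gaussian_charfun mX s0 hl 1 c.
rewrite expr1n mulr1 s2 => <-; congr Ex; apply/funext => w.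
by rewrite mul1r XE'.
Qed.

Lemma component_anticoncentration i (r : R) : 0 < r -> 0 < S i i ->
  fine (P (component G i @^-1` `[- r, r])) <= 2 * r / Num.sqrt (S i i).
Proof.
move=> r0 Si0; have [s [s0 hl]] := comp_law i.
have s2 : s ^+ 2 = S i i.
  rewrite -(gaussian_variance (mcomp i) s0 hl) -Ex_centeredM.
  by congr Ex; apply/funext => w; rewrite mxE expr2.
have sp : 0 < s by rewrite lt0r s0 andbT; apply: contraTneq Si0 => s00; rewrite -s2 s00 expr0n/= ltxx.
rewrite -s2 sqrtr_sqr (gtr0_norm sp).
have := gaussian_anticoncentration hl sp (_ : - r <= r).
by rewrite opprK -mulr2n mulr_natl; apply; lra.
Qed.

End GaussianVector.

Lemma ae_forall_ord d (T : measurableType d) (R : realType) (P : probability T R)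
    (N : nat) (A : 'I_N -> T -> Prop) :
  (forall i, {ae P, forall w, A i w}) -> {ae P, forall w, forall i, A i w}.
Proof.
move=> hA.
have h k : {ae P, forall w, forall kN : (k < N)%N, A (Ordinal kN) w}.
  have [kN|Nk] := pselect (k < N)%N; last by apply: aeW => w kN.
  by apply: filterS (hA (Ordinal kN)) => w h kN'; rewrite (bool_irrelevance kN' kN).
by apply: filterS (ae_foralln h) => w hw [k kN]; exact: hw.
Qed.

(** * Clipping the summands on null sets *)

Section Clipping.
Context d (T : measurableType d) (R : realType) (P : probability T R) (q n : nat).
Variables (X : 'I_n -> {RV P >-> q.-tuple R}) (tau : R) (mu : 'I_n -> 'I_q -> R).
Hypothesis indX : independent_RVs X.
Hypothesis tau0 : 0 <= tau.
Hypothesis meanX : forall j i, 'E_P[component (X j) i]%E = (mu j i)%:E.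
Hypothesis bndX : forall i j, {ae P, forall w, `|component (X j) i w - mu j i| <= tau}.
Local Notation E := (Ex P).

Let good j : set (q.-tuple R) := [set x | forall i, `|tnth x i - mu j i| <= tau].

Let mdiff j i : measurable_fun setT (fun x : q.-tuple R => tnth x i - mu j i).
Proof. by apply: measurable_funB => //; exact: measurable_tnth. Qed.

Let mgood j : measurable (good j).
Proof.
rewrite (_ : good j = \bigcap_(i in [set: 'I_q])
    ((fun x : q.-tuple R => tnth x i - mu j i) @^-1` `[- tau, tau])).
  apply: fin_bigcap_measurable => // i _.
  by rewrite -[A in measurable A]setTI; apply: mdiff => //; exact: measurable_itv.
apply/seteqP; split => [x gx i _|x gx i].
  by rewrite /= in_itv/= -ler_norml; exact: gx.
by have := gx i I; rewrite /= in_itv/= -ler_norml.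
Qed.

Definition clip0 j (x : q.-tuple R) : 'rV[R]_q :=
  \row_i (\1_(good j) x * (tnth x i - mu j i)).

Let mclip0 j i : measurable_fun setT (fun x => clip0 j x 0 i).
Proof.
by under eq_fun do rewrite mxE; apply: measurable_funM => //; exact: measurable_indic.
Qed.

Let bclip0 j x i : `|clip0 j x 0 i| <= tau.
Proof.
rewrite mxE indicE; case: (boolP (x \in good j)) => [/set_mem gx|_].
  by rewrite mul1r; exact: gx.
by rewrite mul0r normr0.
Qed.

(** Built from [clip0], because the second clipping refers to its row space; [cov_matrixE] recovers
    the same matrix from the final variables. *)
Definition cov_matrix : 'M[R]_q := \matrix_(i, k)
  \sum_j E (fun w => clip0 j (X j w) 0 i * clip0 j (X j w) 0 k).
Local Notation S := cov_matrix.

Let inS j : set (q.-tuple R) := [set x | (clip0 j x <= S)%MS].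

Let minS j : measurable (inS j).
Proof.
rewrite (_ : inS j = \bigcap_(l in [set: 'I_q])
    ((fun x : q.-tuple R => (clip0 j x *m cokermx S) 0 l) @^-1` [set 0])).
  apply: fin_bigcap_measurable => // l _.
  rewrite -[A in measurable A]setTI.
  have h : measurable_fun setT (fun x : q.-tuple R => (clip0 j x *m cokermx S) 0 l).
    under eq_fun do rewrite mxE.
    by apply: measurable_sum => k; exact: measurable_funM.
  by apply: h.
apply/seteqP; split => [x|x h]; rewrite /inS /= submxE.
  by move=> /eqP h l _ /=; rewrite h mxE.
apply/eqP/matrixP => a l; rewrite ord1 [RHS]mxE; exact: (h l I).
Qed.

(** Membership in the row space is forced at every outcome, so that [pinvmx S] can be undone
    pointwise in the interpolation. *)
Definition clip j (x : q.-tuple R) : 'rV[R]_q := \1_(inS j) x *: clip0 j x.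

Let mclip j i : measurable_fun setT (fun x => clip j x 0 i).
Proof.
by under eq_fun do rewrite mxE; apply: measurable_funM => //; exact: measurable_indic.
Qed.

Let bclip j x i : `|clip j x 0 i| <= tau.
Proof.
rewrite mxE indicE; case: (_ \in _); first by rewrite mul1r.
by rewrite mul0r normr0.
Qed.

Definition Yclip j (w : T) : 'rV[R]_q := clip j (X j w).
Local Notation Y := Yclip.

Lemma measurable_Yclip j i : measurable_fun setT (fun w => Y j w 0 i).
Proof. exact: (measurableT_comp (mclip j i)). Qed.

Lemma Yclip_bounded j w i : `|Y j w 0 i| <= tau. Proof. exact: bclip. Qed.

Lemma Yclip_range j w : (Y j w <= S)%MS.
Proof.
rewrite /Y /clip indicE; case: (boolP (X j w \in inS j)) => [/set_mem h|_].
  by rewrite scale1r.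
by rewrite scale0r sub0mx.
Qed.

Let ae_good j : {ae P, forall w, good j (X j w)}.
Proof. by apply: ae_forall_ord => i; exact: bndX. Qed.

Let mY0 j i : measurable_fun setT (fun w => clip0 j (X j w) 0 i).
Proof. exact: (measurableT_comp (mclip0 j i)). Qed.

Let bmY0 j i : bounded_measurable (fun w => clip0 j (X j w) 0 i).
Proof. by split => //; exists tau => w; exact: bclip0. Qed.

Let symS i k : S i k = S k i.
Proof.
rewrite !mxE; apply: eq_bigr => j _; congr Ex; apply/funext => w; exact: mulrC.
Qed.

(** For a column [c] of [cokermx S] the form at [c] is 0. It is also the sum of the second moments
    of [<c, clip0 (X j)>], so each of these variables vanishes almost surely. *)
Let ae_inS j : {ae P, forall w, inS j (X j w)}.
Proof.
have H (l : 'I_q) : {ae P, forall w, (clip0 j (X j w) *m cokermx S) 0 l = 0}.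
  pose c : 'rV[R]_q := (col l (cokermx S))^T.
  have cE k w : dot c (clip0 k (X k w)) = (clip0 k (X k w) *m cokermx S) 0 l.
    by rewrite mxE; apply: eq_bigr => a _; rewrite !mxE mulrC.
  have bmc k : bounded_measurable (fun w => dot c (clip0 k (X k w))).
    exact: bm_dotr.
  have Qc : qform S c = 0.
    rewrite /qform /dot big1// => a _; rewrite [X in _ * X](_ : _ = 0) ?mulr0//.
    transitivity ((S *m cokermx S) a l); last by rewrite mulmx_coker mxE.
    by rewrite !mxE; apply: eq_bigr => k _; rewrite symS 2!mxE mulrC.
  have covS i k : S i k = \sum_j E (fun w => clip0 j (X j w) 0 i * clip0 j (X j w) 0 k).
    by rewrite mxE.
  have := qform_sum mY0 (fun j w i => bclip0 j (X j w) i) covS c; rewrite Qc => /esym.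
  move=> /eqP; rewrite psumr_eq0; last by move=> k _; apply: Ex_ge0 => w; exact: sqr_ge0.
  move=> /allP /(_ j (mem_index_enum _)) /= /eqP h.
  have := Ex_sqr_eq0 (bmc j).1 h (bm_integ P (bmX 2 (bmc j))).
  by apply: filterS => w; rewrite cE.
apply: filterS (ae_forall_ord H) => w h; rewrite /inS /= submxE.
by apply/eqP/matrixP => a l; rewrite ord1 [RHS]mxE; exact: h.
Qed.

Let aeY0 j : {ae P, forall w, Y j w = clip0 j (X j w)}.
Proof.
apply: filterS (ae_inS j) => w h.
by rewrite /Y /clip indicE mem_set// scale1r.
Qed.

Lemma Yclip_ae : {ae P, forall w, forall j i, Y j w 0 i = component (X j) i w - mu j i}.
Proof.
apply: ae_forall_ord => j; have := ae_good j; have := aeY0 j.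
apply: filterS2 => w -> g i.
by rewrite mxE indicE mem_set// mul1r.
Qed.

Let bmY j i : bounded_measurable (fun w => Y j w 0 i).
Proof. by split; [exact: measurable_Yclip|exists tau => w; exact: bclip]. Qed.

Let mX j i : measurable_fun setT (component (X j) i).
Proof. by apply: (measurableT_comp (@measurable_tnth _ _ _ i)). Qed.

Let aeYji j i : {ae P, forall w, component (X j) i w - mu j i = Y j w 0 i}.
Proof. by apply: filterS Yclip_ae => w h; rewrite h. Qed.

Let integX j i : integ P (component (X j) i).
Proof.
have h : integ P (fun w => component (X j) i w - mu j i).
  apply: integ_ae_eq (aeYji j i) (bm_integ P (bmY j i)).
  exact: measurable_funB.
have := integD h (integ_cst P (mu j i)); congr integ.
by apply/funext => w; rewrite subrK.
Qed.

Lemma Yclip_mean j i : E (fun w => Y j w 0 i) = 0.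
Proof.
rewrite -(Ex_ae_eq _ (measurable_Yclip j i) (aeYji j i)); last exact: measurable_funB.
rewrite ExB//; last exact: integ_cst.
by have := meanX j i; rewrite expectationEx// => -[->]; rewrite Ex_cst subrr.
Qed.

Lemma cov_matrixE i k : S i k = \sum_j E (fun w => Y j w 0 i * Y j w 0 k).
Proof.
rewrite mxE; apply: eq_bigr => j _; apply: Ex_ae_eq.
- exact: measurable_funM.
- by apply: measurable_funM; exact: measurable_Yclip.
- by apply: filterS (aeY0 j) => w ->.
Qed.

Lemma varianceYclip j i : 'V_P[component (X j) i]%E = (E (fun w => Y j w 0 i ^+ 2))%:E.
Proof.
have ae : {ae P, forall w, (component (X j) i w - mu j i) *
    (component (X j) i w - mu j i) = Y j w 0 i ^+ 2}.
  by apply: filterS (aeYji j i) => w ->.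
have m1 : measurable_fun setT (fun w => (component (X j) i w - mu j i) *
    (component (X j) i w - mu j i)).
  by apply: measurable_funM; exact: measurable_funB.
have bm2 := bmX 2 (bmY j i).
rewrite /variance (covarianceEx (meanX j i) (meanX j i)).
  by rewrite (Ex_ae_eq m1 bm2.1 ae).
exact: integ_ae_eq m1 ae (bm_integ P bm2).
Qed.

Let dflt : q.-tuple R := [tuple 0 | i < q].
(** The remaining sum as a function of [others]; skipping index [j] means that the filler entry is
    never read. *)
Let restf j (y : n.-tuple (q.-tuple R)) : 'rV[R]_q :=
  \sum_(k | k != j) clip k (tnth y k).

Let restE j w : rest Y j w = restf j (others X dflt j w).
Proof.
rewrite /rest /total (bigD1 j)//= addrAC subrr add0r; apply: eq_bigr => k kj.
by rewrite tnth_mktuple (negbTE kj).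
Qed.

Let mrestf j i : measurable_fun setT (fun y => restf j y 0 i).
Proof.
under eq_fun do rewrite summxE big_mkcond.
apply: measurable_sum => k; case: (k != j) => //.
exact: (measurableT_comp (mclip k i) (@measurable_tnth _ _ _ k)).
Qed.

Let mdot (dA : measure_display) (A : measurableType dA) xi (V : A -> 'rV[R]_q) :
  (forall i, measurable_fun setT (fun y => V y 0 i)) ->
  measurable_fun setT (fun y => dot xi (V y)).
Proof. by move=> hV; apply: measurable_sum => i; exact: measurable_funM. Qed.

Let dot_clip_bounded xi : exists M, forall j x, `|dot xi (clip j x)| <= M.
Proof.
exists (\sum_i `|xi 0 i| * tau) => j x.
apply: le_trans (ler_norm_sum _ _ _) _; apply: ler_sum => i _.
by rewrite normrM ler_wpM2l.
Qed.

Lemma Yclip_uncorrelated j xi zeta (c : R) :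
  E (fun w => dot xi (Y j w) * sin (dot zeta (rest Y j w) + c)) = 0.
Proof.
have [M hM] := dot_clip_bounded xi.
have -> : (fun w => dot xi (Y j w) * sin (dot zeta (rest Y j w) + c)) =
    (fun w => dot xi (clip j (X j w)) * sin (dot zeta (restf j (others X dflt j w)) + c)).
  by apply/funext => w; rewrite restE.
rewrite (@Ex_mul_others _ _ _ _ _ P n X dflt indX j (fun x => dot xi (clip j x))
  (fun y => sin (dot zeta (restf j y) + c)) M 1).
- rewrite [X in X * _](_ : _ = 0) ?mul0r//.
  rewrite Ex_sum; last by move=> i; apply: (bm_integ P (bmZ _ (bmY j i))).
  rewrite big1// => i _; rewrite ExZ; last exact: (bm_integ P (bmY j i)).
  by rewrite Yclip_mean mulr0.
- exact: mdot.
- apply: (@measurableT_comp _ _ _ _ _ _ (@sin R)).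
    by apply: continuous_measurable_fun; exact: continuous_sin.
  by apply: measurable_funD => //; exact: mdot.
- exact: hM.
- by move=> y; exact: sin_max.
Qed.

Lemma Yclip_independent_sqr j xi zeta (c : R) :
  E (fun w => dot xi (Y j w) ^+ 2 * cos (dot zeta (rest Y j w) + c)) =
  E (fun w => dot xi (Y j w) ^+ 2) * E (fun w => cos (dot zeta (rest Y j w) + c)).
Proof.
have [M hM] := dot_clip_bounded xi.
under [in LHS]eq_fun do rewrite restE.
rewrite (_ : (fun w => cos (dot zeta (rest Y j w) + c)) =
  (fun w => cos (dot zeta (restf j (others X dflt j w)) + c))); last first.
  by apply/funext => w; rewrite restE.
apply: (@Ex_mul_others _ _ _ _ _ P n X dflt indX j (fun x => dot xi (clip j x) ^+ 2)
  (fun y => cos (dot zeta (restf j y) + c)) (M ^+ 2) 1).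
- by apply: measurable_funX; exact: mdot.
- apply: (@measurableT_comp _ _ _ _ _ _ (@cos R)).
    by apply: continuous_measurable_fun; exact: continuous_cos.
  by apply: measurable_funD => //; exact: mdot.
- by move=> x; rewrite normrX lerXn2r ?nnegrE// (le_trans _ (hM j x)).
- by move=> y; exact: cos_max.
Qed.

Lemma Yclip_uncorrelated_coord i j (h : R -> R) (M : R) : measurable_fun setT h ->
  (forall x, `|h x| <= M) ->
  E (fun w => Y j w 0 i * h (\sum_k Y k w 0 i - Y j w 0 i)) = 0.
Proof.
move=> mh hM.
have -> : (fun w => Y j w 0 i * h (\sum_k Y k w 0 i - Y j w 0 i)) =
    (fun w => clip j (X j w) 0 i * h (restf j (others X dflt j w) 0 i)).
  by apply/funext => w; rewrite -restE !mxE summxE.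
rewrite (@Ex_mul_others _ _ _ _ _ P n X dflt indX j (fun x => clip j x 0 i)
  (fun y => h (restf j y 0 i)) tau M)//.
  by rewrite [X in X * _](Yclip_mean j i) mul0r.
exact: (measurableT_comp mh (mrestf j i)).
Qed.

Lemma Yclip_orthogonal i i' j k : j != k -> E (fun w => Y j w 0 i * Y k w 0 i') = 0.
Proof.
move=> jk.
have -> : (fun w => Y j w 0 i * Y k w 0 i') =
    (fun w => clip j (X j w) 0 i * clip k (tnth (others X dflt j w) k) 0 i').
  by apply/funext => w; rewrite tnth_mktuple eq_sym (negbTE jk).
rewrite (@Ex_mul_others _ _ _ _ _ P n X dflt indX j (fun x => clip j x 0 i)
  (fun y => clip k (tnth y k) 0 i') tau tau)//.
  by rewrite [X in X * _](Yclip_mean j i) mul0r.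
exact: (measurableT_comp (mclip k i') (@measurable_tnth _ _ _ k)).
Qed.

Lemma Yclip_sqr_independent i j k : j != k ->
  E (fun w => Y j w 0 i ^+ 2 * Y k w 0 i ^+ 2) =
  E (fun w => Y j w 0 i ^+ 2) * E (fun w => Y k w 0 i ^+ 2).
Proof.
move=> jk.
have E1 w : Y k w 0 i ^+ 2 = clip k (tnth (others X dflt j w) k) 0 i ^+ 2.
  by rewrite tnth_mktuple eq_sym (negbTE jk).
have b2 k' x : `|clip k' x 0 i ^+ 2| <= tau ^+ 2.
  by rewrite normrX lerXn2r ?nnegrE.
rewrite (_ : (fun w => Y k w 0 i ^+ 2) = (fun w =>
  clip k (tnth (others X dflt j w) k) 0 i ^+ 2)); last exact/funext.
rewrite (_ : (fun w => Y j w 0 i ^+ 2 * Y k w 0 i ^+ 2) = (fun w =>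
  clip j (X j w) 0 i ^+ 2 * clip k (tnth (others X dflt j w) k) 0 i ^+ 2)); last first.
  by apply/funext => w; rewrite E1.
apply: (@Ex_mul_others _ _ _ _ _ P n X dflt indX j (fun x => clip j x 0 i ^+ 2)
  (fun y => clip k (tnth y k) 0 i ^+ 2) (tau ^+ 2) (tau ^+ 2)) => //.
- exact: measurable_funX.
- apply: measurable_funX.
  exact: (measurableT_comp (mclip k i) (@measurable_tnth _ _ _ k)).
Qed.

Lemma cov_total i k : E (fun w => total Y w 0 i * total Y w 0 k) = S i k.
Proof.
under eq_fun do rewrite !summxE mulr_suml.
under eq_fun do under eq_bigr do rewrite mulr_sumr.
have bmYY j j' : bounded_measurable (fun w => Y j w 0 i * Y j' w 0 k) by exact: bmM.
rewrite Ex_sum; last by move=> j; apply/bm_integ/bm_sum.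
rewrite cov_matrixE; apply: eq_bigr => j _.
rewrite Ex_sum; last by move=> j'; exact: bm_integ.
rewrite (bigD1 j)//= big1 ?addr0// => j' jj'.
by apply: Yclip_orthogonal; rewrite eq_sym.
Qed.

Lemma total_mean i : E (fun w => total Y w 0 i) = 0.
Proof.
under eq_fun do rewrite summxE.
rewrite Ex_sum; last by move=> j; exact: bm_integ.
by rewrite big1// => j _; exact: Yclip_mean.
Qed.

End Clipping.

(** Any such union is the finite union of the sign cells whose representative it contains. *)
Lemma measurable_union_of_orthants (R : realType) (q : nat) (O : set (q.-tuple R)) :
  is_union_of_orthants O -> measurable O.
Proof.
move=> hO.
pose rep (b : {ffun 'I_q -> bool}) : q.-tuple R := [tuple (if b i then 1 else -1) | i < q].
pose C (b : {ffun 'I_q -> bool}) : set (q.-tuple R) :=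
  \bigcap_(i in [set: 'I_q]) ((fun x : q.-tuple R => 0 <= tnth x i) @^-1` [set b i]).
have repE b i : (0 <= tnth (rep b) i) = b i.
  by rewrite tnth_mktuple; case: (b i); rewrite ?ler01// oppr_ge0 ler10.
have -> : O = \bigcup_(b in [set b | O (rep b)]) C b.
  apply/seteqP; split => [x Ox|x [b /= Ob Cb]].
    exists [ffun i => 0 <= tnth x i] => /=; last by move=> i _ /=; rewrite ffunE.
    by apply: union_of_orthants_sign hO _ Ox => i; rewrite repE ffunE.
  by apply: union_of_orthants_sign hO _ Ob => i; rewrite repE; exact/esym/(Cb i I).
apply: fin_bigcup_measurable => // b _; apply: fin_bigcap_measurable => // i _.
rewrite -[A in measurable A]setTI.
have h : measurable_fun setT (fun x : q.-tuple R => 0 <= tnth x i).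
  by apply: measurable_fun_ler => //; exact: measurable_tnth.
exact: h.
Qed.

(** * From test functions to orthant probabilities *)

Section SmoothingError.
Context d (T : measurableType d) (R : realType) (P : probability T R) (q : nat).
Variables (V : T -> 'rV[R]_q) (m : 'I_q -> R) (O : set (q.-tuple R)) (r : R).
Hypothesis mV : forall i, measurable_fun setT (fun w => V w 0 i).
Hypothesis integV : forall i, integ P (fun w => (V w 0 i + m i) ^+ 2).
Hypothesis hO : is_union_of_orthants O.

Definition shifted (w : T) : q.-tuple R := [tuple V w 0 i + m i | i < q].

Lemma measurable_shifted : measurable_fun setT shifted.
Proof.
apply/measurable_fun_tnthP => i.
rewrite (_ : _ \o _ = fun w => V w 0 i + m i); first exact: measurable_funD.
by apply/funext => w; rewrite /= tnth_mktuple.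
Qed.

Lemma integ_indic_shifted : integ P (fun w => \1_O (shifted w)).
Proof.
have mO := measurable_union_of_orthants hO.
apply: (@integ_bounded _ _ _ _ _ 1).
  by apply: (measurableT_comp _ measurable_shifted); exact: measurable_indic.
by move=> w; rewrite indicE; case: (_ \in _); rewrite ?normr1 ?normr0.
Qed.

Lemma smoothing_error (f : trig R q) (eta : R) :
  (forall x, `|ev f x - \1_O [tuple x 0 i + m i | i < q]| <=
    \sum_i ((`|x 0 i + m i| <= r)%R%:R + eta * (1 + (x 0 i + m i) ^+ 2))) ->
  `|Ex P (fun w => ev f (V w)) - Ex P (fun w => \1_O (shifted w))| <=
  \sum_i fine (P ((fun w => V w 0 i + m i) @^-1` `[- r, r])) +
  eta * \sum_i (1 + Ex P (fun w => (V w 0 i + m i) ^+ 2)).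
Proof.
move=> hf.
have mVm i : measurable_fun setT (fun w => V w 0 i + m i) by exact: measurable_funD.
have mB i : measurable ((fun w => V w 0 i + m i) @^-1` `[- r, r]).
  by rewrite -[A in measurable A]setTI; apply: mVm => //; exact: measurable_itv.
have iev : integ P (fun w => ev f (V w)).
  have h : measurable_fun setT (fun w => ev f (V w)).
    by have := measurable_ev mV f 0 1; congr measurable_fun; apply/funext => w;
      rewrite add0r scale1r.
  apply: (@integ_bounded _ _ _ _ _ (\sum_(a <- f) `|a.1.1|)) => // w.
  apply: le_trans (ler_norm_sum _ _ _) _; apply: ler_sum => a _.
  by rewrite normrM ler_piMr// cos_max.
rewrite -ExB//; last exact: integ_indic_shifted.
have i1 i : integ P (fun w => \1_((fun w => V w 0 i + m i) @^-1` `[- r, r]) w +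
    eta * (1 + (V w 0 i + m i) ^+ 2)).
  apply: integD; first exact: integ_indic.
  by apply: integZ; apply: integD => //; exact: integ_cst.
apply: le_trans (_ : Ex P (fun w => \sum_i (\1_((fun w => V w 0 i + m i) @^-1` `[- r, r]) w +
    eta * (1 + (V w 0 i + m i) ^+ 2))) <= _).
  apply: normr_Ex_le; [|exact: integ_sum|].
    by apply: integB => //; exact: integ_indic_shifted.
  move=> w; apply: le_trans (hf (V w)) _; apply: ler_sum => i _.
  rewrite lerD2r indicE.
  have -> : (w \in (fun w => V w 0 i + m i) @^-1` `[- r, r]) = (`|V w 0 i + m i| <= r)%R.
    by apply/idP/idP; rewrite inE /= in_itv/= -ler_norml.
  by [].
rewrite Ex_sum// mulr_sumr -big_split /=.
apply: ler_sum => i _; rewrite ExD; last 2 first.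
- exact: integ_indic.
- by apply: integZ; apply: integD => //; exact: integ_cst.
rewrite Ex_probability// ExZ; last by apply: integD => //; exact: integ_cst.
by rewrite ExD ?Ex_cst//; exact: integ_cst.
Qed.

End SmoothingError.

(** * The quantitative bound when every deviation exceeds [tau] *)

Section RealBound.
Context d (T : measurableType d) (R : realType) (P : probability T R) (q n : nat).
Context d' (T' : measurableType d') (Q : probability T' R).
Variables (X : 'I_n -> {RV P >-> q.-tuple R}) (tau : R) (mu : 'I_n -> 'I_q -> R).
Variables (G : {RV Q >-> q.-tuple R}) (O : set (q.-tuple R)) (r : R).
Hypothesis indX : independent_RVs X.
Hypothesis tau0 : 0 <= tau.
Hypothesis meanX : forall j i, 'E_P[component (X j) i]%E = (mu j i)%:E.
Hypothesis bndX : forall i j, {ae P, forall w, `|component (X j) i w - mu j i| <= tau}.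
Hypothesis gaussG : gaussian_vector G.
Hypothesis sameGX : same_mean_and_covariance P Q (sum_RV X) G.
Hypothesis hO : is_union_of_orthants O.
Hypothesis r0 : 0 < r.

Local Notation S := (cov_matrix X tau mu).
Local Notation Y := (Yclip X tau mu).
Local Notation W := (total Y).
Let M i := \sum_j mu j i.

Let bmY j i : bounded_measurable (fun w => Y j w 0 i).
Proof.
by split; [exact: measurable_Yclip|exists tau => w; exact: Yclip_bounded].
Qed.

Let bmW i : bounded_measurable (fun w => W w 0 i).
Proof. by under eq_fun do rewrite summxE; exact: bm_sum. Qed.

Let aeW : {ae P, forall w, sum_RV X w = shifted W M w}.
Proof.
apply: filterS (Yclip_ae tau0 bndX) => w h; apply: eq_from_tnth => i.
rewrite !tnth_mktuple summxE /M -big_split /=; apply: eq_bigr => j _.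
by rewrite h subrK.
Qed.

Let mcomp_sum i : measurable_fun setT (component (sum_RV X) i).
Proof.
rewrite (_ : component _ i = fun w => \sum_j component (X j) i w).
  apply: measurable_sum => j.
  by apply: (measurableT_comp (@measurable_tnth _ _ _ i)).
by apply/funext => w; rewrite /component tnth_mktuple.
Qed.

Let ae_comp i : {ae P, forall w, component (sum_RV X) i w = W w 0 i + M i}.
Proof. by apply: filterS aeW => w h; rewrite /component h tnth_mktuple. Qed.

Let bmWM i : bounded_measurable (fun w => W w 0 i + M i).
Proof. by apply: bmD => //; exact: bm_cst. Qed.

Let mean_sum i : 'E_P[component (sum_RV X) i]%E = (M i)%:E.
Proof.
rewrite expectationEx; last exact: integ_ae_eq (ae_comp i) (bm_integ P (bmWM i)).
rewrite (Ex_ae_eq _ (bmWM i).1 (ae_comp i))// ExD; last 2 first.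
- exact: bm_integ.
- exact: integ_cst.
by rewrite (total_mean tau0 meanX bndX) Ex_cst add0r.
Qed.

Let cov_sum i k :
  covariance P (component (sum_RV X) i) (component (sum_RV X) k) = (S i k)%:E.
Proof.
have ae : {ae P, forall w, (component (sum_RV X) i w - M i) *
    (component (sum_RV X) k w - M k) = W w 0 i * W w 0 k}.
  by apply: filterS2 (ae_comp i) (ae_comp k) => w -> ->; rewrite !addrK.
have mm : measurable_fun setT (fun w => (component (sum_RV X) i w - M i) *
    (component (sum_RV X) k w - M k)).
  by apply: measurable_funM; exact: measurable_funB.
have bmWW := bmM (bmW i) (bmW k).
rewrite (covarianceEx (mean_sum i) (mean_sum k)).
  by rewrite (Ex_ae_eq mm bmWW.1 ae) (cov_total indX tau0 meanX bndX).
exact: integ_ae_eq mm ae (bm_integ P bmWW).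
Qed.

Let meanG i : 'E_Q[component G i]%E = (M i)%:E.
Proof. by rewrite sameGX.1 mean_sum. Qed.

Let covG i k : covariance Q (component G i) (component G k) = (S i k)%:E.
Proof. by rewrite sameGX.2 cov_sum. Qed.

Local Notation Gc := (centered G M).

Let mGc := measurable_centered G M.
Let symS := centered_symmetric gaussG meanG covG.
Let charG := centered_charfun gaussG meanG covG.
Let integG := centered_integ_sqr gaussG meanG.
Let varG := centered_variance gaussG meanG covG.

Let shiftedG : shifted Gc M = G.
Proof.
apply/funext => w; apply: eq_from_tnth => i.
by rewrite tnth_mktuple mxE subrK.
Qed.

Lemma probability_sumE : P (sum_RV X @^-1` O) = (Ex P (fun w => \1_O (shifted W M w)))%:E.
Proof.
have mS : measurable_fun setT (sum_RV X).
  by apply/measurable_fun_tnthP => i; exact: mcomp_sum.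
have mO := measurable_union_of_orthants hO.
have mSO : measurable (sum_RV X @^-1` O).
  by rewrite -[A in measurable A]setTI; exact: mS.
rewrite -[LHS]fineK ?fin_num_measure// -Ex_probability//; congr EFin.
apply: Ex_ae_eq; first exact: measurable_indic.
  have ms : measurable_fun setT (shifted W M).
    by apply: measurable_shifted => i; exact: (bmW i).1.
  by apply: (measurableT_comp _ ms); exact: measurable_indic.
by apply: filterS aeW => w h; rewrite -h !indicE; congr (_%:R);
  apply/idP/idP; rewrite !inE.
Qed.

Lemma probability_gaussianE : Q (G @^-1` O) = (Ex Q (fun w => \1_O (G w)))%:E.
Proof.
have mO := measurable_union_of_orthants hO.
have mGO : measurable (G @^-1` O).
  by rewrite -[A in measurable A]setTI; exact: measurable_funP.
by rewrite -[LHS]fineK ?fin_num_measure// -Ex_probability.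
Qed.

Lemma variance_sumE i : (\sum_(j < n) 'V_P[component (X j) i])%E = (S i i)%:E.
Proof.
under eq_bigr do rewrite (varianceYclip tau0 meanX bndX).
by rewrite sumEFin (cov_matrixE X mu tau0).
Qed.

(** For [n = 1] this gives [sigma_i <= tau], which places that case in the trivial regime. *)
Lemma cov_matrix_le i : S i i <= n%:R * tau ^+ 2.
Proof.
rewrite (cov_matrixE X mu tau0).
apply: le_trans (_ : \sum_(j < n) tau ^+ 2 <= _); last first.
  by rewrite sumr_const card_ord mulr_natl.
apply: ler_sum => j _; rewrite -[leRHS](Ex_cst P); apply: Ex_le.
- exact/bm_integ/bmM.
- exact: integ_cst.
- move=> w; rewrite -expr2 -(real_normK (num_real _)) ler_sqr ?nnegrE//.
  exact: Yclip_bounded.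
Qed.

Lemma real_bound : (1 < n)%N -> (0 < q)%N -> (forall i, tau < Num.sqrt (S i i)) ->
  `|Ex P (fun w => \1_O (shifted W M w)) - Ex Q (fun w => \1_O (G w))| <=
  22 * (tau * (q%:R * Num.sqrt q%:R) * ln n%:R / r +
        \sum_i (r + tau) / Num.sqrt (S i i)).
Proof.
move=> n1 q0 hs.
have n0 : (0 < n)%N by exact: ltn_trans n1.
have sp i : 0 < Num.sqrt (S i i) by exact: le_lt_trans tau0 (hs i).
have Sp i : 0 < S i i by rewrite -sqrtr_gt0.
pose A1 := \sum_i (1 + Ex P (fun w => (W w 0 i + M i) ^+ 2)).
pose A2 := \sum_i (1 + Ex Q (fun w => (Gc w 0 i + M i) ^+ 2)).
have A10 : 0 <= A1.
  by apply: sumr_ge0 => i _; rewrite addr_ge0// Ex_ge0// => w; exact: sqr_ge0.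
have A20 : 0 <= A2.
  by apply: sumr_ge0 => i _; rewrite addr_ge0// Ex_ge0// => w; exact: sqr_ge0.
have iG i : integ Q (fun w => (Gc w 0 i + M i) ^+ 2).
  have i2 : integ Q (fun w => Gc w 0 i ^+ 2).
    have := integG (delta_mx 0 i); congr integ; apply/funext => w.
    rewrite /dot (bigD1 i)//= big1 ?addr0 ?mxE ?eqxx ?mul1r// => k ki.
    by rewrite mxE eqxx /= (negbTE ki) mul0r.
  have i1 : integ Q (fun w => Gc w 0 i) by apply: integ_sqr i2; exact: mGc.
  have := integD i2 (integD (integZ (2 * M i) i1) (integ_cst Q (M i ^+ 2))).
  by congr integ; apply/funext => w; ring.
(* Since [tau < sigma_i], the term [tau^2 / sigma_i^2] is at most [tau / sigma_i], which raises
   [2 tau] to [3 tau]. *)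
have anti1 i : fine (P ((fun w => W w 0 i + M i) @^-1` `[- r, r])) <=
    (2 * r + 3 * tau) / Num.sqrt (S i i).
  have -> : (fun w => W w 0 i + M i) @^-1` `[- r, r] =
      (fun w => \sum_j Y j w 0 i) @^-1` `[- r - M i, r - M i].
    have WE w : \sum_j Y j w 0 i = W w 0 i by rewrite summxE.
    apply/seteqP; split => w /=; rewrite !in_itv /= WE; move: (W w 0 i) (M i) => a b;
      by move=> /andP[h1 h2]; apply/andP; split; lra.
  have varS : \sum_j Ex P (fun w => Y j w 0 i ^+ 2) = Num.sqrt (S i i) ^+ 2.
    by rewrite sqr_sqrtr ?(ltW (Sp i))// (cov_matrixE X mu tau0).
  have ab : - r - M i <= r - M i.
    by rewrite lerD2r (le_trans _ (ltW r0))// oppr_le0 ltW.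
  apply: le_trans (sum_anticoncentration (measurable_Yclip X tau mu ^~ i)
    (fun j w => Yclip_bounded X mu tau0 j w i) (sp i) varS
    (fun j h M' => @Yclip_uncorrelated_coord _ _ _ _ _ _ _ _ _ indX tau0 meanX bndX i j h M')
    (fun j k jk => Yclip_orthogonal indX tau0 meanX bndX i i jk)
    (fun j k jk => Yclip_sqr_independent mu indX tau0 i jk) ab) _.
  have -> : tau ^+ 2 / Num.sqrt (S i i) ^+ 2 =
      tau / Num.sqrt (S i i) * (tau / Num.sqrt (S i i)).
    by field; rewrite gt_eqF.
  have t1 : tau / Num.sqrt (S i i) <= 1 by rewrite ler_pdivrMr// mul1r ltW.
  have t0 : 0 <= tau / Num.sqrt (S i i) by rewrite divr_ge0// ltW.
  have h := ler_piMr t0 t1.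
  have -> : (2 * r + 3 * tau) / Num.sqrt (S i i) =
      (r - M i - (- r - M i) + 2 * tau) / Num.sqrt (S i i) + tau / Num.sqrt (S i i).
    by field; rewrite gt_eqF.
  by rewrite lerD2l.
have anti2 i : fine (Q ((fun w => Gc w 0 i + M i) @^-1` `[- r, r])) <=
    2 * r / Num.sqrt (S i i).
  have -> : (fun w => Gc w 0 i + M i) = component G i.
    by apply/funext => w; rewrite mxE subrK.
  exact: component_anticoncentration gaussG meanG covG _ _ r0 (Sp i).
pose K := 4 * (tau * Num.sqrt q%:R) / r.
have K0 : 0 <= K by rewrite divr_ge0 ?(ltW r0)// !mulr_ge0 ?sqrtr_ge0.
have main eta : 0 < eta ->
    `|Ex P (fun w => \1_O (shifted W M w)) - Ex Q (fun w => \1_O (G w))| <=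
    K * q%:R * (3 / 2 * ln n%:R + 2) +
    \sum_i (2 * r + 3 * tau) / Num.sqrt (S i i) + \sum_i 2 * r / Num.sqrt (S i i) +
    eta * (A1 + A2).
  move=> eta0.
  have [f [gradf appf]] := orthant_test_function M hO r0 eta0 tau0.
  have h1 := smoothing_error (fun i => (bmW i).1)
    (fun i => bm_integ P (bmX 2 (bmWM i))) hO appf.
  have h2 := smoothing_error mGc iG hO appf.
  have h3 := stein_bound (measurable_Yclip X tau mu) (Yclip_bounded X mu tau0)
    (Yclip_range X tau mu) (cov_matrixE X mu tau0)
    (Yclip_uncorrelated indX tau0 meanX bndX) (Yclip_independent_sqr mu indX tau0)
    (fun t s x eta M => @heat_smoothing _ _ _ _ _ _ _ mGc symS charG integG varG t s x eta M)
    (fun t s x eta M => @heat_smoothing2 _ _ _ _ _ _ _ mGc symS charG integG varG t s x eta M)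
    (qform_ge0 varG) gradf n0 q0 K0.
  rewrite (heatE mGc charG f 0 ler01) sqrtr1 in h3.
  have evE : (fun w => ev f (0 + 1 *: Gc w)) = (fun w => ev f (Gc w)).
    by apply/funext => w; rewrite add0r scale1r.
  rewrite evE in h3; rewrite shiftedG in h2.
  have l1 := ler_sum (index_enum 'I_q) (fun i (_ : true) => anti1 i).
  have l2 := ler_sum (index_enum 'I_q) (fun i (_ : true) => anti2 i).
  move: h1 h2 h3 l1 l2; rewrite -/A1 -/A2 mulrDr.
  set a := Ex P _; set b := Ex P _; set c := Ex Q _; set e := Ex Q _.
  move=> h1 h2 h3 l1 l2.
  have -> : b - e = - (a - b) + ((a - c) + (c - e)) by ring.
  apply: le_trans (ler_normD _ _) _; rewrite normrN.
  apply: le_trans (lerD h1 (ler_normD _ _)) _.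
  apply: le_trans (lerD (lexx _) (lerD h3 h2)) _.
  by move: l1 l2; rewrite /K; lra.
(* [eta] tends to 0: no other term depends on it. The added 1 in the denominator keeps it visibly
   positive. *)
have main' : `|Ex P (fun w => \1_O (shifted W M w)) - Ex Q (fun w => \1_O (G w))| <=
    K * q%:R * (3 / 2 * ln n%:R + 2) +
    \sum_i (2 * r + 3 * tau) / Num.sqrt (S i i) + \sum_i 2 * r / Num.sqrt (S i i).
  apply/ler_addgt0Pr => e e0.
  have A0 : 0 < A1 + A2 + 1 by lra.
  apply: le_trans (main (e / (A1 + A2 + 1)) (divr_gt0 e0 A0)) _.
  rewrite lerD2l mulrAC ler_pdivrMr//; apply: ler_wpM2l; lra.
apply: le_trans main' _.
(* Used to absorb the additive 2 into [4 ln n]; this gives [11 / 2], and 22 after multiplication by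
   the 4 in [K]. *)
have ln2 : 1 / 2 <= ln n%:R :> R.
  apply: le_trans (_ : ln 2 <= _); last by rewrite ler_ln ?posrE ?ltr0n// ler_nat.
  have : ln (1 + (- (1 / 2))) <= - (1 / 2) :> R by apply: le_ln1Dx; lra.
  rewrite (_ : 1 + - (1 / 2) = 2^-1); last by field.
  rewrite lnV ?posrE//; lra.
rewrite [leRHS]mulrDr -[leLHS]addrA; apply: lerD.
  have -> : 22 * (tau * (q%:R * Num.sqrt q%:R) * ln n%:R / r) =
      K * q%:R * (11 / 2 * ln n%:R).
    by rewrite /K; field; rewrite gt_eqF.
  apply: ler_wpM2l; first exact: mulr_ge0.
  lra.
rewrite -big_split /= mulr_sumr; apply: ler_sum => i _.
rewrite -mulrDl mulrA ler_pM2r ?invr_gt0// -subr_ge0.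
have -> : 22 * (r + tau) - (2 * r + 3 * tau + 2 * r) = 18 * r + 19 * tau by ring.
by rewrite addr_ge0 ?mulr_ge0 ?(ltW r0).
Qed.

End RealBound.

(** * Trivial regimes and the extended-real statement *)

Lemma ae_exists d (T : measurableType d) (R : realType) (P : probability T R)
    (A : T -> Prop) : {ae P, forall w, A w} -> exists w, A w.
Proof.
move=> [N [mN PN0 AN]]; apply/not_existsP => nA.
have : (P setT <= P N)%E.
  by apply: le_measure; rewrite ?inE//; move=> w _; apply: AN => /=; exact: nA.
by rewrite probability_setT [P N]PN0 lee_fin ler10.
Qed.

Lemma orthant_clt_bound (R : realType) (q n : nat) (d : measure_display)
    (T : measurableType d) (P : probability T R) (X : 'I_n -> {RV P >-> q.-tuple R})
    (tau : R) (d' : measure_display) (T' : measurableType d')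
    (Q : probability T' R) (G : {RV Q >-> q.-tuple R}) (O : set (q.-tuple R)) :
  (0 < n)%N -> (0 < q)%N ->
  independent_RVs X ->
  (forall (i : 'I_q) (j : 'I_n),
     {ae P, forall w,
        (`|(component (X j) i w)%:E - 'E_P[component (X j) i]| <= tau%:E)%E}) ->
  gaussian_vector G ->
  same_mean_and_covariance P Q (sum_RV X) G ->
  is_union_of_orthants O ->
  forall r : R, 0 < r ->
  (`|P (sum_RV X @^-1` O) - Q (G @^-1` O)| <=
     22%:E * ((tau * (q%:R `^ (3 / 2)) * ln n%:R / r)%:E +
             \sum_(i < q) ((r + tau)%:E /
                sqrte (\sum_(j < n) 'V_P[component (X j) i]))))%E.
Proof.
move=> n0 q0 indX bnd gaussG sameGX hO r r0.
(* An infinite mean would put every outcome at infinite distance, contradicting the bound at some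
   outcome. *)
have finE j i : 'E_P[component (X j) i]%E \is a fin_num.
  by have [w] := ae_exists (bnd i j); case: ('E_P[_]%E).
pose mu j i := fine 'E_P[component (X j) i]%E.
have meanX j i : 'E_P[component (X j) i]%E = (mu j i)%:E by rewrite fineK.
have bndX i j : {ae P, forall w, `|component (X j) i w - mu j i| <= tau}.
  by apply: filterS (bnd i j) => w; rewrite meanX -EFinB lee_fin.
have tau0 : 0 <= tau.
  by have [w] := ae_exists (bndX (Ordinal q0) (Ordinal n0)); exact: le_trans.
have fx := probability_sumE tau0 bndX hO.
have fG := probability_gaussianE G hO.
have rt0 : 0 < r + tau by rewrite ltr_pwDl.
under eq_bigr do rewrite (variance_sumE tau0 meanX bndX).
set S := cov_matrix X tau mu.
have ln0 : 0 <= ln n%:R :> R by rewrite ln_ge0// ler1n.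
have A0 : 0 <= tau * (q%:R `^ (3 / 2)) * ln n%:R / r.
  by rewrite divr_ge0 ?(ltW r0)// !mulr_ge0// powR_ge0.
have term0 i : (0 <= (r + tau)%:E / sqrte (S i i)%:E)%E.
  apply: mule_ge0; first by rewrite lee_fin ltW.
  by rewrite inve_ge0 lee_fin sqrtr_ge0.
(* If [sigma_i <= tau], the [i]-th term is at least 1, or [+oo] when [sigma_i = 0], while two
   probabilities differ by at most 1. *)
have [[i hi]|hs] := pselect (exists i, Num.sqrt (S i i) <= tau).
  apply: (@le_trans _ _ 1%E).
    have a1 : (0 <= P (sum_RV X @^-1` O) <= 1)%E.
      rewrite measure_ge0 probability_le1//.
      have mO := measurable_union_of_orthants hO.
      have mS : measurable_fun setT (sum_RV X).
        apply/measurable_fun_tnthP => k.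
        rewrite (_ : _ \o _ = fun w => \sum_j component (X j) k w).
          apply: measurable_sum => j.
          by apply: (measurableT_comp (@measurable_tnth _ _ _ k)).
        by apply/funext => w; rewrite /= tnth_mktuple.
      by rewrite -[A in measurable A]setTI; exact: mS.
    have b1 : (0 <= Q (G @^-1` O) <= 1)%E.
      rewrite measure_ge0 probability_le1//.
      have mO := measurable_union_of_orthants hO.
      by rewrite -[A in measurable A]setTI; exact: measurable_funP.
    move: a1 b1; rewrite fx fG -EFinB !lee_fin ler_norml.
    move=> /andP[? ?] /andP[? ?]; apply/andP; split; lra.
  apply: (@le_trans _ _ (22%:E * 1)%E); first by rewrite mule1 lee_fin; lra.
  rewrite lee_pmul2l ?lte_fin//.
  apply: (@le_trans _ _ (\sum_(i < q) (r + tau)%:E / sqrte (S i i)%:E)%E); last first.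
    by rewrite leeDr// lee_fin.
  rewrite (bigD1 i)//=; apply: (@le_trans _ _ ((r + tau)%:E / sqrte (S i i)%:E)%E).
    rewrite /= inver; case: eqP => [_|/eqP s0].
      by rewrite gt0_muley ?lte_fin// leey.
    have sp : 0 < Num.sqrt (S i i) by rewrite lt0r s0 sqrtr_ge0.
    by rewrite -EFinM lee_fin ler_pdivlMr// mul1r; apply: le_trans hi _; rewrite lerDr ltW.
  by apply: leeDl; apply: sume_ge0 => k _; exact: term0.
have hs' i : tau < Num.sqrt (S i i).
  by rewrite ltNge; apply/negP => h; apply: hs; exists i.
have n1 : (1 < n)%N.
  rewrite ltnNge; apply/negP => n1.
  have := hs' (Ordinal q0); apply/negP; rewrite -leNgt -(ger0_norm tau0) -sqrtr_sqr.
  rewrite ler_wsqrtr//; apply: le_trans (cov_matrix_le X mu tau0 _) _.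
  by rewrite ler_piMl ?sqr_ge0// lern1.
have sp i : 0 < Num.sqrt (S i i) by exact: le_lt_trans tau0 (hs' i).
have := real_bound indX tau0 meanX bndX gaussG sameGX hO r0 n1 q0 hs'.
rewrite fx fG -EFinB /= -lee_fin => /le_trans; apply.
have powE : q%:R `^ (3 / 2) = q%:R * Num.sqrt q%:R :> R.
  rewrite (_ : 3 / 2 = 1 + 2^-1); last by field.
  rewrite powRD; last by apply/implyP => _; rewrite pnatr_eq0 -lt0n.
  by rewrite powRr1// powR12_sqrt.
have termE : (\sum_(i < q) (r + tau)%:E / sqrte (S i i)%:E)%E =
    (\sum_(i < q) (r + tau) / Num.sqrt (S i i))%:E.
  by rewrite -sumEFin; apply: eq_bigr => i _; rewrite /= inver gt_eqF// -EFinM.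
by rewrite termE -EFinD -EFinM powE.
Qed.

Theorem theorem2p4 (R : realType) :
  exists C : R, 0 < C /\
  forall (q n : nat) (d : measure_display) (T : measurableType d)
    (P : probability T R) (X : 'I_n -> {RV P >-> q.-tuple R}) (tau : R)
    (d' : measure_display) (T' : measurableType d')
    (Q : probability T' R) (G : {RV Q >-> q.-tuple R})
    (O : set (q.-tuple R)),
  (0 < n)%N ->
  independent_RVs X ->
  (forall (i : 'I_q) (j : 'I_n),
     {ae P, forall w,
        (`|(component (X j) i w)%:E - 'E_P[component (X j) i]| <= tau%:E)%E}) ->
  gaussian_vector G ->
  same_mean_and_covariance P Q (sum_RV X) G ->
  is_union_of_orthants O ->
  forall r : R, 0 < r ->
  (`|P (sum_RV X @^-1` O) - Q (G @^-1` O)| <=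
     C%:E * ((tau * (q%:R `^ (3 / 2)) * ln n%:R / r)%:E +
             \sum_(i < q) ((r + tau)%:E /
                sqrte (\sum_(j < n) 'V_P[component (X j) i]))))%E.
Proof.
exists 22; split=> // -[|q] n d T P X tau d' T' Q G O n0; last first.
  exact: (@orthant_clt_bound R q.+1 n d T P X tau d' T' Q G O n0).
(* For [q = 0] the space is a single point, so both events are full or both are empty; the right
   side is 0 because [0^(3/2) = 0]. The sign of [tau] cannot be read off without a coordinate, hence
   the separate case. *)
move=> _ _ _ _ _ r r0.
have -> : (`|P (sum_RV X @^-1` O) - Q (G @^-1` O)| = 0)%E.
  have [Ot|nOt] := pselect (O [tuple]).
    rewrite (_ : _ @^-1` O = setT); last first.
      by apply/seteqP; split => // w _; rewrite /preimage/= [sum_RV X w]tuple0.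
    rewrite (_ : G @^-1` O = setT); last first.
      by apply/seteqP; split => // w _; rewrite /preimage/= [G w]tuple0.
    by rewrite !probability_setT subee// abse0.
  rewrite (_ : _ @^-1` O = set0); last first.
    by apply/seteqP; split => // w; rewrite /preimage/= [sum_RV X w]tuple0.
  rewrite (_ : G @^-1` O = set0); last first.
    by apply/seteqP; split => // w; rewrite /preimage/= [G w]tuple0.
  by rewrite !measure0 sube0 abse0.
by rewrite big_ord0 adde0 powR0 ?mulr0 ?mul0r ?mule0// mulf_neq0.
Qed.
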